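(* For every $(\mathbf{x},t)\in\bar\Omega\times[0,T]$, the state-constrained value function $$V(\mathbf{x},t):=\inf_{u\in\mathcal{U}}\left\{\int_t^T L(s,x(s),u(s))\,ds+g(x(T)) : \dot x(s)=f(s,x(s),u(s)),\ x(t)=\mathbf{x},\ x(s)\in\bar\Omega\ \text{for all } s\in[t,T]\right\}$$ can be represented as $$V(\mathbf{x},t)=\inf\left\{\int_t^T H^*(s,x(s),-\dot x(s))\,ds+g(x(T)) : x(t)=\mathbf{x},\ x(s)\in\bar\Omega\right\}$$ $$=\inf\left\{\int_t^T H^*(s,x(s),\beta(s))\,ds+g(x(T)) : x(t)=\mathbf{x},\ \dot x(s)=-\beta(s),\ x(s)\in\bar\Omega,\ \beta(s)\in\mathrm{Conv}(B(x(s),s))\right\}.$$ The first infimum on the right is over absolutely continuous curves $x:[t,T]\to\mathbb{R}^n$ (i.e. with $\dot x\in L^1$). The second is over pairs $(x,\beta)$ with $\beta:[t,T]\to\mathbb{R}^n$ measurable and $x$ absolutely continuous. The state constraint holds for all $s\in[t,T]$ and the constraints on $\dot x$ and $\beta$ for a.e. $s\in[t,T]$.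
   Context: Fix $T>0$ and a (nonempty) compact control set $U\subset\mathbb{R}^m$; $\mathcal{U}:=\{u:[0,T]\to U : u\text{ is measurable}\}$. Standing assumptions: $f:[0,T]\times\mathbb{R}^n\times U\to\mathbb{R}^n$ and $L:[0,T]\times\mathbb{R}^n\times U\to[0,\infty)$ are such that $f(t,\mathbf{x},a)$ and $L(t,\mathbf{x},a)$ are Lipschitz continuous in $t$ and $\mathbf{x}$ for each $a\in U$; $g:\mathbb{R}^n\to\mathbb{R}$ is Lipschitz continuous and uniformly bounded. $\Omega\subset\mathbb{R}^n$ is a bounded open set whose closure $\bar\Omega$ is convex and compact. Boundary assumption: there exists $\nu>0$ such that for all $\mathbf{x}\in\partial\Omega$ and $t\in[0,T]$ there exists $a\in U$ with $f(t,\mathbf{x},a)\cdot n(\mathbf{x})\le-\nu$, where $n(\mathbf{x})$ is the outward unit normal vector to $\partial\Omega$ at $\mathbf{x}$. The feasible set of negative vector fields is $B(\mathbf{x},t):=\{-f(t,\mathbf{x},a):a\in U\}$, which is compact for every $(\mathbf{x},t)$. $\mathrm{Conv}(A)$ denotes the convex hull of $A$. The Hamiltonian is $H(t,\mathbf{x},p):=\sup_{a\in U}\{-p\cdot f(t,\mathbf{x},a)-L(t,\mathbf{x},a)\}$, and its convex conjugate in the last variable is $H^*(t,\mathbf{x},b):=\sup_{p\in\mathbb{R}^n}\{p\cdot b-H(t,\mathbf{x},p)\}\in(-\infty,+\infty]$.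
   Formalization: The Lipschitz constants of f and L in (t,x) are taken to be uniform over a in U; with constants depending arbitrarily on a, the stated representation is false (the relaxed value can be strictly smaller than V). *)

(* Defs.v *)
From HB Require Import structures.
From mathcomp Require Import all_boot all_order all_algebra.
From mathcomp Require Import all_classical all_reals all_analysis.

Set Implicit Arguments.
Unset Strict Implicit.
Unset Printing Implicit Defensive.

Import Order.TTheory GRing.Theory Num.Theory.
Import numFieldNormedType.Exports.

Local Open Scope classical_set_scope.
Local Open Scope ring_scope.

(* R^n is 'rV[R]_n.  Its norm `|v| is the sup norm, used only where the choice
   of norm is immaterial (topology, Lipschitz and absolute continuity);
   Euclidean notions go through [dot]. *)
Definition dot (R : realType) (n : nat) (v w : 'rV[R]_n) : R :=
  \sum_(i < n) v ord0 i * w ord0 i.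

Definition boundary (T : topologicalType) (A : set T) : set T :=
  closure A `\` interior A.

Definition unit_supporting_normal (R : realType) (n : nat)
    (A : set 'rV[R]_n) (x v : 'rV[R]_n) : Prop :=
  dot v v = 1 /\ forall y, A y -> dot v (y - x) <= 0.

(* The outward unit normal to the boundary of Omega at x, for Omega with convex
   closure: the one and only unit vector supporting [closure Omega] at x. *)
Definition is_outward_unit_normal (R : realType) (n : nat)
    (Omega : set 'rV[R]_n) (x v : 'rV[R]_n) : Prop :=
  unique (unit_supporting_normal (closure Omega) x) v.

Definition convex_hull (R : realType) (n : nat) (A : set 'rV[R]_n) :
    set 'rV[R]_n :=
  smallest (@convex_set R 'rV[R]_n) A.

(* Borel measurability; a Lebesgue-measurable function on D agrees a.e. with
   such a function, which leaves the infima below unchanged. *)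
Definition measurable_vec (R : realType) (k : nat) (D : set R)
    (u : R -> 'rV[R]_k) : Prop :=
  forall j : 'I_k, measurable_fun D (fun s => u s ord0 j).

Definition absolutely_continuous (R : realType) (n : nat) (a b : R)
    (x : R -> 'rV[R]_n) : Prop :=
  forall e : R, 0 < e -> exists2 d : R, 0 < d &
    forall (k : nat) (p q : 'I_k -> R),
      (forall i, [/\ a <= p i, p i <= q i & q i <= b]) ->
      trivIset [set: 'I_k] (fun i => `]p i, q i[%classic) ->
      \sum_(i < k) (q i - p i) < d ->
      \sum_(i < k) `|x (q i) - x (p i)| < e.

(* Absolutely continuous curves on [a, b], with derivative in L^1.  Curves are
   total functions on R; only their values on [a, b] matter, because derive1 x is
   used only almost everywhere on [a, b].  The a.e. derivability is recorded
   because derive1 x s is a junk value where x is not derivable. *)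
Definition ac_curve (R : realType) (n : nat) (a b : R) (x : R -> 'rV[R]_n) :
    Prop :=
  [/\ absolutely_continuous a b x,
      {ae lebesgue_measure, forall s : R, s \in `[a, b] -> derivable x s 1} &
      forall i : 'I_n, lebesgue_measure.-integrable `[a, b]
        (fun s => (derive1 x s ord0 i)%:E)].

Section control_problem.
Context (R : realType) (n m : nat).
Variables (T : R) (U : set 'rV[R]_m).
Variables (f : R -> 'rV[R]_n -> 'rV[R]_m -> 'rV[R]_n).
Variables (L : R -> 'rV[R]_n -> 'rV[R]_m -> R) (g : 'rV[R]_n -> R).
Variable (Omega : set 'rV[R]_n).

Definition control (u : R -> 'rV[R]_m) : Prop :=
  measurable_vec `[0, T] u /\ forall s, s \in `[0, T] -> U (u s).

Definition neg_fields (x : 'rV[R]_n) (t : R) : set 'rV[R]_n :=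
  [set - f t x a | a in U].

Definition hamiltonian (t : R) (x p : 'rV[R]_n) : \bar R :=
  ereal_sup [set (- dot p (f t x a) - L t x a)%:E | a in U].

Definition hamiltonian_conj (t : R) (x b : 'rV[R]_n) : \bar R :=
  ereal_sup [set ((dot p b)%:E - hamiltonian t x p)%E | p in [set: 'rV[R]_n]].

Definition constrained_curve (x0 : 'rV[R]_n) (t : R) (x : R -> 'rV[R]_n) :
    Prop :=
  [/\ ac_curve t T x, x t = x0 &
      forall s, s \in `[t, T] -> closure Omega (x s)].

(* No measurability of L in a is assumed: for the nonnegative integrand
   L s (x s) (u s) the library integral is the supremum of the integrals of the
   measurable simple functions below it, so it is always meaningful. *)
Definition value_function (x0 : 'rV[R]_n) (t : R) : \bar R :=
  ereal_inf [set c | exists u x,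
    [/\ control u, constrained_curve x0 t x,
        {ae lebesgue_measure, forall s : R, s \in `[t, T] ->
          derive1 x s = f s (x s) (u s)} &
        c = (\int[lebesgue_measure]_(s in `[t, T]) (L s (x s) (u s))%:E
             + (g (x T))%:E)%E]].

Definition value_variational (x0 : 'rV[R]_n) (t : R) : \bar R :=
  ereal_inf [set c | exists x,
    constrained_curve x0 t x /\
    c = (\int[lebesgue_measure]_(s in `[t, T])
           hamiltonian_conj s (x s) (- derive1 x s)
         + (g (x T))%:E)%E].

Definition value_relaxed (x0 : 'rV[R]_n) (t : R) : \bar R :=
  ereal_inf [set c | exists x beta,
    [/\ constrained_curve x0 t x, measurable_vec `[t, T] beta,
        {ae lebesgue_measure, forall s : R, s \in `[t, T] ->
          derive1 x s = - beta s},
        {ae lebesgue_measure, forall s : R, s \in `[t, T] ->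
          convex_hull (neg_fields (x s) s) (beta s)} &
        c = (\int[lebesgue_measure]_(s in `[t, T])
               hamiltonian_conj s (x s) (beta s)
             + (g (x T))%:E)%E]].

End control_problem.

(* A single Lipschitz constant, valid for every a in U. *)
Definition lipschitz_tx (R : realType) (n m : nat) (V : normedModType R)
    (T : R) (U : set 'rV[R]_m) (F : R -> 'rV[R]_n -> 'rV[R]_m -> V) : Prop :=
  exists K : R, forall a, U a ->
    forall s t x y, s \in `[0, T] -> t \in `[0, T] ->
      `|F s x a - F t y a| <= K * (`|s - t| + `|x - y|).

(* Main.v *)
Require Import Defs.
From HB Require Import structures.
From mathcomp Require Import all_boot all_order all_algebra.
From mathcomp Require Import all_classical all_reals all_analysis.
From mathcomp Require Import measurable_realfun.
From mathcomp Require Import ring lra.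

Set Implicit Arguments.
Unset Strict Implicit.
Unset Printing Implicit Defensive.

Import Order.TTheory GRing.Theory Num.Theory.
Import numFieldNormedType.Exports.

Local Open Scope classical_set_scope.
Local Open Scope ring_scope.

(** Two inequalities are soft.  The conjugate [H^*] lies below the cost of every
    control, so the variational value is at most the value function, and the
    variational and relaxed costs of a curve coincide.  That a curve of finite
    cost is admissible for the relaxed problem is a statement about its velocity:
    by [averaged_velocity], mean velocities over short intervals are close to
    mixtures of admissible velocities, so the velocity lies in the closed convex
    hull of the admissible ones, and the hull of a compact set is closed by
    Caratheodory's theorem ([velocity_in_convex_hull]).

    The substance is that the value function does not exceed the variational
    value: a curve [x] in the closed set, of finite conjugate cost, has to be
    followed by genuine trajectories that stay in the set and cost hardly more.

    Mixtures come from convex duality.  The conjugate is the largest function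
    below all affine minorants of the cost.  If mean velocity and mean conjugate
    cost of [x] over a short interval were far from the mixtures of pairs
    (velocity, cost) available at the left end point, a separating functional
    could be integrated along the interval, by the fundamental theorem of calculus
    for absolutely continuous curves, to a contradiction.  A mixture is then
    realised by [chattering] between finitely many constant controls, so that all
    controls are step functions; this takes the place of a measurable selection.

    The state constraint is met by pushing.  A compactness argument
    ([inward_uniform]) makes the inward condition uniform: near each point one
    control, of bounded cost, points inward relative to all almost normal
    directions.  The new trajectory runs along the reference curve more slowly and
    spends the time gained on inward controls.  Since the data depend on time and
    state, the lag accumulated so far causes an error proportional to it; letting
    the lag grow exponentially, at a large rate [lam], makes the current push
    dominate this error at all times.  The invariant [pushed] expresses that the
    displacement from the reference point is inward by an amount proportional to
    the lag in all directions in which the trajectory is close to the boundary; it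
    passes from one step to the next ([pushed_step]) and leaves room of the order
    of the lag.  As the initial lag tends to zero, end point and cost converge to
    those of [x] ([approximating_trajectory]).

    Costs need not be measurable along a curve.  For a nonnegative integrand the
    integral is then a lower integral, and the proof uses of it that it is
    monotone and superadditive over disjoint domains. *)

(** * Euclidean products, norms and projections *)

Section dot_product.
Context {R : realType} {n : nat}.
Implicit Types u v w : 'rV[R]_n.

Lemma dotC v w : dot v w = dot w v.
Proof. by apply: eq_bigr => i _; rewrite mulrC. Qed.

Lemma dotDr v w1 w2 : dot v (w1 + w2) = dot v w1 + dot v w2.
Proof. by rewrite -big_split/=; apply: eq_bigr => i _; rewrite !mxE mulrDr. Qed.

Lemma dotZr v a w : dot v (a *: w) = a * dot v w.
Proof. by rewrite mulr_sumr; apply: eq_bigr => i _; rewrite !mxE mulrCA. Qed.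

Lemma dotNr v w : dot v (- w) = - dot v w.
Proof. by rewrite -scaleN1r dotZr mulN1r. Qed.

Lemma dotBr v w1 w2 : dot v (w1 - w2) = dot v w1 - dot v w2.
Proof. by rewrite dotDr dotNr. Qed.

Lemma dot0r v : dot v 0 = 0.
Proof. by rewrite -(scale0r 0) dotZr mul0r. Qed.

Lemma dotDl v1 v2 w : dot (v1 + v2) w = dot v1 w + dot v2 w.
Proof. by rewrite dotC dotDr !(dotC w). Qed.

Lemma dotZl a v w : dot (a *: v) w = a * dot v w.
Proof. by rewrite dotC dotZr (dotC w). Qed.

Lemma dotNl v w : dot (- v) w = - dot v w.
Proof. by rewrite dotC dotNr (dotC w). Qed.

Lemma dot0l w : dot 0 w = 0.
Proof. by rewrite dotC dot0r. Qed.

Lemma dot_sqrDZ v a w :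
  dot (v + a *: w) (v + a *: w) = dot v v + a * (2 * dot v w + a * dot w w).
Proof. rewrite dotDl !dotDr !dotZl !dotZr (dotC w v); ring. Qed.

Lemma norm_coord v i : `|v ord0 i| <= `|v|.
Proof.
rewrite [leRHS]/Num.Def.normr /= mx_normrE; apply/bigmax_geP; right => /=.
by exists (ord0, i).
Qed.

Lemma row_norm_le v (b : R) : 0 <= b -> (forall i, `|v ord0 i| <= b) -> `|v| <= b.
Proof.
move=> b0 vb; rewrite [leLHS]/Num.Def.normr /= mx_normrE; apply/bigmax_leP; split=> //.
by move=> [i j] _ /=; rewrite ord1.
Qed.

Lemma dot_coord_le v i : v ord0 i ^+ 2 <= dot v v.
Proof.
rewrite /dot (bigD1 i)//= expr2 lerDl sumr_ge0// => j _.
by rewrite -expr2 sqr_ge0.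
Qed.

Lemma dot_ge0 v : 0 <= dot v v.
Proof. by apply: sumr_ge0 => i _; rewrite -expr2 sqr_ge0. Qed.

Lemma sqr_norm_le_dot v : `|v| ^+ 2 <= dot v v.
Proof.
rewrite -[leRHS]sqr_sqrtr ?dot_ge0// lerXn2r ?nnegrE ?sqrtr_ge0//.
apply: row_norm_le; first exact: sqrtr_ge0.
by move=> i; rewrite -sqrtr_sqr ler_wsqrtr// dot_coord_le.
Qed.

Lemma norm_dot_le v w : `|dot v w| <= n%:R * (`|v| * `|w|).
Proof.
apply: le_trans (ler_norm_sum _ _ _) _.
rewrite mulr_natl -[X in _ *+ X]card_ord -sumr_const; apply: ler_sum => i _.
by rewrite normrM ler_pM// norm_coord.
Qed.

Lemma unit_norm_le1 v : dot v v = 1 -> `|v| <= 1.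
Proof.
move=> v1; rewrite -(@ler_pXn2r _ 2)// ?nnegrE// expr1n -v1.
exact: sqr_norm_le_dot.
Qed.

Lemma norm_dot_unit v w : dot v v = 1 -> `|dot v w| <= n%:R * `|w|.
Proof.
move=> v1; apply: le_trans (norm_dot_le _ _) _.
by rewrite ler_wpM2l// ler_piMl// unit_norm_le1.
Qed.

Lemma dot_unit_le v w : dot v v = 1 -> dot v w <= n%:R * `|w|.
Proof. by move=> v1; apply: le_trans (ler_norm _) (norm_dot_unit _ _). Qed.

Lemma cvg_dot (T : Type) (F : set_system T) (FF : Filter F)
    (g h : T -> 'rV[R]_n) v w :
  g @ F --> v -> h @ F --> w -> (fun t => dot (g t) (h t)) @ F --> dot v w.
Proof.
move=> gv hw; rewrite /dot; elim: (index_enum _) => [|i s IHs].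
  by rewrite big_nil; under eq_fun do rewrite big_nil; exact: cvg_cst.
rewrite big_cons; under eq_fun do rewrite big_cons.
apply: cvgD IHs; apply: cvgM.
- by apply: (@cvg_comp _ _ _ g (fun M => M ord0 i) _ _ _ gv); exact: coord_continuous.
- by apply: (@cvg_comp _ _ _ h (fun M => M ord0 i) _ _ _ hw); exact: coord_continuous.
Qed.

End dot_product.

Section projection.
Context {R : realType} {n : nat}.

Lemma closed_nearest_point (E : set 'rV[R]_n) (P : 'rV[R]_n) :
  closed E -> E !=set0 ->
  exists2 e, E e & forall y, E y -> dot (e - P) (e - P) <= dot (y - P) (y - P).
Proof.
move=> cE [e0 Ee0].
pose S := E `&` [set y | dot (y - P) (y - P) <= dot (e0 - P) (e0 - P)].
have cf : continuous (fun y : 'rV[R]_n => dot (y - P) (y - P)).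
  move=> y; apply: (@cvg_dot _ _ _ (nbhs y)).
    by apply: cvgB; [exact: cvg_id|exact: cvg_cst].
  by apply: cvgB; [exact: cvg_id|exact: cvg_cst].
have cS : compact S.
  apply: bounded_closed_compact.
    exists (Num.sqrt (dot (e0 - P) (e0 - P)) + `|P|); split => //.
    move=> M hM y [_ /= hy]; apply: ltW; apply: le_lt_trans hM.
    rewrite -[y](subrK P); apply: le_trans (ler_normD _ _) _; rewrite lerD2r.
    rewrite -[leLHS]normr_id -sqrtr_sqr ler_wsqrtr//.
    exact: le_trans (sqr_norm_le_dot _) hy.
  apply: closedI => //.
  apply: (closed_comp _ (@closed_le _ _)) => y _; exact: cf.
have S0 : S !=set0 by exists e0; split => //=.
have [e /set_mem[Ee /= ebd] emin] := EVT_min_rV S0 cS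
  (continuous_subspaceT cf).
exists e => // y Ey.
have [yle|ygt] := leP (dot (y - P) (y - P)) (dot (e0 - P) (e0 - P)).
  by apply: emin; rewrite inE.
exact: le_trans ebd (ltW ygt).
Qed.

(** First-order optimality: moving from the nearest point towards any other
    point of the convex set cannot decrease the distance to [P]. *)
Lemma convex_projection (E : set 'rV[R]_n) (P : 'rV[R]_n) :
  closed E -> E !=set0 ->
  (forall y z l, E y -> E z -> 0 <= l <= 1 -> E (l *: y + (1 - l) *: z)) ->
  exists2 e, E e & forall y, E y -> 0 <= dot (e - P) (y - e).
Proof.
move=> cE E0 convE; have [e Ee emin] := closed_nearest_point P cE E0.
exists e => // y Ey; rewrite leNgt; apply/negP => neg.
set b := dot (e - P) (y - e) in neg; set a := dot (y - e) (y - e).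
have a0 : 0 <= a by exact: dot_ge0.
pose l := (- b) / (a - b).
have ab : 0 < a - b by lra.
have l0 : 0 < l by rewrite divr_gt0//; lra.
have l1 : l <= 1 by rewrite ler_pdivrMr//; lra.
have := emin _ (convE y e l Ey Ee _); rewrite (ltW l0) l1 => /(_ isT).
have -> : l *: y + (1 - l) *: e - P = (e - P) + l *: (y - e).
  by apply/rowP => i; rewrite !mxE; ring.
rewrite dot_sqrDZ -/a -/b.
have la : l * (a - b) = - b by rewrite /l mulfVK// gt_eqF.
move=> h.
have h2 : 0 <= l * (2 * b + l * a) by lra.
have : 0 <= 2 * b + l * a by rewrite pmulr_rge0 in h2.
have : l * b < 0 by rewrite pmulr_rlt0.
lra.
Qed.

Lemma closed_convex_separation (E : set 'rV[R]_n) (P : 'rV[R]_n) :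
  closed E -> E !=set0 ->
  (forall y z l, E y -> E z -> 0 <= l <= 1 -> E (l *: y + (1 - l) *: z)) ->
  ~ E P -> exists2 v, dot v v = 1 & exists2 b, b < dot v P &
    forall y, E y -> dot v y <= b.
Proof.
move=> cE E0 convE nEP; have [e Ee he] := convex_projection P cE E0 convE.
have d0 : 0 < dot (P - e) (P - e).
  rewrite lt_neqAle dot_ge0 andbT; apply/eqP => h.
  have := sqr_norm_le_dot (P - e); rewrite -h real_exprn_even_le0//=.
  by rewrite normr_eq0 subr_eq0 => /eqP Pe; rewrite Pe in nEP.
pose s := Num.sqrt (dot (P - e) (P - e)).
have s0 : 0 < s by rewrite sqrtr_gt0.
have ss : s * s = dot (P - e) (P - e) by rewrite -expr2 sqr_sqrtr// ltW.
exists (s^-1 *: (P - e)).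
  by rewrite dotZl dotZr -ss mulrA -invfM mulVf// mulf_neq0// gt_eqF.
exists (dot (s^-1 *: (P - e)) e).
  by rewrite -subr_gt0 -dotBr dotZl mulr_gt0// invr_gt0.
move=> y Ey; rewrite -subr_le0 -dotBr dotZl.
rewrite pmulr_rle0 ?invr_gt0//.
by have := he y Ey; rewrite -[e - P]opprB dotNl oppr_ge0.
Qed.

End projection.

(** * Convex hulls and Caratheodory's theorem *)

Section convex_combinations.
Context {R : realType}.

(** Finitely supported measures of mass [w] on [U], as lists of weighted
    points: a list keeps the points in an order, which is the order in which
    the chattering control runs through them. *)
Definition weights (A : eqType) (U : set A) (w : R) (l : seq (R * A)) : Prop :=
  {in l, forall c, 0 <= c.1 /\ U c.2} /\ \sum_(c <- l) c.1 = w.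

Definition rescale (A : eqType) (k : R) (l : seq (R * A)) : seq (R * A) :=
  [seq (k * c.1, c.2) | c <- l].

Lemma weights_cat (A : eqType) (U : set A) w1 w2 l1 l2 :
  weights U w1 l1 -> weights U w2 l2 -> weights U (w1 + w2) (l1 ++ l2).
Proof.
move=> [p1 s1] [p2 s2]; split; last by rewrite big_cat/= s1 s2.
by move=> c; rewrite mem_cat => /orP[/p1|/p2].
Qed.

Lemma weights_rescale (A : eqType) (U : set A) k w l :
  0 <= k -> weights U w l -> weights U (k * w) (rescale k l).
Proof.
move=> k0 [p s]; split; last by rewrite big_map/= -mulr_sumr s.
move=> c /mapP[d /p[d0 Ud] ->]; split => //=; exact: mulr_ge0.
Qed.

Lemma weights1 (A : eqType) (U : set A) k a :
  0 <= k -> U a -> weights U k [:: (k, a)].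
Proof.
move=> k0 Ua; split; last by rewrite big_seq1.
by move=> c; rewrite inE => /eqP ->.
Qed.

Lemma sum_rescale (A : eqType) (V : lmodType R) (F : A -> V) k l :
  \sum_(c <- rescale k l) c.1 *: F c.2 = k *: \sum_(c <- l) c.1 *: F c.2.
Proof.
by rewrite big_map scaler_sumr; apply: eq_bigr => c _ /=; rewrite scalerA.
Qed.

Lemma sumr_rescale (A : eqType) (F : A -> R) k l :
  \sum_(c <- rescale k l) c.1 * F c.2 = k * \sum_(c <- l) c.1 * F c.2.
Proof.
by rewrite big_map mulr_sumr; apply: eq_bigr => c _ /=; rewrite mulrA.
Qed.

Lemma weighted_norm_le (A : eqType) (V : normedModType R) (U : set A) w l
    (F : A -> V) (e : R) :
  weights U w l -> (forall a, U a -> `|F a| <= e) ->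
  `|\sum_(c <- l) c.1 *: F c.2| <= w * e.
Proof.
move=> [p <-] Fe; apply: le_trans (ler_norm_sum _ _ _) _.
rewrite mulr_suml big_seq [leRHS]big_seq; apply: ler_sum => c /p[c0 Uc].
by rewrite normrZ ger0_norm// ler_wpM2l// Fe.
Qed.

Lemma weighted_le (A : eqType) (U : set A) w l (F G : A -> R) (e : R) :
  weights U w l -> (forall a, U a -> F a <= G a + e) ->
  \sum_(c <- l) c.1 * F c.2 <= \sum_(c <- l) c.1 * G c.2 + w * e.
Proof.
move=> [p <-] FG; rewrite mulr_suml -big_split/=.
rewrite big_seq [leRHS]big_seq; apply: ler_sum => c /p[c0 Uc].
by rewrite -mulrDr ler_wpM2l// FG.
Qed.

Section hull.
Context {n : nat}.
Variable B : set 'rV[R]_n.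

Definition hull : set 'rV[R]_n :=
  [set \sum_(c <- l) c.1 *: c.2 | l in weights B 1].

Lemma hull_convex y z l :
  hull y -> hull z -> 0 <= l <= 1 -> hull (l *: y + (1 - l) *: z).
Proof.
move=> [s ws <-] [t wt <-] /andP[l0 l1].
exists (rescale l s ++ rescale (1 - l) t).
  rewrite [X in weights _ X](_ : 1 = l * 1 + (1 - l) * 1); last by ring.
  by apply: weights_cat; apply: weights_rescale => //; lra.
by rewrite big_cat/= (sum_rescale id) (sum_rescale id).
Qed.

Lemma sub_hull : B `<=` hull.
Proof.
move=> b Bb; exists [:: (1, b)]; last by rewrite big_seq1 scale1r.
exact: weights1.
Qed.

Lemma convex_set_elim (K : set 'rV[R]_n) : convex_set K ->
  forall y z l, K y -> K z -> 0 <= l <= 1 -> K (l *: y + (1 - l) *: z).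
Proof.
move=> cK y z l Ky Kz l01.
have := cK y z (Itv01 (andP l01).1 (andP l01).2); rewrite !inE; exact.
Qed.

(** Caratheodory: with more than [n.+1] points, an affine dependence lets one
    shift weight along it until some point is dropped. *)
Lemma hull_shorten l : weights B 1 l -> (n.+1 < size l)%N ->
  exists l', [/\ weights B 1 l', (size l' < size l)%N &
    \sum_(c <- l') c.1 *: c.2 = \sum_(c <- l) c.1 *: c.2].
Proof.
move=> [p s] nl; set N := size l in nl *.
pose d0 : R * 'rV[R]_n := (0, 0).
pose c (i : 'I_N) := nth d0 l i.
have cl i : c i \in l by rewrite mem_nth.
have sumE (V : nmodType) (F : R * 'rV[R]_n -> V) :
    \sum_(x <- l) F x = \sum_(i < N) F (c i).
  by rewrite (big_nth d0) big_mkord.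
(* The extra column of ones makes a dependence of the rows an affine one. *)
pose M : 'M[R]_(N, n + 1) := \matrix_i row_mx (c i).2 (1%:M).
have : kermx M != 0.
  rewrite -mxrank_eq0 mxrank_ker subn_eq0 -ltnNge.
  by rewrite (leq_ltn_trans (rank_leq_col _))// addn1.
move=> /rowV0Pn[u0 /sub_kermxP u0M u0n0].
have depR (u : 'rV_N) : u *m M = 0 ->
    \sum_i u ord0 i *: (c i).2 = 0 /\ \sum_i u ord0 i = 0.
  move=> uM; split.
    apply/rowP => j; have := congr1 (fun A : 'rV_(n + 1) => A ord0 (lshift 1 j)) uM.
    rewrite !mxE summxE => {2}<-; apply: eq_bigr => i _.
    by rewrite !mxE (unsplitK (inl j)).
  have := congr1 (fun A : 'rV_(n + 1) => A ord0 (rshift n ord0)) uM.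
  rewrite !mxE => {2}<-; apply: eq_bigr => i _.
  by rewrite !mxE (unsplitK (inr _)) mxE eqxx mulr1.
have [u [uM [i0 ui0]]] : exists u : 'rV[R]_N, u *m M = 0 /\ exists i, 0 < u ord0 i.
  have [i0 ui0] : exists i, u0 ord0 i != 0.
    apply/existsP; rewrite -negb_forall; apply: contra u0n0 => /forallP h.
    by apply/eqP/rowP => i; rewrite mxE; apply/eqP/h.
  have [lt0|gt0|/eqP] := ltgtP (u0 ord0 i0) 0; last by rewrite (negbTE ui0).
  - exists (- u0); split; first by rewrite mulNmx u0M oppr0.
    by exists i0; rewrite mxE oppr_gt0.
  - by exists u0; split => //; exists i0.
have [ub us] := depR u uM.
have := @arg_minP _ _ _ i0 (fun i => 0 < u ord0 i) (fun i => (c i).1 / u ord0 i) ui0.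
(* [t] is the largest step along [u] that keeps all weights nonnegative; the
   weight of [j] then vanishes. *)
case=> j uj jmin; set t := (c j).1 / u ord0 j in jmin.
have cpos i : 0 <= (c i).1 by have [] := p _ (cl i).
have t0 : 0 <= t by rewrite divr_ge0// ltW.
pose l1 := [seq ((c i).1 - t * u ord0 i, (c i).2) | i <- enum 'I_N & i != j].
exists l1; split.
- split.
    move=> x /mapP[i _ ->] /=; split; last by have [] := p _ (cl i).
    have [ui|ui] := leP (u ord0 i) 0.
      by rewrite subr_ge0 (le_trans _ (cpos i))// mulr_ge0_le0.
    by rewrite subr_ge0 -ler_pdivlMr// jmin.
  rewrite big_map big_filter/= -s (sumE _ fst).
  transitivity (\sum_(i < N) ((c i).1 - t * u ord0 i)).
    rewrite big_enum_cond/= [RHS](bigD1 j)//= /t divfK ?gt_eqF// subrr add0r.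
    by apply: eq_bigl => i.
  by rewrite sumrB -mulr_sumr us mulr0 subr0.
- rewrite size_map size_filter -[X in (_ < X)%N]card_ord cardE -(count_predC (predC1 j)).
  rewrite -[ltnLHS]addn0 ltn_add2l -has_count; apply/hasP.
  by exists j; rewrite ?mem_enum//= negbK eqxx.
- rewrite big_map big_filter/= (sumE _ (fun x => x.1 *: x.2)).
  transitivity (\sum_(i < N) ((c i).1 - t * u ord0 i) *: (c i).2).
    rewrite big_enum_cond/= [RHS](bigD1 j)//= /t divfK ?gt_eqF// subrr scale0r add0r.
    by apply: eq_bigl => i.
  transitivity (\sum_(i < N) ((c i).1 *: (c i).2 - t *: (u ord0 i *: (c i).2))).
    by apply: eq_bigr => i _; rewrite scalerBl scalerA.
  by rewrite sumrB -scaler_sumr ub scaler0 subr0.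
Qed.

Lemma caratheodory y : hull y ->
  exists l, [/\ weights B 1 l, (size l <= n.+1)%N & \sum_(c <- l) c.1 *: c.2 = y].
Proof.
move=> [l wl <-]; have [N] := ubnP (size l).
elim: N l wl => // N IHN l wl lN.
have [le|gt] := leqP (size l) n.+1; first by exists l.
have [l' [wl' sl' <-]] := hull_shorten wl gt.
by apply: IHN => //; apply: leq_trans sl' _.
Qed.

(** Combinations of at most [k.+1] points, built one point at a time so that
    compactness follows by induction from continuity of the mixing map. *)
Fixpoint hull_upto (k : nat) : set 'rV[R]_n :=
  if k is k'.+1 then
    [set p.1 *: p.2.1 + (1 - p.1) *: p.2.2 |
      p in `[(0 : R), 1]%classic `*` (B `*` hull_upto k')]
  else B.

Lemma hull_upto_compact k : compact B -> compact (hull_upto k).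
Proof.
move=> cB; elim: k => //= k IHk; apply: continuous_compact; last first.
  by apply: compact_setX; [exact: segment_compact|exact: compact_setX].
apply: (@continuous_subspaceT (R * ('rV[R]_n * 'rV[R]_n))%type).
move=> /= [r [y z]].
have c1 : (fun p : R * ('rV[R]_n * 'rV[R]_n) => p.1) @ (r, (y, z)) --> r.
  exact: cvg_fst.
have c2 : (fun p : R * ('rV[R]_n * 'rV[R]_n) => p.2) @ (r, (y, z)) --> (y, z).
  exact: cvg_snd.
have c21 : (fun p : R * ('rV[R]_n * 'rV[R]_n) => p.2.1) @ (r, (y, z)) --> y.
  by apply: (cvg_comp _ _ c2); exact: cvg_fst.
have c22 : (fun p : R * ('rV[R]_n * 'rV[R]_n) => p.2.2) @ (r, (y, z)) --> z.
  by apply: (cvg_comp _ _ c2); exact: cvg_snd.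
by apply: cvgD; apply: cvgZ => //; apply: cvgB => //; exact: cvg_cst.
Qed.

Lemma hull_upto_le k m : (k <= m)%N -> hull_upto k `<=` hull_upto m.
Proof.
elim: m k => [|m IHm] [|k] km y //=.
  move=> By; exists (1, (y, y)); rewrite /=; last by rewrite scale1r subrr scale0r addr0.
  by split; [rewrite /= in_itv/= ler01 lexx|split => //; exact: (IHm 0)].
by move=> [[r [b z]] /= [hr [Bb hz]] <-]; exists (r, (b, z)) => //; do 2!split => //=; exact: IHm hz.
Qed.

Lemma sum_in_hull_upto l w : 0 < w -> weights B w l ->
  hull_upto (size l).-1 (w^-1 *: \sum_(c <- l) c.1 *: c.2).
Proof.
elim: l w => [|c l IHl] w w0 [p s].
  by move: s w0; rewrite big_nil => <-; rewrite ltxx.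
have [c0 Kc] := p c (mem_head _ _).
have pl : {in l, forall d, 0 <= d.1 /\ B d.2}.
  by move=> d dl; apply: p; rewrite inE dl orbT.
have s0 : 0 <= \sum_(d <- l) d.1.
  by rewrite big_seq sumr_ge0// => d /pl[].
move: s; rewrite !big_cons => sw.
(* The points after the first may carry no mass, and then cannot be normalised. *)
have [z|nz] := eqVneq (\sum_(d <- l) d.1) 0.
  have -> : \sum_(d <- l) d.1 *: d.2 = 0.
    rewrite big_seq big1// => d dl; have [d0 _] := pl d dl.
    have /eqP := z; rewrite big_seq psumr_eq0; last by move=> e /pl[].
    by move=> /allP/(_ d dl); rewrite dl/= => /eqP ->; rewrite scale0r.
  have -> : w = c.1 by rewrite -sw z addr0.
  have cn0 : c.1 != 0 by move: sw; rewrite z addr0 => ->; rewrite gt_eqF.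
  by rewrite addr0 scalerA mulVf// scale1r; exact: (@hull_upto_le 0).
have sp : 0 < \sum_(d <- l) d.1 by rewrite lt_neqAle eq_sym nz.
have := IHl _ sp (conj pl erefl).
case: l {IHl p} pl s0 sw nz sp => [|d l] pl s0 sw nz sp; first by rewrite big_nil eqxx in nz.
set S := \sum_(_ <- _) _ in s0 sw nz sp *; set V := \sum_(_ <- _) _ => hV /=.
exists (c.1 / w, (c.2, S^-1 *: V)); first split => //=.
  rewrite in_itv/=; apply/andP; split; first exact: divr_ge0 c0 (ltW w0).
  by rewrite ler_pdivrMr// mul1r -sw lerDl.
rewrite /= scalerDr !scalerA [w^-1 * _]mulrC; congr (_ + _ *: _).
have -> : 1 - c.1 / w = S / w.
  by rewrite -{1}(@mulfV _ w) ?gt_eqF// -mulrBl -sw addrAC subrr add0r.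
by rewrite mulrAC mulfV// mul1r.
Qed.

Lemma hull_upto_sub k (K : set 'rV[R]_n) : B `<=` K ->
  (forall y z l, K y -> K z -> 0 <= l <= 1 -> K (l *: y + (1 - l) *: z)) ->
  hull_upto k `<=` K.
Proof.
move=> BK convK; elim: k => [//|k IHk] y /=.
by move=> [[r [b z]] /= [hr [/BK Kb /IHk hz]] <-]; exact: convK.
Qed.

Lemma hull_sub_convex_hull : hull `<=` convex_hull B.
Proof.
move=> _ [l wl <-] K /= [/convex_set_elim convK BK].
have := sum_in_hull_upto ltr01 wl; rewrite invr1 scale1r.
exact: hull_upto_sub.
Qed.

(** By Caratheodory's bound the hull is one of the compact sets [hull_upto]. *)
Lemma compact_hull_closed : compact B -> closed hull.
Proof.
move=> cB; suff -> : hull = hull_upto n.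
  by apply: compact_closed; [exact: norm_hausdorff|exact: hull_upto_compact].
apply/seteqP; split; last exact: hull_upto_sub sub_hull hull_convex.
move=> y /caratheodory[l [wl sl <-]]; apply: (@hull_upto_le (size l).-1).
  by rewrite -ltnS; case: (size l) sl.
by have := sum_in_hull_upto ltr01 wl; rewrite invr1 scale1r.
Qed.

End hull.
End convex_combinations.

(** * Absolutely continuous curves *)

(** Derivability as a first-order expansion with explicit radius, the form in
    which it is combined with covering arguments and with error estimates. *)
Section first_order_expansion.
Context {R : realType} {V : normedModType R}.
Implicit Types (x : R -> V) (s : R).

Lemma derivable_expansion x s : derivable x s 1 -> forall e, 0 < e ->
  exists2 d, 0 < d &
    forall v, `|v - s| < d -> `|x v - x s - (v - s) *: x^`()%classic s| <= e * `|v - s|.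
Proof.
move=> /cvgrPdist_le dx e /dx; rewrite -/(derive x s 1) -derive1E.
move=> [d /= d0 dP]; exists d => // v vs.
have [->|vns] := eqVneq v s; first by rewrite !subrr scale0r subrr !normr0 mulr0.
have vs0 : v - s != 0 by rewrite subr_eq0.
have := dP (v - s); rewrite /ball_/= sub0r normrN => /(_ vs vs0).
rewrite [(v - s)%:A]mulr1 subrK -ler_pdivrMr ?normr_gt0// => h.
apply: le_trans h; rewrite mulrC -normfV -normrZ scalerBr scalerA mulVf// scale1r.
by rewrite distrC.
Qed.

Lemma expansion_derivable x s c :
  (forall e, 0 < e -> exists2 d, 0 < d &
    forall v, `|v - s| < d -> `|x v - x s - (v - s) *: c| <= e * `|v - s|) ->
  derivable x s 1 /\ x^`()%classic s = c.
Proof.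
move=> H; have : h^-1 *: ((x \o shift s) (h *: 1) - x s) @[h --> 0^'] --> c.
  apply/cvgrPdist_le => e /H[d d0 dP]; exists d => //= h.
  rewrite /ball_/= sub0r normrN => hd h0; have := dP (h + s).
  rewrite addrK [h *: 1]mulr1 => /(_ hd) hb.
  rewrite -(scale1r c) -(mulVf h0) -scalerA -scalerBr normrZ normfV.
  by rewrite mulrC ler_pdivrMr ?normr_gt0// distrC.
move=> Hc; split; first by apply/cvg_ex; exists c.
by rewrite derive1E; apply/cvg_lim.
Qed.

End first_order_expansion.

Section fundamental_theorem_ac.
Context {R : realType}.
Local Notation mu := (@lebesgue_measure R).

(** Cousin's covering argument: a property of points that propagates across a
    neighbourhood of each point of a segment propagates across the segment. *)
Lemma cousin_propagation (a b : R) (P : R -> Prop) : a <= b -> P a ->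
  (forall s, a <= s -> s <= b -> exists2 d, 0 < d &
    forall u v, a <= u -> u <= s -> s <= v -> v <= b -> s - d < u -> v < s + d ->
      P u -> P v) ->
  P b.
Proof.
move=> ab Pa loc.
pose S := [set c | [/\ a <= c, c <= b & P c]].
have S0 : S !=set0 by exists a; split.
have hS : has_sup S by split => //; exists b => c [].
have as_ : a <= sup S by apply: (ub_le_sup hS.2).
have sb : sup S <= b by apply: ge_sup => // c [].
have [d d0 step] := loc _ as_ sb.
have [u [au ub Pu] su] := sup_adherent d0 hS.
have us : u <= sup S by apply: (ub_le_sup hS.2).
pose v := Num.min b (sup S + d / 2).
have sv : sup S <= v by rewrite /v le_min sb/= lerDl ltW// divr_gt0.
have Pv : P v.
  apply: (step u) => //; first by rewrite /v ge_min lexx.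
  by rewrite /v gt_min ltrD2l ltr_pdivrMr// ltr_pMr// ltr1n orbT.
have vs : v <= sup S.
  by apply: (ub_le_sup hS.2); split => //; [exact: le_trans sv|rewrite /v ge_min lexx].
move: Pv; rewrite /v; have [//|h] := leP b (sup S + d / 2).
by move: vs; rewrite /v (min_idPr (ltW h)) gerDl leNgt divr_gt0.
Qed.

(** The covering argument below adds intervals on the right, so the head of the
    list is the rightmost one; half-open intervals make indefinite integrals
    additive along the list. *)
Definition ordered_intervals (a c : R) (O : set R) (l : seq (R * R)) :=
  pairwise (fun i j : R * R => j.2 <= i.1) l /\
  {in l, forall i, [/\ a <= i.1, i.1 <= i.2, i.2 <= c & `]i.1, i.2] `<=` O]}.

Lemma absolutely_continuous_seq (n : nat) (a b : R) (x : R -> 'rV[R]_n) :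
  absolutely_continuous a b x -> forall e, 0 < e -> exists2 d, 0 < d &
  forall O l, ordered_intervals a b O l -> \sum_(i <- l) (i.2 - i.1) < d ->
    \sum_(i <- l) `|x i.2 - x i.1| < e.
Proof.
move=> acx e /acx[d d0 H]; exists d => // O l [pl ml].
rewrite !(big_nth (0, 0)) !big_mkord => sd; apply: H => //.
  by move=> i; have [] := ml _ (mem_nth (0, 0) (ltn_ord i)).
apply/trivIsetP => i j _ _ ij; wlog lij : i j ij / (i < j)%N.
  move=> W; have [lij|lij|eij] := ltngtP i j; first exact: W.
    by rewrite setIC; apply: W => //; rewrite eq_sym.
  by move/eqP: ij; case; apply/val_inj.
have /(pairwiseP (0, 0))/(_ i j) := pl; rewrite !inE !ltn_ord => /(_ isT isT lij) /= h.
rewrite -subset0 => r [] /=; rewrite !in_itv/= => /andP[ir _] /andP[_ rj].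
by move: (lt_le_trans (lt_trans ir rj) h); rewrite ltxx.
Qed.

Lemma lebesgue_itv_oc (u v : R) : u <= v -> fine (mu `]u, v]) = v - u.
Proof.
rewrite le_eqVlt => /predU1P[->|uv]; first by rewrite set_itvoc0 measure0 subrr.
by rewrite lebesgue_measure_itv/= lte_fin uv.
Qed.

(** Mass carried up to [c] by the part of the line where derivatives are not
    controlled. *)
Let W (O : set R) (a : R) (h : R -> R) (c : R) : R :=
  \int[mu]_(t in O `&` `]a, c]) h t.

Let WD (O : set R) (a : R) (h : R -> R) (u v : R) : measurable O -> mu.-integrable setT (EFin \o h) ->
  a <= u -> u <= v -> `]u, v] `<=` O ->
  W O a h v = W O a h u + \int[mu]_(t in `]u, v]) h t.
Proof.
move=> mO ih au uv uvO; rewrite /W -Rintegral_setU//.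
- congr (Rintegral _ _ _); apply/seteqP; split=> r /=.
    rewrite !in_itv/= => -[Or /andP[ar rv]].
    by have [ru|ru] := leP r u; [left; rewrite ar|right].
  rewrite !in_itv/= => -[[Or /andP[ar ru]]|/andP[ur rv]].
    by rewrite ar (le_trans ru).
  by split; [apply: uvO; rewrite /= in_itv/= ur|rewrite (le_lt_trans au)].
- exact: measurableI.
- apply: integrableS ih => //; apply: measurableU => //; exact: measurableI.
- apply/disj_setPS => r [[_ /=]]; rewrite !in_itv/= => /andP[_ ru] /andP[ur _].
  by move: (lt_le_trans ur ru); rewrite ltxx.
Qed.

Let W_homo (O : set R) (a : R) (h : R -> R) (u v : R) : measurable O -> mu.-integrable setT (EFin \o h) ->
  (forall t, 0 <= h t) -> u <= v -> W O a h u <= W O a h v.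
Proof.
move=> mO ih h0 uv; rewrite /W fine_le//.
- by apply: integrable_fin_num => //; [exact: measurableI|apply: integrableS ih => //; exact: measurableI].
- by apply: integrable_fin_num => //; [exact: measurableI|apply: integrableS ih => //; exact: measurableI].
- apply: ge0_subset_integral => //.
  + exact: measurableI.
  + exact: measurableI.
  + by case/integrableP : ih => mh _; apply: measurable_funS mh.
  + by move=> t _; rewrite lee_fin.
  + by apply: setIS => t /=; rewrite !in_itv/= => /andP[-> /le_trans]; exact.
Qed.

(** Off an open set of small measure the difference of [F] and the indefinite
    integral of its derivative has zero derivative; on it, both vary little, the
    first by absolute continuity and the second by that of the integral. *)
Lemma ac_ftc (F h : R -> R) (a b : R) : a <= b ->
  (forall e, 0 < e -> exists2 d, 0 < d &
    forall O l, ordered_intervals a b O l -> \sum_(i <- l) (i.2 - i.1) < d ->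
      \sum_(i <- l) `|F i.2 - F i.1| < e) ->
  {ae mu, forall s, s \in `[a, b] -> derivable F s 1 /\ F^`()%classic s = h s} ->
  mu.-integrable `[a, b] (EFin \o h) ->
  F b - F a = \int[mu]_(s in `[a, b]) h s.
Proof.
move=> ab acF dF iF'.
pose f := h \_ `[a, b].
have fE : EFin \o f = (EFin \o h) \_ `[a, b] by rewrite restrict_EFin.
have intf : mu.-integrable setT (EFin \o f).
  by rewrite fE; apply/(integrable_mkcond _ _).1.
have intfS A : measurable A -> mu.-integrable A (EFin \o f).
  by move=> mA; apply: integrableS intf.
pose nf t := `|f t|.
have intnf : mu.-integrable setT (EFin \o nf) by exact: (integrable_abse intf).
pose G c := \int[mu]_(t in `]-oo, c]) f t.
have GB u v : u <= v -> G v - G u = \int[mu]_(t in `]u, v]) f t.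
  by move=> uv; rewrite /G Rintegral_itvB//; exact: intfS.
have GW u v : u <= v -> `|G v - G u| <= \int[mu]_(t in `]u, v]) nf t.
  by move=> uv; rewrite GB//; apply: le_normr_Rintegral => //; exact: intfS.
suff main e : 0 < e -> `|(F b - G b) - (F a - G a)| <= e * (b - a) + (e + e).
  have E : F b - F a = G b - G a.
    apply/eqP; rewrite -subr_eq0 -normr_le0; apply/ler_addgt0Pl => e e0.
    rewrite addr0; pose e' := e / (b - a + 2).
    have k0 : 0 < b - a + 2 by lra.
    have := main e' (divr_gt0 e0 k0).
    rewrite [X in `|X| <= _](_ : _ = F b - F a - (G b - G a)); last by ring.
    move=> /le_trans; apply; rewrite -mulr2n -mulr_natr -mulrDr /e'.
    by rewrite divfK ?gt_eqF.
  rewrite E GB// Rintegral_itv_obnd_cbnd; last by apply: intfS.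
  by apply: eq_Rintegral => t tab; rewrite /f patchE tab.
move=> e0; have [d1 d10 acP] := acF e e0.
have [d2 [d20 intP]] := integral_normr_continuous intf e0.
have aeG : {ae mu, forall s, derivable G s 1 /\ G^`()%classic s = f s}.
  apply: FTC1Ny; first by move=> y; exact: intfS.
  exact: open_integrable_locally openT intf.
have [A [mA A0 badA]] : mu.-negligible (~` [set s |
    (s \in `[a, b] -> derivable F s 1 /\ F^`()%classic s = h s) /\ (derivable G s 1 /\ G^`()%classic s = f s)]).
  exact: (@filterI _ _ (ae_filter_ringOfSetsType mu) _ _ dF aeG).
have d0 : 0 < Num.min d1 d2 by rewrite lt_min d10.
have Aoo : (mu A < +oo)%E by rewrite A0.
have [ O [oO AO mOA]] := lebesgue_regularity_outer mA Aoo d0.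
have mO : measurable O by exact: open_measurable.
have muO : (mu O < (Num.min d1 d2)%:E)%E.
  apply: le_lt_trans mOA; rewrite -[leRHS]add0e -A0.
  have mOA : measurable (O `\` A) by exact: measurableD.
  apply: le_trans (measureU2 _ mA mOA).
  by rewrite setDUK.
have int1 : mu.-integrable `[a, b] (EFin \o cst 1).
  apply: continuous_compact_integrable; first exact: segment_compact.
  exact: cst_continuous.
pose ind := (cst 1 : R -> R) \_ `[a, b].
have inti : mu.-integrable setT (EFin \o ind).
  by rewrite -restrict_EFin; apply/(integrable_mkcond _ _).1.
pose D c := F c - G c.
(* Along the segment, points off [O] contribute to the first term of the bound
   and intervals inside [O] to the list [l], whose total length is at most the
   measure of [O]. *)
have acc : exists l, [/\ ordered_intervals a b O l,
   \sum_(i <- l) (i.2 - i.1) <= W O a ind b - W O a ind a &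
   `|D b - D a| <= e * (b - a) + (\sum_(i <- l) `|F i.2 - F i.1| +
     (W O a nf b - W O a nf a))].
  apply: (@cousin_propagation a b (fun c => exists l, [/\ ordered_intervals a c O l,
   \sum_(i <- l) (i.2 - i.1) <= W O a ind c - W O a ind a &
   `|D c - D a| <= e * (c - a) + (\sum_(i <- l) `|F i.2 - F i.1| +
     (W O a nf c - W O a nf a))])) => //.
    exists [::]; split.
    - by split => // i; rewrite in_nil.
    - by rewrite big_nil subrr.
    - by rewrite big_nil !subrr normr0 mulr0 !addr0.
  move=> s as_ sb.
  have [sA|snA] := pselect (A s).
    have /nbhs_ballP[d /= dp dO] := open_nbhs_nbhs (conj oO (AO _ sA)).
    exists d => // u v au us sv vb du dv [l [[pl ml] sl Dl]].
    have uv := le_trans us sv.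
    have uvO : `]u, v] `<=` O.
      move=> r /=; rewrite in_itv/= => /andP[ur rv]; apply: dO.
      rewrite /ball/= ltr_distlC; apply/andP; split; lra.
    exists ((u, v) :: l); split.
    - split=> /=.
        by rewrite pl andbT; apply/allP => i /ml[].
      move=> i; rewrite inE => /predU1P[->//|/ml[ai ii ic iO]].
      by split => //; exact: le_trans uv.
    - rewrite big_cons/= (WD mO inti au uv uvO).
      have -> : \int[mu]_(t in `]u, v]) ind t = v - u.
        rewrite -[RHS]mul1r -[v - u](lebesgue_itv_oc uv).
        rewrite -[RHS]Rintegral_cst//; apply: eq_Rintegral => t.
        rewrite inE/= in_itv/= => /andP[ut tv].
        by rewrite /ind patchE mem_set//= in_itv/= (le_trans au (ltW ut)) (le_trans tv).
      lra.
    - rewrite big_cons/= (WD mO intnf au uv uvO).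
      have := GW u v uv; move: Dl; rewrite /D => Dl Guv.
      have -> : F v - G v - (F a - G a) =
        (F u - G u - (F a - G a)) + ((F v - F u) - (G v - G u)) by ring.
      apply: le_trans (ler_normD _ _) _.
      have := ler_normB (F v - F u) (G v - G u).
      have : e * (u - a) <= e * (v - a) by rewrite ler_pM2l// lerD2r.
      lra.
  have [[Fs Fsh] [Gs GsE]] : (derivable F s 1 /\ F^`()%classic s = h s) /\ (derivable G s 1 /\ G^`()%classic s = f s).
    have [] : (s \in `[a, b] -> derivable F s 1 /\ F^`()%classic s = h s) /\ (derivable G s 1 /\ G^`()%classic s = f s).
      by apply: contrapT => bad; apply: snA; exact: badA.
    by move=> h1 h2; split => //; apply: h1; rewrite in_itv/= as_.
  have e2 : 0 < e / 2 by rewrite divr_gt0.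
  have [dF' dF0 FP] := derivable_expansion Fs e2.
  have [dG' dG0 GP] := derivable_expansion Gs e2.
  exists (Num.min dF' dG'); first by rewrite lt_min dF0.
  have fs : f s = F^`()%classic s by rewrite Fsh /f patchE mem_set//= in_itv/= as_.
  have DP v : `|v - s| < Num.min dF' dG' -> `|D v - D s| <= e * `|v - s|.
    rewrite lt_min => /andP[/FP h1 /GP]; rewrite GsE fs => h2.
    have -> : D v - D s = (F v - F s - (v - s) *: F^`()%classic s) -
                          (G v - G s - (v - s) *: F^`()%classic s).
      by rewrite /D; ring.
    apply: le_trans (ler_normB _ _) _; apply: le_trans (lerD h1 h2) _.
    by rewrite -mulrDl -splitr.
  move=> u v au us sv vb du dv [l [[pl ml] sl Dl]].
  have uv := le_trans us sv.
  exists l; split.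
  - by split=> // i /ml[ai ii ic iO]; split => //; exact: le_trans uv.
  - by apply: le_trans sl _; rewrite lerD2r W_homo// => t; rewrite /ind patchE; case: ifP.
  - have Wuv : W O a nf u <= W O a nf v by apply: W_homo => // t; exact: normr_ge0.
    have hv : `|D v - D s| <= e * (v - s).
      by rewrite -[X in e * X]ger0_norm ?subr_ge0//; apply: DP; rewrite ger0_norm ?subr_ge0//; lra.
    have hu : `|D u - D s| <= e * (s - u).
      rewrite -[X in e * X]ger0_norm ?subr_ge0// [X in e * X]distrC; apply: DP.
      by rewrite distrC ger0_norm ?subr_ge0//; lra.
    have -> : D v - D a = (D u - D a) + ((D v - D s) - (D u - D s)) by ring.
    apply: le_trans (ler_normD _ _) _.
    have := ler_normB (D v - D s) (D u - D s).
    have -> : e * (v - a) = e * (u - a) + e * (v - s) + e * (s - u) by ring.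
    lra.
have [l [ol sl Dl]] := acc.
have Waa k : W O a k a = 0.
  by rewrite /W set_itv_ge ?bnd_simp ?ltxx// setI0 Rintegral_set0.
rewrite !Waa !subr0 in sl Dl.
apply: le_trans Dl _; rewrite lerD2l; apply: lerD; apply: ltW.
  apply: (acP O) => //; apply: le_lt_trans sl _.
  have -> : W O a ind b = fine (mu (O `&` `]a, b])).
    rewrite -[RHS]mul1r -Rintegral_cst; last exact: measurableI.
    apply: eq_Rintegral => t; rewrite inE => -[_ /=]; rewrite in_itv/= => /andP[at_ tb].
    by rewrite /ind patchE mem_set//= in_itv/= (ltW at_).
  have mOI : (mu (O `&` `]a, b]) <= mu O)%E.
    by rewrite le_measure ?inE//; exact: measurableI.
  rewrite -lte_fin fineK.
    by apply: le_lt_trans mOI (lt_le_trans muO _); rewrite lee_fin ge_min lexx.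
  rewrite ge0_fin_numE//; apply: le_lt_trans mOI (lt_trans muO _); exact: ltry.
apply: intP; first exact: measurableI.
apply: le_lt_trans (_ : (mu O < _)%E); last first.
  by apply: lt_le_trans muO _; rewrite lee_fin ge_min lexx orbT.
by rewrite le_measure ?inE//; exact: measurableI.
Qed.

End fundamental_theorem_ac.

Section curve_ftc.
Context {R : realType} {n : nat}.
Local Notation mu := (@lebesgue_measure R).
Implicit Types (x : R -> 'rV[R]_n).

Lemma derivable_dot x s (p : 'rV[R]_n) : derivable x s 1 ->
  derivable (fun r => dot p (x r)) s 1 /\
  (fun r => dot p (x r))^`()%classic s = dot p (x^`()%classic s).
Proof.
move=> dx; apply: expansion_derivable => e e0.
have k0 : 0 < n%:R * `|p| + 1 by rewrite ltr_wpDl// mulr_ge0.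
have [d d0 H] := derivable_expansion dx (divr_gt0 e0 k0).
exists d => // v /H; rewrite -!dotBr => {}H.
rewrite -[_ *: _]/(_ * _) -dotZr -dotBr; apply: le_trans (norm_dot_le _ _) _.
rewrite mulrA; apply: (@le_trans _ _ ((n%:R * `|p| + 1) * (e / (n%:R * `|p| + 1) * `|v - s|))).
  by apply: ler_pM => //; rewrite ?mulr_ge0// lerDl.
by rewrite mulrA mulrCA mulfV ?gt_eqF// mulr1.
Qed.

Lemma integrable_dot (A : set R) (F : R -> 'rV[R]_n) (p : 'rV[R]_n) :
  measurable A ->
  (forall i : 'I_n, mu.-integrable A (fun s => (F s ord0 i)%:E)) ->
  mu.-integrable A (fun s => (dot p (F s))%:E).
Proof.
move=> mA iF; rewrite /dot; under eq_fun do rewrite -sumEFin.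
apply: integrable_sum => // i _.
under eq_fun do rewrite EFinM.
exact: integrableZl.
Qed.

(** Tested against a functional [p], the vector identity becomes a scalar one,
    and it is in this form that velocities are compared with half-spaces. *)
Lemma ac_curve_ftc (a b : R) x u v (p : 'rV[R]_n) : ac_curve a b x ->
  a <= u -> u <= v -> v <= b ->
  dot p (x v - x u) = \int[mu]_(s in `[u, v]) dot p (x^`()%classic s).
Proof.
move=> [acx dx ix] au uv vb; rewrite dotBr.
apply: (@ac_ftc R (fun r => dot p (x r)) (fun s => dot p (x^`()%classic s))) => //.
- move=> e e0; have k0 : 0 < n%:R * `|p| + 1 by rewrite ltr_wpDl// mulr_ge0.
  have [d d0 H] := absolutely_continuous_seq acx (divr_gt0 e0 k0).
  exists d => // O l [pl ml] sl.
  have ol : ordered_intervals a b O l.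
    split => // i /ml[ui ii iv iO]; split => //; [exact: le_trans ui|exact: le_trans vb].
  have := H _ _ ol sl; rewrite ltr_pdivlMr// mulrC; apply: le_lt_trans.
  rewrite mulr_sumr; apply: ler_sum => i _; rewrite -dotBr.
  apply: le_trans (norm_dot_le _ _) _; rewrite mulrA ler_wpM2r//.
  by rewrite lerDl.
- apply: (@filterS _ _ (ae_filter_ringOfSetsType mu) _ _ _ dx) => s /= H suv.
  apply: derivable_dot; apply: H; move: suv; rewrite !in_itv/= => /andP[us sv].
  by rewrite (le_trans au us) (le_trans sv vb).
- apply: (@integrableS _ _ _ mu `[a, b]) => //.
    by move=> s /=; rewrite !in_itv/= => /andP[us sv]; rewrite (le_trans au us) (le_trans sv vb).
  exact: integrable_dot.
Qed.

Lemma ac_curve_unif_continuous (a b : R) x : ac_curve a b x -> forall e, 0 < e ->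
  exists2 d, 0 < d & forall u v, a <= u -> u <= v -> v <= b -> v - u < d ->
    `|x v - x u| < e.
Proof.
move=> [acx _ _] e /(absolutely_continuous_seq acx)[d d0 H]; exists d => // u v au uv vb uvd.
have := H setT [:: (u, v)]; rewrite !big_seq1/=; apply => //.
by split => // i; rewrite inE => /eqP ->.
Qed.

End curve_ftc.

(** * Integrals of nonmeasurable functions *)

(** For a nonnegative integrand without measurability the integral is a supremum
    over simple functions, so monotonicity survives, and additivity over the
    domain survives as superadditivity. *)
Section lower_integral.
Context d (T : measurableType d) (R : realType) (mu : {measure set T -> \bar R}).
Local Open Scope ereal_scope.
Import HBNNSimple.
Implicit Types (f g : T -> \bar R) (A B D : set T).

Let below f D := [set h : {nnsfun T >-> R} | forall x, (h x)%:E <= (f \_ D) x].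

Let integral_sup f D : (forall x, D x -> 0 <= f x) ->
  \int[mu]_(x in D) f x = ereal_sup [set sintegral mu h | h in below f D].
Proof. by move=> f0; rewrite ge0_integralE. Qed.

Let below_le f D (h : {nnsfun T >-> R}) : (forall x, D x -> 0 <= f x) ->
  below f D h -> sintegral mu h <= \int[mu]_(x in D) f x.
Proof. by move=> f0 hf; rewrite integral_sup//; apply: ereal_sup_ubound; exists h. Qed.

(** Cutting a null set out of a simple function below [f] leaves its integral
    unchanged and makes it a simple function below [g]. *)
Lemma ae_ge0_le_integral_nonmeas f g D :
  (forall x, D x -> 0 <= f x) -> (forall x, D x -> 0 <= g x) ->
  {ae mu, forall x, D x -> f x <= g x} ->
  \int[mu]_(x in D) f x <= \int[mu]_(x in D) g x.
Proof.
move=> f0 g0 [N [mN N0 bad]]; rewrite (integral_sup f0).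
apply: ge_ereal_sup => _ [h /= hf <-].
have mNC := measurableC mN.
have -> : sintegral mu h = sintegral mu (proj_nnsfun h mNC).
  rewrite -!integralT_nnsfun; apply: ge0_ae_eq_integral => //.
  - exact/measurable_EFinP.
  - exact/measurable_EFinP.
  - by move=> x _; rewrite lee_fin.
  - by move=> x _; rewrite lee_fin.
  exists N; split => // x /= /not_implyP[_]; apply: contra_notP => Nx.
  by rewrite mindicE mem_set// mulr1.
apply: below_le => // x /=; rewrite mindicE.
have [|xN] := boolP (x \in ~` N); last first.
  rewrite mulr0 patchE; case: ifPn => // /set_mem; exact: g0.
rewrite inE mulr1 => /= Nx; apply: le_trans (hf x) _; rewrite !patchE.
case: ifPn => // /set_mem Dx.
by have := contra_not (bad x) Nx => /= /contrapT; exact.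
Qed.

(** Simple functions below [f] on disjoint sets add up to one below [f] on the
    union; the reverse inequality needs measurability. *)
Lemma integral_superadditive f A B : (forall x, (A `|` B) x -> 0 <= f x) ->
  [disjoint A & B] ->
  \int[mu]_(x in A) f x + \int[mu]_(x in B) f x <= \int[mu]_(x in A `|` B) f x.
Proof.
move=> f0 AB.
have fA x : A x -> 0 <= f x by move=> Ax; apply: f0; left.
have fB x : B x -> 0 <= f x by move=> Bx; apply: f0; right.
set I := leRHS; have I0 : 0 <= I by exact: integral_ge0.
have [->|Ioo] := eqVneq I +oo; first by rewrite leey.
have Ifin : I \is a fin_num by rewrite ge0_fin_numE// ltey.
have key (h1 h2 : {nnsfun T >-> R}) : below f A h1 -> below f B h2 ->
    sintegral mu h1 + sintegral mu h2 <= I.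
  move=> h1A h2B; rewrite -sintegralD//; apply: (@below_le _ _ (add_nnsfun h1 h2)) => // x /=.
  rewrite EFinD; have := h1A x; have := h2B x; rewrite !patchE in_setU.
  have := AB; rewrite disj_set2E => /eqP AB0.
  have [xA|] := boolP (x \in A); have [xB|] := boolP (x \in B) => //=.
  - suff : set0 x by []; rewrite -AB0; split; exact/set_mem.
  - move=> _ h2x h1x; apply: le_trans (leeD h1x h2x) _; by rewrite adde0.
  - move=> _ h2x h1x; apply: le_trans (leeD h1x h2x) _; by rewrite add0e.
  - move=> _ _ h2x h1x; apply: le_trans (leeD h1x h2x) _; by rewrite adde0.
have IBfin : \int[mu]_(x in B) f x \is a fin_num.
  rewrite ge0_fin_numE; last exact: integral_ge0.
  rewrite (integral_sup fB); apply: (@le_lt_trans _ _ I); last by rewrite ltey.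
  apply: ge_ereal_sup => _ [h2 /= h2B <-].
  have := key nnsfun0 h2 _ h2B; rewrite sintegral0 add0e; apply => x /=.
  by rewrite patchE; case: ifPn => // /set_mem; exact: fA.
rewrite -leeBrDr// [leLHS](integral_sup fA); apply: ge_ereal_sup => _ [h1 /= h1A <-].
have h1fin : sintegral mu h1 \is a fin_num.
  rewrite ge0_fin_numE ?sintegral_ge0//; apply: (@le_lt_trans _ _ I); last by rewrite ltey.
  have := key h1 nnsfun0 h1A; rewrite sintegral0 adde0; apply => x /=.
  by rewrite patchE; case: ifPn => // /set_mem; exact: fB.
rewrite leeBrDr// addeC -leeBrDr// (integral_sup fB).
apply: ge_ereal_sup => _ [h2 /= h2B <-].
by rewrite leeBrDr// addeC; exact: key.
Qed.

Lemma integral_domain_le f A B : (forall x, B x -> 0 <= f x) -> A `<=` B ->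
  \int[mu]_(x in A) f x <= \int[mu]_(x in B) f x.
Proof.
move=> f0 AB; have fA x : A x -> 0 <= f x by move=> /AB; exact: f0.
rewrite (integral_sup fA); apply: ge_ereal_sup => _ [h /= hf <-].
apply: below_le => // x; apply: le_trans (hf x) _; rewrite !patchE.
case: ifPn => [/set_mem/AB Bx|_]; first by rewrite mem_set.
by case: ifPn => // /set_mem; exact: f0.
Qed.

Lemma integrable_le_integral_nonmeas (p : T -> R) f D : measurable D ->
  mu.-integrable D (EFin \o p) -> (forall x, D x -> 0 <= f x) ->
  {ae mu, forall x, D x -> (p x)%:E <= f x} ->
  \int[mu]_(x in D) (p x)%:E <= \int[mu]_(x in D) f x.
Proof.
move=> mD ip f0 pf; apply: (@le_trans _ _ (\int[mu]_(x in D) (Num.max (p x) 0)%:E)).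
  apply: le_integral => //; last by move=> x _; rewrite lee_fin le_max lexx.
  have := integrable_funepos mD ip; apply: eq_integrable => // x _.
  by rewrite funeposE EFin_max.
apply: ae_ge0_le_integral_nonmeas => //; first by move=> x _; rewrite lee_fin le_max lexx orbT.
apply: (@filterS _ _ (ae_filter_ringOfSetsType mu) _ _ _ pf) => x /= H Dx.
by rewrite EFin_max ge_max H// f0.
Qed.

End lower_integral.

(** * Ordinary differential equations *)

Section lipschitz_continuity.
Context {R : realType} {V W : normedModType R}.

Lemma lipschitz_continuous (x : V -> W) (K : R) :
  (forall u v, `|x u - x v| <= K * `|u - v|) -> continuous x.
Proof.
move=> lx u; apply/cvgrPdist_le => e e0.
have k0 : 0 < `|K| + 1 by rewrite ltr_wpDl.
apply/nbhs_ballP; exists (e / (`|K| + 1)); first by rewrite /= divr_gt0.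
move=> v; rewrite -ball_normE /= => uv; apply: le_trans (lx _ _) _.
apply: (@le_trans _ _ ((`|K| + 1) * `|u - v|)).
  by rewrite ler_wpM2r// (le_trans (ler_norm _))// lerDl.
by rewrite mulrC -ler_pdivlMr// ltW.
Qed.

End lipschitz_continuity.

Section geometric_limit.
Context {R : realType} {n : nat}.

Lemma pow_half_small (C e : R) : 0 < e -> exists k, C * 2^-1 ^+ k <= e.
Proof.
move=> e0; have h : `|2^-1 : R| < 1 by rewrite ger0_norm ?invr_ge0// invf_lt1// ltr1n.
have k0 : 0 < `|C| + 1 by rewrite ltr_wpDl.
have [N _ HN] := (@cvgrPdist_le _ _ _ _ _ _ _).1 (cvg_expr h) _ (divr_gt0 e0 k0).
exists N; have := HN N (leqnn N); rewrite sub0r normrN ger0_norm ?exprn_ge0 ?invr_ge0// => H.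
apply: (@le_trans _ _ ((`|C| + 1) * 2^-1 ^+ N)).
  by rewrite ler_wpM2r ?exprn_ge0 ?invr_ge0// (le_trans (ler_norm _))// lerDl.
by rewrite mulrC -ler_pdivlMr.
Qed.

Lemma le_of_pow_half (a b C : R) : (forall k, a <= b + C * 2^-1 ^+ k) -> a <= b.
Proof.
move=> H; apply/ler_addgt0Pl => e e0; have [k Hk] := pow_half_small C e0.
by apply: le_trans (H k) _; rewrite addrC lerD2r.
Qed.

Lemma geometric_cauchy (u : nat -> 'rV[R]_n) (C : R) :
  (forall k, `|u k.+1 - u k| <= C * 2^-1 ^+ k) ->
  exists l, forall k, `|u k - l| <= 2 * C * 2^-1 ^+ k.
Proof.
move=> H.
have pk k : 0 <= 2^-1 ^+ k :> R by rewrite exprn_ge0 ?invr_ge0.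
have C0 : 0 <= C by have := le_trans (normr_ge0 _) (H 0); rewrite expr0 mulr1.
have tail k m : `|u (k + m)%N - u k| <= 2 * C * 2^-1 ^+ k - 2 * C * 2^-1 ^+ (k + m).
  elim: m => [|m IHm]; first by rewrite addn0 !subrr normr0.
  rewrite addnS; have -> : u (k + m).+1 - u k = (u (k + m).+1 - u (k + m)%N) + (u (k + m)%N - u k).
    by apply/rowP => i; rewrite !mxE; ring.
  apply: le_trans (ler_normD _ _) _; apply: le_trans (lerD (H _) IHm) _.
  rewrite exprS; set a := 2^-1 ^+ (k + m); set b := 2^-1 ^+ k; lra.
have tailW k m : (k <= m)%N -> `|u m - u k| <= 2 * C * 2^-1 ^+ k.
  move=> /subnKC <-; apply: le_trans (tail _ _) _; rewrite gerBl.
  by rewrite mulr_ge0 ?mulr_ge0.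
have cu : cvg (u @ \oo).
  apply/cauchy_cvgP; apply: cauchy_exP => e e0.
  have [k Hk] := pow_half_small (2 * C) (divr_gt0 e0 (ltr0Sn R 1)).
  exists (u k); exists k => // m /= km; rewrite -ball_normE /= distrC.
  apply: le_lt_trans (tailW _ _ km) _; apply: le_lt_trans Hk _.
  by rewrite ltr_pdivrMr// ltr_pMr// ltr1n.
exists (lim (u @ \oo)) => k; apply/ler_addgt0Pl => e e0.
have [N _ HN] := (@cvgrPdist_le _ _ _ _ _ _ _).1 cu _ e0.
have := HN (maxn N k) (leq_maxl _ _); have := tailW _ _ (leq_maxr N k).
set m := maxn N k; move: (lim _) => l h1 h2.
have -> : u k - l = (u m - l) - (u m - u k).
  by apply/rowP => i; rewrite !mxE; ring.
apply: le_trans (ler_normB _ _) _; apply: lerD => //.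
by rewrite distrC.
Qed.

End geometric_limit.

Section primitive.
Context {R : realType} {n : nat}.
Local Notation mu := (@lebesgue_measure R).
Implicit Types (g h : R -> 'rV[R]_n).

Definition primitive (s0 : R) g (s : R) : 'rV[R]_n :=
  \row_i \int[mu]_(t in `]s0, s]) g t ord0 i.

Lemma primitive_start s0 g : primitive s0 g s0 = 0.
Proof.
by apply/rowP => i; rewrite !mxE set_itvoc0 Rintegral_set0.
Qed.

Lemma continuous_integrable g i (u v : R) : continuous g ->
  mu.-integrable `]u, v] (EFin \o (fun t => g t ord0 i)).
Proof.
move=> cg; apply: (@integrableS _ _ _ mu `[u, v]) => //; first exact: subset_itv_oc_cc.
apply: continuous_compact_integrable; first exact: segment_compact.
apply: continuous_subspaceT => t.
by apply: (@cvg_comp _ _ _ g (fun M => M ord0 i) _ _ _ (cg t)); exact: coord_continuous.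
Qed.

Lemma primitive_coord s0 g i u v : continuous g -> s0 <= u -> u <= v ->
  (primitive s0 g v - primitive s0 g u) ord0 i = \int[mu]_(t in `]u, v]) g t ord0 i.
Proof.
move=> cg su uv; rewrite !mxE Rintegral_itvB//; exact: continuous_integrable.
Qed.

Lemma primitive_dist s0 g h u v e : continuous g -> continuous h ->
  s0 <= u -> u <= v -> 0 <= e ->
  (forall t, u < t -> t <= v -> `|g t - h t| <= e) ->
  `|(primitive s0 g v - primitive s0 g u) - (primitive s0 h v - primitive s0 h u)|
    <= e * (v - u).
Proof.
move=> cg ch su uv e0 gh; apply: row_norm_le => [|i].
  by rewrite mulr_ge0// subr_ge0.
rewrite mxE [X in _ + X]mxE !primitive_coord//.
have ig := continuous_integrable i u v cg; have ih := continuous_integrable i u v ch.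
rewrite -RintegralB//.
have id : mu.-integrable `]u, v] (EFin \o (fun t => g t ord0 i - h t ord0 i)).
  exact: (@integrableB _ _ _ mu _ _ _ _ ig ih).
apply: le_trans (le_normr_Rintegral _ id) _ => //.
rewrite -(lebesgue_itv_oc uv) -Rintegral_cst//; apply: le_Rintegral => //.
- exact: (integrable_abse id).
- apply: (@integrableS _ _ _ mu `[u, v]) => //; first exact: subset_itv_oc_cc.
  apply: continuous_compact_integrable; first exact: segment_compact.
  exact: cst_continuous.
- move=> t /=; rewrite in_itv/= => /andP[ut tv].
  by apply: le_trans (gh t ut tv); rewrite -[X in _ <= `|X|]/(g t - h t); have := norm_coord (g t - h t) i; rewrite !mxE.
Qed.

Lemma primitive_cst s0 (c : 'rV[R]_n) u v : s0 <= u -> u <= v ->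
  primitive s0 (fun=> c) v - primitive s0 (fun=> c) u = (v - u) *: c.
Proof.
move=> su uv; apply/rowP => i.
rewrite primitive_coord//; last by move=> t; exact: cst_continuous.
by rewrite Rintegral_cst// lebesgue_itv_oc// mxE mulrC.
Qed.

End primitive.

Section picard.
Context {R : realType} {n : nat}.

(** Cutting time off to the interval extends the slopes of the iterates to
    continuous functions on the whole line. *)
Definition clamp (a b s : R) : R := Num.max a (Num.min b s).

Lemma clamp_itv a b s : a <= b -> a <= clamp a b s <= b.
Proof. by move=> ab; rewrite /clamp le_max lexx ge_max ab/= ge_min lexx. Qed.

Lemma clamp_id a b s : a <= s -> s <= b -> clamp a b s = s.
Proof. by move=> as_ sb; rewrite /clamp (min_idPr sb) (max_idPr as_). Qed.

Lemma clamp_lip a b s t : `|clamp a b s - clamp a b t| <= `|s - t|.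
Proof.
rewrite /clamp ler_norml; have := ler_norm (s - t); have := ler_norm (t - s).
rewrite (distrC t); rewrite /Num.max /Num.min; set d := `|s - t| => h1 h2.
case: (ltP b s) => ?; case: (ltP b t) => ?; case: (ltP a b) => ?;
  case: (ltP a s) => ?; case: (ltP a t) => ?; lra.
Qed.

Variables (F : R -> 'rV[R]_n -> 'rV[R]_n) (s0 h K M : R) (y0 : 'rV[R]_n).
Hypotheses (h0 : 0 <= h) (K0 : 0 <= K) (Mh : M * h <= 1) (Kh : K * h <= 2^-1).
Local Notation inI s := (s0 <= s <= s0 + h).
Hypothesis lipF : forall s s' y y', inI s -> inI s' ->
  `|F s y - F s' y'| <= K * (`|s - s'| + `|y - y'|).
Hypothesis boundF : forall s y, inI s -> `|y - y0| <= 1 -> `|F s y| <= M.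

Let slope (y : R -> 'rV[R]_n) (s : R) : 'rV[R]_n :=
  F (clamp s0 (s0 + h) s) (y (clamp s0 (s0 + h) s)).

Let iter_picard (k : nat) : R -> 'rV[R]_n :=
  iter k (fun y s => y0 + primitive s0 (slope y) s) (fun=> y0).

Let tame (y : R -> 'rV[R]_n) := y s0 = y0 /\
  forall u v, s0 <= u -> u <= v -> v <= s0 + h -> `|y v - y u| <= M * (v - u).

Let I0 : inI s0. Proof. by rewrite lexx lerDl. Qed.

Let M0 : 0 <= M.
Proof. by apply: le_trans (normr_ge0 _) (boundF (y := y0) I0 _); rewrite subrr normr0. Qed.

Let tame_near y s : tame y -> inI s -> `|y s - y0| <= 1.
Proof.
move=> [<- yl] /andP[s1 s2]; apply: le_trans (yl _ _ _ s1 s2) _ => //.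
by apply: le_trans Mh; rewrite ler_wpM2l// lerBlDl.
Qed.

Let tame_lip y s t : tame y -> inI s -> inI t -> `|y s - y t| <= M * `|s - t|.
Proof.
move=> [_ yl] /andP[s1 s2] /andP[t1 t2]; have [st|/ltW ts] := leP s t.
  by rewrite distrC (distrC s) (ger0_norm (_ : 0 <= t - s)) ?subr_ge0// yl.
by rewrite (ger0_norm (_ : 0 <= s - t)) ?subr_ge0// yl.
Qed.

Let cI s : inI (clamp s0 (s0 + h) s).
Proof. by apply: clamp_itv; rewrite lerDl. Qed.

Let slope_lip y s t : tame y -> `|slope y s - slope y t| <= K * (1 + M) * `|s - t|.
Proof.
move=> ty; apply: le_trans (lipF _ _ (cI s) (cI t)) _.
rewrite -mulrA ler_wpM2l// mulrDl mul1r; apply: lerD; first exact: clamp_lip.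
by apply: le_trans (tame_lip ty (cI s) (cI t)) _; rewrite ler_wpM2l// clamp_lip.
Qed.

Let slope_continuous y : tame y -> continuous (slope y).
Proof. by move=> ty; apply: (@lipschitz_continuous _ _ _ _ (K * (1 + M))) => u v; exact: slope_lip. Qed.

Let tame_step y : tame y -> tame (fun s => y0 + primitive s0 (slope y) s).
Proof.
move=> ty; split; first by rewrite primitive_start addr0.
move=> u v u1 uv v2; rewrite opprD addrACA subrr add0r.
have := @primitive_dist _ _ s0 (slope y) (fun=> 0) u v M (slope_continuous ty) (@cst_continuous _ _ _) u1 uv M0.
rewrite primitive_cst// scaler0 subr0; apply => t _ _.
by rewrite subr0 boundF// tame_near.
Qed.

Let iter_tame k : tame (iter_picard k).
Proof.
elim: k => [|k IHk]; last exact: tame_step.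
by split => // u v _ uv _; rewrite subrr normr0 mulr_ge0// subr_ge0.
Qed.

Let iter_dist k s : inI s -> `|iter_picard k.+1 s - iter_picard k s| <= M * h * 2^-1 ^+ k.
Proof.
elim: k s => [|k IHk] s sI.
  rewrite expr0 mulr1; have [e1 l1] := iter_tame 1; rewrite /= -e1.
  have /andP[s1 s2] := sI; rewrite e1 -[X in _ - X]e1; apply: le_trans (l1 _ _ _ s1 s2) _ => //.
  by rewrite ler_wpM2l// lerBlDl.
have /andP[s1 s2] := sI.
rewrite [iter_picard k.+2]/= [X in _ - X](_ : _ = y0 + primitive s0 (slope (iter_picard k)) s)//.
rewrite opprD addrACA subrr add0r.
have e0 : 0 <= K * (M * h * 2^-1 ^+ k) by rewrite !mulr_ge0// exprn_ge0// invr_ge0.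
have := @primitive_dist _ _ s0 (slope (iter_picard k.+1)) (slope (iter_picard k)) s0 s _
  (slope_continuous (iter_tame k.+1)) (slope_continuous (iter_tame k)) (lexx _) s1 e0.
rewrite !primitive_start !subr0 => H; apply: le_trans (H _) _.
  move=> t _ _; apply: le_trans (lipF _ _ (cI t) (cI t)) _.
  by rewrite subrr normr0 add0r ler_wpM2l// IHk.
have sh : s - s0 <= h by rewrite lerBlDl.
rewrite exprS (mulrCA (M * h)); move: e0; set X := M * h * 2^-1 ^+ k => e0.
have X0 : 0 <= X by rewrite !mulr_ge0// exprn_ge0// invr_ge0.
apply: (@le_trans _ _ (K * X * h)); first by rewrite ler_wpM2l.
by rewrite mulrAC ler_wpM2r.
Qed.

(** The second-order expansion holds for every Picard iterate and passes to the
    limit.  It contains both the differential equation, by letting [v] tend to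
    [u], and the one-step error of Euler's method. *)
Lemma picard_lindelof_local : exists y : R -> 'rV[R]_n,
  [/\ y s0 = y0,
    forall u v, s0 <= u -> u <= v -> v <= s0 + h -> `|y v - y u| <= M * (v - u) &
    forall u v, s0 <= u -> u <= v -> v <= s0 + h ->
      `|y v - y u - (v - u) *: F u (y u)| <= K * (1 + M) * (v - u) ^+ 2].
Proof.
have lims s : exists l, inI s -> forall k, `|iter_picard k s - l| <= 2 * (M * h) * 2^-1 ^+ k.
  have [sI|] := boolP (s0 <= s <= s0 + h); last by move=> /negP nI; exists 0.
  have [l Hl] := geometric_cauchy (fun k => iter_dist k sI).
  by exists l.
have [y Hy] := choice lims; exists y.
have pk k : 0 <= 2^-1 ^+ k :> R by rewrite exprn_ge0 ?invr_ge0.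
have bnd u v : s0 <= u -> u <= v -> v <= s0 + h -> inI u /\ inI v.
  by move=> su uv vh; rewrite su vh (le_trans uv vh) (le_trans su uv).
split.
- apply/eqP; rewrite -subr_eq0 -normr_le0.
  apply: (@le_of_pow_half _ _ _ (2 * (M * h))) => k; rewrite add0r distrC.
  by have := Hy s0 I0 k; rewrite (iter_tame k).1.
- move=> u v su uv vh; have [uI vI] := bnd u v su uv vh.
  apply: (@le_of_pow_half _ _ _ (2 * (2 * (M * h)))) => k.
  have -> : y v - y u = (iter_picard k v - iter_picard k u)
      + ((iter_picard k u - y u) - (iter_picard k v - y v)).
    by apply/rowP => i; rewrite !mxE; ring.
  apply: le_trans (ler_normD _ _) _; apply: lerD; first exact: (iter_tame k).2.
  apply: le_trans (ler_normB _ _) _; apply: le_trans (lerD (Hy u uI k) (Hy v vI k)) _; lra.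
- move=> u v su uv vh; have [uI vI] := bnd u v su uv vh.
  apply: (@le_of_pow_half _ _ _ ((2 + K * h) * (2 * (M * h)))) => k.
  have := @primitive_dist _ _ s0 (slope (iter_picard k)) (fun=> F u (iter_picard k u)) u v
    (K * (1 + M) * (v - u)) (slope_continuous (iter_tame k)) (@cst_continuous _ _ _) su uv.
  rewrite primitive_cst// => H.
  have -> : y v - y u - (v - u) *: F u (y u) =
     (iter_picard k.+1 v - iter_picard k.+1 u - (v - u) *: F u (iter_picard k u)) +
     (((iter_picard k.+1 u - y u) - (iter_picard k.+1 v - y v)) +
       (v - u) *: (F u (iter_picard k u) - F u (y u))).
    by apply/rowP => i; rewrite !mxE; ring.
  apply: le_trans (ler_normD _ _) _; apply: lerD.
    rewrite expr2 mulrA [iter_picard k.+1]/= opprD addrACA subrr add0r; apply: H.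
      by rewrite mulr_ge0 ?subr_ge0// mulr_ge0// addr_ge0.
    move=> t ut tv; rewrite -[X in F u (_ X)](@clamp_id s0 (s0 + h) u)//; last exact: le_trans vh.
    rewrite -[X in F X _](@clamp_id s0 (s0 + h) u)//; last exact: le_trans vh.
    apply: le_trans (slope_lip t u (iter_tame k)) _.
    rewrite ler_wpM2l// ?mulr_ge0// ?addr_ge0// ger0_norm ?subr_ge0 ?lerD2r//; exact: ltW.
  rewrite mulrDl mulrDl; apply: le_trans (ler_normD _ _) _; apply: lerD.
    apply: le_trans (ler_normB _ _) _.
    apply: le_trans (lerD (Hy u uI k.+1) (Hy v vI k.+1)) _.
    rewrite exprS; have : 0 <= M * h * 2^-1 ^+ k by rewrite !mulr_ge0.
    set z := 2^-1 ^+ k; rewrite -!mulrA; lra.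
  rewrite normrZ ger0_norm ?subr_ge0//.
  have Fd : `|F u (iter_picard k u) - F u (y u)| <= K * (2 * (M * h) * 2^-1 ^+ k).
    apply: le_trans (lipF _ _ uI uI) _; rewrite subrr normr0 add0r ler_wpM2l//.
    exact: Hy.
  rewrite [K * h]mulrC -!mulrA; apply: ler_pM => //; rewrite ?subr_ge0//.
  + lra.
  + by rewrite !mulrA in Fd *.
Qed.

End picard.

(** * Uniformly inward-pointing controls *)

Section uniform_inward_pointing.
Context {R : realType} {n m : nat}.

Lemma unit_sphere_compact : compact [set v : 'rV[R]_n | dot v v = 1].
Proof.
apply: bounded_closed_compact.
  exists 1; split => // M M1 v /= v1; apply: ltW; apply: le_lt_trans M1.
  exact: unit_norm_le1.
apply: (@preimage_closed _ _ (fun v : 'rV[R]_n => dot v v) [set 1]).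
  by move=> v _; apply: (@cvg_dot _ _ _ (nbhs v)) => //; exact: cvg_id.
exact: closed_eq.
Qed.

(** A unit vector supporting the closure at an interior point [p] would have a
    nonpositive product with itself, as [p + (e / 2) *: v] is still in the set. *)
Lemma supporting_normal_boundary (Omega : set 'rV[R]_n) (p v : 'rV[R]_n) :
  closure Omega p -> unit_supporting_normal (closure Omega) p v -> boundary Omega p.
Proof.
move=> Cp [v1 sv]; split => // /nbhs_ballP[e /= e0 pe].
have : closure Omega (p + (e / 2) *: v).
  apply: subset_closure; apply: pe; rewrite -ball_normE /= opprD addrA subrr add0r normrN.
  have e2 : 0 <= e / 2 by rewrite divr_ge0// ltW.
  rewrite normrZ ger0_norm//; apply: (@le_lt_trans _ _ (e / 2 * 1)).
    by rewrite ler_wpM2l// unit_norm_le1.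
  by rewrite mulr1 ltr_pdivrMr// ltr_pMr// ltr1n.
move=> /sv; rewrite addrAC subrr add0r dotZr v1 mulr1 leNgt.
by rewrite divr_gt0.
Qed.

Variables (T K nu : R) (U : set 'rV[R]_m).
Variables (f : R -> 'rV[R]_n -> 'rV[R]_m -> 'rV[R]_n).
Variables (L : R -> 'rV[R]_n -> 'rV[R]_m -> R).
Variables (Omega : set 'rV[R]_n) (normal : 'rV[R]_n -> 'rV[R]_n).
Local Notation C := (closure Omega).
Hypotheses (U0 : U !=set0) (K0 : 0 <= K) (nu0 : 0 < nu).
Hypothesis lipf : forall a, U a -> forall s t x y, s \in `[0, T] -> t \in `[0, T] ->
  `|f s x a - f t y a| <= K * (`|s - t| + `|x - y|).
Hypothesis lipL : forall a, U a -> forall s t x y, s \in `[0, T] -> t \in `[0, T] ->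
  `|L s x a - L t y a| <= K * (`|s - t| + `|x - y|).
Hypothesis cC : compact C.
Hypothesis normalP : forall x, boundary Omega x -> is_outward_unit_normal Omega x (normal x).
Hypothesis inward : forall x t, boundary Omega x -> t \in `[0, T] ->
  exists2 a, U a & dot (f t x a) (normal x) <= - nu.

Let inv_near0 (e : R) : 0 < e -> \forall k \near \oo, k.+1%:R^-1 < e.
Proof. by move=> e0; exact: near_infty_natSinv_lt (PosNum e0). Qed.

(** Directions almost normal at a fixed point: those failing to be normal are
    excluded by a witness in the set, and near the only normal one the chosen
    control still points inward. *)
Lemma inward_at (p : 'rV[R]_n) (t : R) : C p -> t \in `[0, T] ->
  exists2 a, U a & exists2 r, 0 < r & forall v, dot v v = 1 ->
    (forall w, C w -> dot v (w - p) <= r) -> dot (f t p a) v <= - (3 / 4 * nu).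
Proof.
move=> Cp tT.
have [a Ua Ha] : exists2 a, U a & (boundary Omega p -> dot (f t p a) (normal p) <= - nu).
  have [bp|nbp] := pselect (boundary Omega p).
    by have [a Ua Ha] := inward bp tT; exists a.
  by have [a Ua] := U0; exists a.
exists a => //.
pose Q (k : nat) (v : 'rV[R]_n) :=
  (forall w, C w -> dot v (w - p) <= k.+1%:R^-1) -> dot (f t p a) v <= - (3 / 4 * nu).
have : \forall k \near \oo, [set v : 'rV[R]_n | dot v v = 1] `<=` Q k.
  have cover := (compact_near_coveringP _).1 unit_sphere_compact.
  apply: (cover nat \oo Q) => v v1.
  have [sv|nsv] := pselect (unit_supporting_normal C p v).
    have bp := supporting_normal_boundary Cp sv.
    have vn : v = normal p by have [_ /(_ v sv)] := normalP bp.
    have cd : (fun v' => dot (f t p a) v') @ v --> dot (f t p a) v.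
      by apply: (@cvg_dot _ _ _ (nbhs v)); [exact: cvg_cst|exact: cvg_id].
    have dlt : dot (f t p a) v < - (3 / 4 * nu).
      by have := Ha bp; rewrite vn; move: nu0; lra.
    have near_v : \forall v' \near v, dot (f t p a) v' < - (3 / 4 * nu).
      exact: (cvgr_lt _ cd).
    exists ([set v' | dot (f t p a) v' < - (3 / 4 * nu)], setT).
      by split => //; exact: filterT.
    by move=> [v' k] /= [/ltW v'lt _] _.
  have [w [Cw wv]] : exists w, C w /\ 0 < dot v (w - p).
    apply: contrapT => nw; apply: nsv; split => // w Cw; rewrite leNgt; apply/negP => h.
    by apply: nw; exists w.
  have cd : (fun v' => dot v' (w - p)) @ v --> dot v (w - p).
    by apply: (@cvg_dot _ _ _ (nbhs v)); [exact: cvg_id|exact: cvg_cst].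
  have h2 : dot v (w - p) / 2 < dot v (w - p) by rewrite ltr_pdivrMr// ltr_pMr// ltr1n.
  exists ([set v' | dot v (w - p) / 2 < dot v' (w - p)],
          [set k | k.+1%:R^-1 < dot v (w - p) / 2]).
    by split => /=; [exact: (cvgr_gt _ cd)|apply: inv_near0; rewrite divr_gt0].
  move=> [v' k] /= [h3 h4] /(_ w Cw) h5.
  by move: (lt_le_trans (lt_trans h4 h3) h5); rewrite ltxx.
move=> [k _ /(_ k (leqnn k)) Hk]; exists k.+1%:R^-1; first by rewrite invr_gt0.
by move=> v v1; apply: Hk.
Qed.

(** The radius, and a bound on the cost of the inward control, are uniform:
    a control that works at one point works at nearby points and times. *)
Lemma inward_uniform : exists2 r, 0 < r & exists Lam : R,
  forall t p, t \in `[0, T] -> C p -> exists a, [/\ U a, L t p a <= Lam &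
    forall v, dot v v = 1 -> (forall w, C w -> dot v (w - p) <= r) ->
      dot (f t p a) v <= - (nu / 2)].
Proof.
pose D : R := n%:R.
pose Q (k : nat) (z : R * 'rV[R]_n) := z.1 \in `[0, T] -> exists a, [/\ U a, L z.1 z.2 a <= k%:R &
    forall v, dot v v = 1 -> (forall w, C w -> dot v (w - z.2) <= k.+1%:R^-1) ->
      dot (f z.1 z.2 a) v <= - (nu / 2)].
have cK : compact (`[0, T]%classic `*` C) by apply: compact_setX => //; exact: segment_compact.
have : \forall k \near \oo, (`[0, T]%classic `*` C) `<=` Q k.
  have cover := (compact_near_coveringP _).1 cK.
  apply: (cover nat \oo Q) => -[t p] [/= tT Cp].
  have {}tT : t \in `[0, T] by [].
  have [a Ua [r r0 Hr]] := inward_at Cp tT.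
  pose k0 := D * (K * 2) + D + 1.
  have D0 : 0 <= D by rewrite /D.
  have k00 : 0 < k0 by rewrite ltr_wpDl// addr_ge0// mulr_ge0// mulr_ge0.
  pose d := Num.min (r / (2 * k0)) (nu / (4 * k0)).
  have d0 : 0 < d by rewrite lt_min !divr_gt0// mulr_gt0.
  have dr : k0 * d <= r / 2.
    by rewrite ler_pdivlMr// mulrC mulrA mulrC -ler_pdivlMr ?mulr_gt0// /d ge_min lexx.
  have dnu : k0 * d <= nu / 4.
    by rewrite ler_pdivlMr// mulrC mulrA mulrC -ler_pdivlMr ?mulr_gt0// /d ge_min lexx orbT.
  exists ([set z | ball t d z.1 /\ ball p d z.2],
          [set k | k.+1%:R^-1 < r / 2 /\ L t p a + K * (2 * d) <= k%:R]).
    split => /=.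
      exists (ball t d, ball p d); first by split; exact: nbhsx_ballx.
      by move=> [z1 z2] [].
    apply: filterI; first by apply: inv_near0; rewrite divr_gt0.
    exact: nbhs_infty_ger.
  move=> [[t' p'] k] /= [[]]; rewrite -!ball_normE /= => tt' pp' [kr kL] t'T.
  have sd : `|t' - t| + `|p' - p| <= 2 * d by rewrite distrC (distrC p'); lra.
  exists a; split => //.
    have := lipL Ua p' p t'T tT; rewrite ler_norml => /andP[_ h].
    have : K * (`|t' - t| + `|p' - p|) <= K * (2 * d) by rewrite ler_wpM2l.
    lra.
  move=> /= v v1 hv.
  have hp : dot (f t p a) v <= - (3 / 4 * nu).
    apply: Hr => // w Cw; have hw : dot v (w - p') <= k.+1%:R^-1 := hv w Cw.
    move: hw kr dr; set q := k.+1%:R^-1 => hw kr dr.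
    have -> : w - p = (w - p') + (p' - p) by rewrite addrA subrK.
    rewrite dotDr; have h1 : dot v (p' - p) <= D * `|p' - p| by exact: dot_unit_le.
    have : D * `|p' - p| <= D * d by rewrite ler_wpM2l// distrC ltW.
    have : D * d <= k0 * d.
      rewrite ler_wpM2r ?(ltW d0)// /k0 -addrA addrCA lerDl addr_ge0// mulr_ge0// mulr_ge0//.
    lra.
  have hf : `|dot v (f t' p' a - f t p a)| <= k0 * d.
    apply: le_trans (norm_dot_unit _ v1) _; rewrite -/D.
    apply: (@le_trans _ _ (D * (K * (2 * d)))).
      rewrite ler_wpM2l//; apply: le_trans (lipf Ua _ _ t'T tT) _.
      by rewrite ler_wpM2l.
    rewrite !mulrA ler_wpM2r ?(ltW d0)// /k0 mulrA -addrA lerDl addr_ge0//.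
  move: hf; rewrite dotBr ler_norml => /andP[_].
  rewrite dotC (dotC v (f t p a)); move: hp dnu nu0; lra.
move=> [k _ /(_ k (leqnn k)) Hk]; exists k.+1%:R^-1; first by rewrite invr_gt0.
exists k%:R => t p tT Cp; exact: (Hk (t, p)).
Qed.

End uniform_inward_pointing.

(** * The conjugate Hamiltonian along a curve *)

Section conjugate_hamiltonian.
Context {R : realType} {n m : nat}.
Variables (U : set 'rV[R]_m).
Variables (f : R -> 'rV[R]_n -> 'rV[R]_m -> 'rV[R]_n).
Variables (L : R -> 'rV[R]_n -> 'rV[R]_m -> R).
Local Notation Hconj := (hamiltonian_conj U f L).

Lemma hamiltonian_conj_le_cost s y a : U a ->
  (Hconj s y (- f s y a) <= (L s y a)%:E)%E.
Proof.
move=> Ua; apply: ge_ereal_sup => _ [p _ <-].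
have : ((- dot p (f s y a) - L s y a)%:E <= hamiltonian U f L s y p)%E.
  by apply: ereal_sup_ubound; exists a.
rewrite dotNr; case: (hamiltonian U f L s y p) => [h| |] //=; last by rewrite leNye.
by rewrite !lee_fin; lra.
Qed.

(** An affine lower bound of velocity and cost over the controls is inherited
    by the conjugate, which is the convex envelope of the cost. *)
Lemma hamiltonian_conj_ge s y p q k b : 0 < q ->
  (forall a, U a -> k <= dot p (f s y a) + q * L s y a) ->
  (((dot p b + k) / q)%:E <= Hconj s y b)%E.
Proof.
move=> q0 H; apply: (@le_trans _ _ ((dot (q^-1 *: p) b)%:E - hamiltonian U f L s y (q^-1 *: p))%E); last first.
  by apply: ereal_sup_ubound; exists (q^-1 *: p).
have : (hamiltonian U f L s y (q^-1 *: p) <= (- (k / q))%:E)%E.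
  apply: ge_ereal_sup => _ [a Ua <-]; rewrite lee_fin dotZl.
  have : 0 <= q^-1 * (dot p (f s y a) + q * L s y a - k).
    by rewrite pmulr_rge0 ?invr_gt0// subr_ge0; exact: H.
  rewrite mulrBr mulrDr mulrA mulVf ?gt_eqF// mul1r [_ * k]mulrC; lra.
rewrite dotZl mulrDl [_ / q]mulrC.
case: (hamiltonian U f L s y _) => [h| |] //=; last by rewrite leey.
by rewrite !lee_fin; lra.
Qed.

Lemma hamiltonian_conj_ge0 s y b : (forall a, U a -> 0 <= L s y a) ->
  (0 <= Hconj s y b)%E.
Proof.
move=> L0; have := @hamiltonian_conj_ge s y 0 1 0 b ltr01.
rewrite dot0l addr0 mul0r; apply => a Ua.
by rewrite dot0l add0r mul1r L0.
Qed.

End conjugate_hamiltonian.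

Section block_rows.
Context {R : realType} {n : nat}.

Lemma dot_row_mx (u v : 'rV[R]_n) (a b : 'rV[R]_1) :
  dot (row_mx u a) (row_mx v b) = dot u v + a ord0 ord0 * b ord0 ord0.
Proof.
rewrite /dot big_split_ord/= big_ord1; congr (_ + _); last by rewrite !row_mxEr.
by apply: eq_bigr => i _; rewrite !row_mxEl.
Qed.

Lemma norm_row_mxl (u : 'rV[R]_n) (a : 'rV[R]_1) : `|u| <= `|row_mx u a|.
Proof.
apply: row_norm_le => // i; rewrite -(row_mxEl u a); exact: norm_coord.
Qed.

Lemma norm_row_mxr (u : 'rV[R]_n) (a : 'rV[R]_1) : `|a ord0 ord0| <= `|row_mx u a|.
Proof. rewrite -(row_mxEr u a); exact: norm_coord. Qed.

End block_rows.

Section averaged_velocities.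
Context {R : realType} {n m : nat}.
Local Notation mu := (@lebesgue_measure R).
Variables (T K t : R) (U : set 'rV[R]_m).
Variables (f : R -> 'rV[R]_n -> 'rV[R]_m -> 'rV[R]_n).
Variables (L : R -> 'rV[R]_n -> 'rV[R]_m -> R).
Hypotheses (U0 : U !=set0) (K0 : 0 <= K) (t0 : 0 <= t).
Hypothesis lipf : forall a, U a -> forall s t x y, s \in `[0, T] -> t \in `[0, T] ->
  `|f s x a - f t y a| <= K * (`|s - t| + `|x - y|).
Hypothesis lipL : forall a, U a -> forall s t x y, s \in `[0, T] -> t \in `[0, T] ->
  `|L s x a - L t y a| <= K * (`|s - t| + `|x - y|).
Hypothesis L0 : forall s y a, s \in `[0, T] -> U a -> 0 <= L s y a.
Variable x : R -> 'rV[R]_n.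
Hypothesis acx : ac_curve t T x.
Let phi s := hamiltonian_conj U f L s (x s) (- x^`()%classic s).
Hypothesis phi_fin : (\int[mu]_(s in `[t, T]) phi s < +oo)%E.

Let itT s : t <= s -> s <= T -> s \in `[0, T].
Proof. by move=> ts sT; rewrite in_itv/= (le_trans t0 ts). Qed.

Let phi0 s : t <= s -> s <= T -> (0 <= phi s)%E.
Proof. by move=> ts sT; apply: hamiltonian_conj_ge0 => a Ua; apply: L0 => //; exact: itT. Qed.

(** Right-open intervals fit together without overlap, so that the
    superadditivity of the integral applies to consecutive ones. *)
Definition running_cost (s : R) : R := fine (\int[mu]_(r in `[t, s[) phi r).

Let int_fin u v : t <= u -> v <= T -> (\int[mu]_(r in `[u, v[) phi r)%E \is a fin_num.
Proof.
move=> tu vT; rewrite ge0_fin_numE; last first.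
  apply: integral_ge0 => r /=; rewrite in_itv/= => /andP[ur rv].
  by apply: phi0; [exact: le_trans ur|exact: le_trans (ltW rv) _].
apply: le_lt_trans phi_fin; apply: integral_domain_le.
  by move=> r /=; rewrite in_itv/= => /andP[tr rT]; exact: phi0.
move=> r /=; rewrite !in_itv/= => /andP[ur rv].
by rewrite (le_trans tu ur) (le_trans (ltW rv)).
Qed.

Lemma running_cost_ge0 s : s <= T -> 0 <= running_cost s.
Proof.
move=> sT; apply: fine_ge0; apply: integral_ge0 => r /=; rewrite in_itv/= => /andP[tr rs].
by apply: phi0 => //; exact: le_trans (ltW rs) _.
Qed.

Lemma running_cost_le s : t <= s -> s <= T ->
  ((running_cost s)%:E <= \int[mu]_(s in `[t, T]) phi s)%E.
Proof.
move=> ts sT; rewrite fineK ?int_fin//; apply: integral_domain_le.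
  by move=> r /=; rewrite in_itv/= => /andP[tr rT]; exact: phi0.
by move=> r /=; rewrite !in_itv/= => /andP[-> rs]; exact: le_trans (ltW rs) _.
Qed.

Lemma running_cost_superadditive u v : t <= u -> u <= v -> v <= T ->
  running_cost u + fine (\int[mu]_(r in `[u, v[) phi r) <= running_cost v.
Proof.
move=> tu uv vT; have f1 := int_fin (lexx t) (le_trans uv vT).
have f2 := int_fin tu vT; have f3 := int_fin (lexx t) vT.
rewrite /running_cost -fineD//.
have uvE : `[t, v[%classic = `[t, u[%classic `|` `[u, v[%classic.
  apply/seteqP; split => r /=; rewrite !in_itv/=.
    by move=> /andP[tr rv]; have [ur|ru] := leP u r; [right; rewrite rv|left; rewrite tr].
  move=> [/andP[tr ru]|/andP[ur rv]]; first by rewrite tr (lt_le_trans ru).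
  by rewrite rv (le_trans tu).
apply: fine_le => //; first by rewrite fin_numD f1.
rewrite uvE; apply: integral_superadditive.
  rewrite -uvE => r /=; rewrite in_itv/= => /andP[tr rv].
  by apply: phi0 => //; exact: le_trans (ltW rv) _.
apply/disj_setPS => r [/=]; rewrite !in_itv/= => /andP[_ ru] /andP[ur _].
by move: (lt_le_trans ru ur); rewrite ltxx.
Qed.

(** Velocities and costs reachable by mixing controls, with the cost allowed to
    be overestimated; the latter makes the set closed upwards. *)
Let mixtures (s : R) : set 'rV[R]_(n + 1) :=
  [set z | exists l (c : R), [/\ weights U 1 l,
     \sum_(w <- l) w.1 * L s (x s) w.2 <= c &
     z = row_mx (\sum_(w <- l) w.1 *: f s (x s) w.2) (const_mx c)]].

Let mixtures_convex s y z l : mixtures s y -> mixtures s z -> 0 <= l <= 1 ->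
  mixtures s (l *: y + (1 - l) *: z).
Proof.
move=> [l1 [c1 [w1 h1 ->]]] [l2 [c2 [w2 h2 ->]]] /andP[l0 l1'].
have l1'' : 0 <= 1 - l by rewrite subr_ge0.
exists (rescale l l1 ++ rescale (1 - l) l2), (l * c1 + (1 - l) * c2); split.
- rewrite [X in weights _ X](_ : 1 = l * 1 + (1 - l) * 1); last by ring.
  by apply: weights_cat; apply: weights_rescale.
- rewrite big_cat/= (sumr_rescale (L s (x s))) (sumr_rescale (L s (x s))).
  by apply: lerD; rewrite ler_wpM2l.
- rewrite big_cat/= (sum_rescale (f s (x s))) (sum_rescale (f s (x s))).
  rewrite !scale_row_mx add_row_mx; congr row_mx.
  by apply/rowP => i; rewrite !mxE.
Qed.

Let closure_convex (E : set 'rV[R]_(n + 1)) :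
  (forall y z l, E y -> E z -> 0 <= l <= 1 -> E (l *: y + (1 - l) *: z)) ->
  forall y z l, closure E y -> closure E z -> 0 <= l <= 1 ->
    closure E (l *: y + (1 - l) *: z).
Proof.
move=> cE y z l Ey Ez l01 A /nbhs_ballP[e /= e0 eA].
have [y' [Ey' yy']] := Ey _ (nbhsx_ballx y e e0).
have [z' [Ez' zz']] := Ez _ (nbhsx_ballx z e e0).
exists (l *: y' + (1 - l) *: z'); split; first exact: cE.
apply: eA; move: yy' zz'; rewrite -!ball_normE /= => yy' zz'.
have -> : l *: y + (1 - l) *: z - (l *: y' + (1 - l) *: z') =
  l *: (y - y') + (1 - l) *: (z - z').
  by apply/rowP => i; rewrite !mxE; ring.
have /andP[l0 l1] := l01; have l1' : 0 <= 1 - l by rewrite subr_ge0.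
apply: le_lt_trans (ler_normD _ _) _; rewrite !normrZ !ger0_norm//.
move: l0; rewrite le_eqVlt => /predU1P[<-|lp]; first by rewrite mul0r add0r subr0 mul1r.
have : l * `|y - y'| < l * e by rewrite ltr_pM2l.
have : (1 - l) * `|z - z'| <= (1 - l) * e by rewrite ler_wpM2l// ltW.
lra.
Qed.

(** Were the mean velocity and mean conjugate cost of [x] over a short interval
    far from all mixtures, the functional separating them would integrate to a
    contradiction, since the conjugate dominates every affine minorant of the
    cost.  The cost coefficient [q] of the functional may vanish, hence the
    perturbation [q + e]. *)
Lemma averaged_velocity (e : R) : 0 < e -> exists2 d, 0 < d &
  forall u v, t <= u -> u < v -> v <= T -> v - u < d -> exists l, [/\ weights U 1 l,
    `|\sum_(w <- l) w.1 *: f u (x u) w.2 - (v - u)^-1 *: (x v - x u)| <= e &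
    (v - u) * (\sum_(w <- l) w.1 * L u (x u) w.2) <=
      running_cost v - running_cost u + (v - u) * e].
Proof.
move=> e0; pose D : R := n%:R; have D0 : 0 <= D by rewrite /D.
pose kap := e / (2 * (D + 1)).
have D1 : 0 < D + 1 by rewrite ltr_wpDl.
have kap0 : 0 < kap by rewrite divr_gt0// mulr_gt0.
have K1 : 0 < 2 * K + 1 by rewrite ltr_wpDl// mulr_ge0.
pose e1 := kap / (2 * K + 1).
have e10 : 0 < e1 by rewrite divr_gt0.
have Ke1 : K * (e1 + e1) <= kap.
  have E : kap = (2 * K + 1) * e1 by rewrite /e1 mulrCA mulfV ?mulr1// gt_eqF.
  rewrite E; lra.
have [d d0 Hd] := ac_curve_unif_continuous acx e10.
exists (Num.min d e1); first by rewrite lt_min d0.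
move=> u v tu uv vT; rewrite lt_min => /andP[vd ve1].
have uT : u <= T by exact: le_trans (ltW uv) vT.
have uI := itT tu uT.
have vu0 : 0 < v - u by rewrite subr_gt0.
have var_small s : u <= s -> s <= v -> K * (`|s - u| + `|x s - x u|) <= kap.
  move=> us sv; apply: le_trans Ke1; rewrite ler_wpM2l//; apply: lerD.
    by rewrite ger0_norm ?subr_ge0//; lra.
  by apply: ltW; apply: Hd => //; lra.
pose ell := (v - u)^-1 * fine (\int[mu]_(r in `[u, v[) phi r).
pose vel := (v - u)^-1 *: (x v - x u).
pose P : 'rV[R]_(n + 1) := row_mx vel (const_mx ell).
have mix0 : closure (mixtures u) !=set0.
  have [a Ua] := U0; exists (row_mx (f u (x u) a) (const_mx (L u (x u) a))).
  apply: subset_closure; exists [:: (1, a)], (L u (x u) a); split.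
  - exact: weights1.
  - by rewrite big_seq1 mul1r.
  - by rewrite big_seq1 scale1r.
have [z mz zP] := convex_projection P (@closed_closure _ (mixtures u)) mix0
  (closure_convex (@mixtures_convex u)).
set N := z - P in zP.
have [p [q NE]] : exists p q, N = row_mx p (const_mx q : 'rV[R]_1).
  exists (lsubmx N), (rsubmx N ord0 ord0); rewrite -{1}(hsubmxK N); congr row_mx.
  by apply/rowP => i; rewrite (ord1 i) !mxE.
(* The half-space through the projection [z] with normal [N]; [S] is the value
   of the functional [(p, q)] at [z]. *)
pose S := dot p vel + q * ell + dot N N.
have above a r : U a -> 0 <= r -> S <= dot p (f u (x u) a) + q * (L u (x u) a + r).
  move=> Ua r0.
  have : closure (mixtures u) (row_mx (f u (x u) a) (const_mx (L u (x u) a + r))).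
    apply: subset_closure; exists [:: (1, a)], (L u (x u) a + r); split.
    - exact: weights1.
    - by rewrite big_seq1 mul1r lerDl.
    - by rewrite big_seq1 scale1r.
  move=> /zP.
  have -> : forall y, y - z = (y - P) - N by move=> y; rewrite /N opprB addrA subrK.
  rewrite dotBr dotBr {1 2}NE !dot_row_mx !mxE /S; lra.
(* The set of mixtures is closed upwards in the cost. *)
have q0 : 0 <= q.
  rewrite leNgt; apply/negP => qneg; have [a Ua] := U0.
  pose r := (`|S - dot p (f u (x u) a) - q * L u (x u) a| + 1) / (- q).
  have r0 : 0 <= r by rewrite divr_ge0 ?addr_ge0// oppr_ge0 ltW.
  have := above a r Ua r0.
  have -> : q * (L u (x u) a + r) = q * L u (x u) a
      - (`|S - dot p (f u (x u) a) - q * L u (x u) a| + 1).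
    by rewrite /r; field; rewrite lt_eqF.
  have := normr_ge0 (S - dot p (f u (x u) a) - q * L u (x u) a).
  have := ler_norm (- (S - dot p (f u (x u) a) - q * L u (x u) a)); rewrite normrN; lra.
have key e' : 0 < e' -> dot N N <= e' * ell + (D * `|p| + (q + e')) * kap.
  move=> e'0; pose q' := q + e'; have q'0 : 0 < q' by rewrite ltr_wpDl.
  pose k := S - (D * `|p| + q') * kap.
  have kle s a : u <= s -> s <= v -> U a -> k <= dot p (f s (x s) a) + q' * L s (x s) a.
    move=> us sv Ua; have sI := itT (le_trans tu us) (le_trans sv vT).
    have h1 := above a 0 Ua (lexx 0); rewrite addr0 in h1.
    have h2 : 0 <= e' * L u (x u) a by rewrite mulr_ge0// ?(ltW e'0)// L0.
    have h3 : `|f s (x s) a - f u (x u) a| <= kap.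
      by apply: le_trans (lipf Ua _ _ sI uI) _; exact: var_small.
    have h4 : L u (x u) a - L s (x s) a <= kap.
      apply: le_trans (ler_norm _) _; rewrite distrC.
      by apply: le_trans (lipL Ua _ _ sI uI) _; exact: var_small.
    have h5 : dot p (f u (x u) a) - dot p (f s (x s) a) <= D * `|p| * kap.
      rewrite -dotBr; apply: le_trans (ler_norm _) _; apply: le_trans (norm_dot_le _ _) _.
      by rewrite distrC mulrA ler_wpM2l// mulr_ge0.
    have h6 : q' * (L u (x u) a - L s (x s) a) <= q' * kap by rewrite ler_wpM2l// ltW.
    rewrite /k /q' in h6 *; lra.
  pose psi s := (dot p (- x^`()%classic s) + k) / q'.
  have acd := acx; case: acd => _ _ ix.
  have ixuv A : measurable A -> A `<=` `[t, T] -> forall i : 'I_n,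
      mu.-integrable A (fun s => (x^`()%classic s ord0 i)%:E).
    by move=> mA AtT i; apply: integrableS (ix i).
  have uvtT : `[u, v] `<=` `[t, T].
    by move=> r /=; rewrite !in_itv/= => /andP[ur rv]; rewrite (le_trans tu ur) (le_trans rv vT).
  have ipx : mu.-integrable `[u, v] (EFin \o (fun s => dot p (x^`()%classic s))).
    by apply: integrable_dot => //; exact: ixuv.
  have icst c : mu.-integrable `[u, v] (EFin \o cst c).
    apply: continuous_compact_integrable; first exact: segment_compact.
    exact: cst_continuous.
  have psiE : psi = fun s => k / q' - q'^-1 * dot p (x^`()%classic s).
    by apply/funext => s; rewrite /psi dotNr; ring.
  have ipx' : mu.-integrable `[u, v] (EFin \o (fun s => q'^-1 * dot p (x^`()%classic s))).
    by rewrite (_ : _ \o _ = fun s => (q'^-1%:E * (dot p (x^`()%classic s))%:E)%E)//; exact: integrableZl.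
  have ipsi : mu.-integrable `[u, v] (EFin \o psi).
    rewrite psiE; exact: (@integrableB _ _ _ mu _ _ _ _ (icst (k / q')) ipx').
  have ipsi' : mu.-integrable `[u, v[ (EFin \o psi).
    by apply: integrableS ipsi => //; exact: subset_itv_co_cc.
  have intpsi : \int[mu]_(s in `[u, v[) psi s = (k * (v - u) - dot p (x v - x u)) / q'.
    rewrite Rintegral_itv_bndo_bndc// psiE.
    have -> : \int[mu]_(s in `[u, v]) (k / q' - q'^-1 * dot p (x^`()%classic s)) =
        \int[mu]_(s in `[u, v]) cst (k / q') s -
        \int[mu]_(s in `[u, v]) (q'^-1 * dot p (x^`()%classic s)).
      by apply: RintegralB => //; exact: icst.
    rewrite Rintegral_cst// RintegralZl//.
    rewrite -(ac_curve_ftc p acx tu (ltW uv) vT).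
    have -> : fine (mu `[u, v]) = v - u.
      by have := congr1 fine (@lebesgue_measure_itv R `[u, v]); rewrite /= lte_fin uv.
    ring.
  have psi_le : (\int[mu]_(s in `[u, v[) (psi s)%:E <= \int[mu]_(s in `[u, v[) phi s)%E.
    apply: integrable_le_integral_nonmeas => //.
      move=> r /=; rewrite in_itv/= => /andP[ur rv].
      by apply: phi0; [exact: le_trans ur|exact: le_trans (ltW rv) _].
    apply: aeW => r /=; rewrite in_itv/= => /andP[ur rv].
    apply: hamiltonian_conj_ge => // a Ua; apply: kle => //; exact: ltW.
  have : \int[mu]_(s in `[u, v[) psi s <= fine (\int[mu]_(s in `[u, v[) phi s).
    by apply: fine_le => //; [exact: integrable_fin_num|exact: int_fin].
  rewrite intpsi ler_pdivrMr//.
  have -> : fine (\int[mu]_(s in `[u, v[) phi s) = (v - u) * ell.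
    by rewrite /ell mulrA mulfV ?mul1r// gt_eqF.
  have -> : dot p (x v - x u) = (v - u) * dot p vel.
    by rewrite /vel dotZr mulrA mulfV ?mul1r// gt_eqF.
  rewrite mulrAC -mulrA (mulrC k) -mulrBr ler_pM2l// /k /S /q'; lra.
have NN : dot N N <= (D * `|p| + q) * kap.
  apply/ler_addgt0Pl => eps eps0.
  have l0 : 0 <= ell.
    rewrite mulr_ge0 ?invr_ge0 ?(ltW vu0)//; apply: fine_ge0; apply: integral_ge0 => r /=.
    rewrite in_itv/= => /andP[ur rv].
    by apply: phi0; [exact: le_trans ur|exact: le_trans (ltW rv) _].
  have w0 : 0 < ell + kap by rewrite ltr_wpDl.
  have := key _ (divr_gt0 eps0 w0); set e' := eps / (ell + kap).
  have : e' * (ell + kap) = eps by rewrite /e' divfK ?gt_eqF.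
  lra.
have Nn : `|N| <= e / 2.
  have h1 : `|p| <= `|N| by rewrite NE norm_row_mxl.
  have h2 : q <= `|N|.
    apply: le_trans (ler_norm _) _; have := norm_row_mxr p (const_mx q).
    by rewrite mxE NE.
  have h3 : `|N| ^+ 2 <= (D + 1) * kap * `|N|.
    apply: le_trans (sqr_norm_le_dot N) _; apply: le_trans NN _.
    rewrite mulrAC ler_wpM2r ?(ltW kap0)// mulrDl mul1r; apply: lerD => //.
    by rewrite ler_wpM2l.
  have : `|N| <= (D + 1) * kap.
    have [->|N0] := eqVneq `|N| 0; first by rewrite mulr_ge0// ltW.
    by move: h3; rewrite expr2 ler_pM2r// lt_neqAle eq_sym N0 normr_ge0.
  by rewrite /kap (_ : (D + 1) * _ = e / 2)//; field; rewrite gt_eqF.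
have e20 : 0 < e / 2 by rewrite divr_gt0.
have [y [[l [c [wl lc yE]]] zy]] := mz _ (nbhsx_ballx z _ e20).
move: zy; rewrite -ball_normE /= => zy.
have yP : `|y - P| <= e.
  rewrite (_ : y - P = N - (z - y)); last by apply/rowP => i; rewrite /N !mxE; ring.
  apply: le_trans (ler_normB _ _) _; lra.
have yPE : y - P = row_mx (\sum_(w <- l) w.1 *: f u (x u) w.2 - vel) (const_mx (c - ell)).
  rewrite yE /P opp_row_mx add_row_mx; congr row_mx.
  by apply/rowP => i; rewrite !mxE.
exists l; split => //.
  by apply: le_trans yP; rewrite yPE; exact: norm_row_mxl.
have cle : c - ell <= e.
  apply: le_trans (ler_norm _) _; apply: le_trans yP; rewrite yPE.
  by have := norm_row_mxr (\sum_(w <- l) w.1 *: f u (x u) w.2 - vel) (const_mx (c - ell)); rewrite mxE.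
have sup_ := running_cost_superadditive tu (ltW uv) vT.
have ellE : (v - u) * ell = fine (\int[mu]_(s in `[u, v[) phi s).
  by rewrite /ell mulrA mulfV ?mul1r// gt_eqF.
apply: (@le_trans _ _ ((v - u) * (ell + e))).
  by rewrite ler_wpM2l ?(ltW vu0)//; lra.
rewrite mulrDr ellE; lra.
Qed.

End averaged_velocities.

(** * Controlled arcs and chattering *)

Section measurability_gluing.
Context {R : realType}.

Let set_seq_cons (e : R) (E : seq R) : [set` e :: E] = e |` [set` E].
Proof.
apply/seteqP; split => s /=; rewrite inE; first by move=> /predU1P[->|sE]; [left|right].
by move=> [->|sE]; rewrite ?eqxx// sE orbT.
Qed.

Lemma seq_set_measurable (E : seq R) : measurable [set` E].
Proof.
elim: E => [|e E IHE]; first by rewrite set_nil.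
by rewrite set_seq_cons; apply: measurableU => //; exact: measurable_set1.
Qed.

(** Points are Borel sets, so the values at finitely many of them are
    irrelevant for measurability. *)
Lemma measurable_off_seq (D : set R) (E : seq R) (h : R -> R) : measurable D ->
  measurable_fun (D `\` [set` E]) h -> measurable_fun D h.
Proof.
move=> mD; elim: E => [|e E IHE]; first by rewrite set_nil setD0.
rewrite set_seq_cons => mh; apply: IHE; have mE := seq_set_measurable E.
have m1 : measurable (D `\` (e |` [set` E])).
  by apply: measurableD => //; apply: measurableU => //; exact: measurable_set1.
apply: (@measurable_funS _ _ _ _ ((D `\` (e |` [set` E])) `|` [set e])).
- by apply: measurableU => //; exact: measurable_set1.
- by move=> s [Ds nE]; have [->|ne] := eqVneq s e; [right|left; split => // -[/eqP|//]; rewrite (negbTE ne)].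
- by apply/measurable_funU => //; split => //; exact: measurable_fun_set1.
Qed.

Lemma measurable_glue (a b c : R) (h h1 h2 : R -> R) : a <= b -> b <= c ->
  measurable_fun `]a, b[ h1 -> measurable_fun `]b, c[ h2 ->
  (forall s, a < s -> s < b -> h s = h1 s) ->
  (forall s, b < s -> s < c -> h s = h2 s) ->
  measurable_fun `]a, c[ h.
Proof.
move=> ab bc m1 m2 e1 e2; apply: (@measurable_off_seq _ [:: b]) => //.
apply: (@measurable_funS _ _ _ _ (`]a, b[%classic `|` `]b, c[%classic)).
- exact: measurableU.
- move=> s [/=]; rewrite in_itv/= inE => /andP[as_ sc] /eqP sb.
  by rewrite !in_itv/= as_ sc andbT; case: ltgtP sb => // _ _; [left|right].
- apply/measurable_funU => //; split.
    by apply: eq_measurable_fun m1 => s; rewrite inE/= in_itv/= => /andP[? ?]; rewrite e1.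
  by apply: eq_measurable_fun m2 => s; rewrite inE/= in_itv/= => /andP[? ?]; rewrite e2.
Qed.

Lemma seq_set_measure0 (E : seq R) : lebesgue_measure [set` E] = 0%E.
Proof. by apply: countable_lebesgue_measure0; apply: finite_set_countable; exact: finite_seq. Qed.

End measurability_gluing.

Section arcs.
Context {R : realType} {n m : nat}.
Local Notation mu := (@lebesgue_measure R).
Variables (T K M : R) (U : set 'rV[R]_m).
Variables (f : R -> 'rV[R]_n -> 'rV[R]_m -> 'rV[R]_n).
Variables (L : R -> 'rV[R]_n -> 'rV[R]_m -> R).
Variable (C : set 'rV[R]_n).

(** A piecewise smooth controlled trajectory inside [C]: the equation holds off
    a finite set, which makes concatenation a matter of adding one point. *)
Record arc (s0 s1 : R) (u : R -> 'rV[R]_m) (x : R -> 'rV[R]_n) (c : R) : Prop := Arc {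
  arc_lip : forall p q, s0 <= p -> p <= q -> q <= s1 -> `|x q - x p| <= M * (q - p);
  arc_in : forall s, s0 <= s -> s <= s1 -> C (x s);
  arc_control : forall s, U (u s);
  arc_control_measurable : forall j, measurable_fun setT (fun s => u s ord0 j);
  arc_ode : exists E : seq R, forall s, s0 < s -> s < s1 -> s \notin E ->
    derivable x s 1 /\ x^`()%classic s = f s (x s) (u s);
  arc_rhs_measurable : forall i, measurable_fun `]s0, s1[ (fun s => f s (x s) (u s) ord0 i);
  arc_cost_measurable : measurable_fun `]s0, s1[ (fun s => L s (x s) (u s));
  arc_cost : (\int[mu]_(s in `]s0, s1[) (L s (x s) (u s))%:E <= c%:E)%E }.

Definition reach (s0 : R) (y0 : 'rV[R]_n) (s1 : R) (y1 : 'rV[R]_n) (c : R) :=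
  exists u x, [/\ arc s0 s1 u x c, x s0 = y0 & x s1 = y1].

Lemma reach_refl s y a : 0 <= M -> U a -> C y -> reach s y s y 0.
Proof.
move=> M0 Ua Cy; exists (fun=> a), (fun=> y); split => //.
have e0 : `]s, s[%classic = set0 :> set R by rewrite set_itvoo0.
split => //.
- by move=> p q _ pq _; rewrite subrr normr0 mulr_ge0// subr_ge0.
- by exists [::] => r sr rs; move: (lt_trans sr rs); rewrite ltxx.
- by move=> i; rewrite e0; exact: measurable_fun_set0.
- by rewrite e0; exact: measurable_fun_set0.
- by rewrite e0 integral_set0.
Qed.

Lemma derivable_near_eq (x z : R -> 'rV[R]_n) s d : 0 < d ->
  (forall r, `|r - s| < d -> x r = z r) -> derivable x s 1 ->
  derivable z s 1 /\ z^`()%classic s = x^`()%classic s.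
Proof.
move=> d0 xz dx; apply: expansion_derivable => e /(derivable_expansion dx)[d' d'0 H].
exists (Num.min d d'); first by rewrite lt_min d0.
move=> v; rewrite lt_min => /andP[vd vd']; rewrite -xz// -(xz s) ?subrr ?normr0//.
exact: H.
Qed.

Lemma reach_trans s0 y0 s1 y1 s2 y2 c1 c2 : s0 <= s1 -> s1 <= s2 ->
  (forall s y a, s0 <= s -> s <= s2 -> U a -> 0 <= L s y a) ->
  reach s0 y0 s1 y1 c1 -> reach s1 y1 s2 y2 c2 -> reach s0 y0 s2 y2 (c1 + c2).
Proof.
move=> s01 s12 L0 [u1 [x1 [A1 x10 x11]]] [u2 [x2 [A2 x21 x22]]].
pose u s := if s < s1 then u1 s else u2 s.
pose x s := if s < s1 then x1 s else x2 s.
have xl s : s <= s1 -> x s = x1 s.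
  by rewrite le_eqVlt /x => /predU1P[->|->//]; rewrite ltxx x21 x11.
have xr s : s1 <= s -> x s = x2 s by rewrite /x => h; rewrite ltNge h.
have ul s : s < s1 -> u s = u1 s by rewrite /u => ->.
have ur s : s1 <= s -> u s = u2 s by rewrite /u => h; rewrite ltNge h.
exists u, x; split; [|by rewrite xl|by rewrite xr].
have mc : measurable_fun `]s0, s2[ (fun s => L s (x s) (u s)).
  apply: (measurable_glue s01 s12 (arc_cost_measurable A1) (arc_cost_measurable A2)).
    by move=> s _ ss1; rewrite xl ?ul// ltW.
  by move=> s ss1 _; rewrite xr ?ur// ltW.
split => //.
- move=> p q p0 pq q2; have [qs|/ltW sq] := leP q s1.
    by rewrite !xl ?(le_trans pq)//; exact: (arc_lip A1).
  have [ps|/ltW sp] := leP p s1; last by rewrite !xr//; exact: (arc_lip A2).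
  rewrite (xl p)// (xr q)//.
  have -> : x2 q - x1 p = (x2 q - x2 s1) + (x1 s1 - x1 p) by rewrite x21 -x11 addrA subrK.
  apply: le_trans (ler_normD _ _) _.
  have := arc_lip A1 p0 ps (lexx _); have := arc_lip A2 (lexx _) sq q2; lra.
- move=> s h0 h2; have [ss|/ltW ss] := leP s s1.
    by rewrite xl//; exact: (arc_in A1).
  by rewrite xr//; exact: (arc_in A2).
- by move=> s; rewrite /u; case: ifP => _; [exact: (arc_control A1)|exact: (arc_control A2)].
- move=> j; rewrite (_ : (fun s => _) = fun s => if s < s1 then u1 s ord0 j else u2 s ord0 j); last first.
    by apply/funext => s; rewrite /u; case: ifP.
  apply: measurable_fun_ifT; [|exact: (arc_control_measurable A1)|exact: (arc_control_measurable A2)].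
  by apply: measurable_fun_ltr => //; exact: measurable_id.
- have [E1 H1] := arc_ode A1; have [E2 H2] := arc_ode A2.
  exists (s1 :: E1 ++ E2) => s h0 h2; rewrite inE mem_cat !negb_or => /andP[ns /andP[n1 n2]].
  have [lt|gt|es] := ltgtP s s1; last by rewrite es eqxx in ns.
  + have [dx eq] := H1 s h0 lt n1.
    have d0 : 0 < s1 - s by rewrite subr_gt0.
    have := derivable_near_eq (z := x) d0 _ dx => -[r|dz ez].
      by rewrite ltr_norml => /andP[_ h]; rewrite xl//; lra.
    by split=> //; rewrite ez eq xl ?ul// ltW.
  + have [dx eq] := H2 s gt h2 n2.
    have d0 : 0 < s - s1 by rewrite subr_gt0.
    have := derivable_near_eq (z := x) d0 _ dx => -[r|dz ez].
      by rewrite ltr_norml => /andP[h _]; rewrite xr//; lra.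
    by split=> //; rewrite ez eq xr ?ur// ltW.
- move=> i; apply: (measurable_glue s01 s12 (arc_rhs_measurable A1 i) (arc_rhs_measurable A2 i)).
    by move=> s _ ss1; rewrite xl ?ul// ltW.
  by move=> s ss1 _; rewrite xr ?ur// ltW.
- have U12 : (`]s0, s2[%classic `\` [set s1] = `]s0, s1[%classic `|` `]s1, s2[%classic)%classic.
    apply/seteqP; split => s /=; rewrite !in_itv/=.
      by move=> [/andP[-> ->] ns]; rewrite andbT; case: ltgtP ns => // _ _; [left|right].
    move=> [/andP[h0 h1]|/andP[h1 h2]].
      by split; [rewrite h0 (lt_le_trans h1)|move=> h; rewrite h ltxx in h1].
    by split; [rewrite h2 (le_lt_trans s01)|move=> h; rewrite h ltxx in h1].
  have mcE : measurable_fun `]s0, s2[ (fun s => (L s (x s) (u s))%:E) by exact/measurable_EFinP.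
  have mD : measurable (`]s0, s2[%classic `\` [set s1]) by apply: measurableD => //; exact: measurable_set1.
  rewrite -(@integral_setD1 _ _ s1)//; last by apply: measurable_funS mcE => //; exact: subDsetl.
  rewrite U12 ge0_integral_setU//=; first last.
  + apply/disj_setPS => r [/=]; rewrite !in_itv/= => /andP[_ h1] /andP[h2 _].
    by move: (lt_trans h1 h2); rewrite ltxx.
  + move=> s; rewrite !in_itv/= => H; rewrite lee_fin; apply: L0.
    * by case: H => /andP[h1 h2]; apply: ltW => //; exact: le_lt_trans h1.
    * by case: H => /andP[h1 h2]; apply: ltW => //; exact: lt_le_trans s12.
    * by rewrite /u; case: ifP => _; [exact: (arc_control A1)|exact: (arc_control A2)].
  + by rewrite -U12; apply: measurable_funS mcE => //; exact: subDsetl.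
  rewrite EFinD; apply: leeD.
    apply: le_trans (arc_cost A1); rewrite le_eqVlt; apply/orP; left; apply/eqP.
    apply: eq_integral => s; rewrite inE/= in_itv/= => /andP[h0 h1].
    by rewrite xl ?ul// ltW.
  apply: le_trans (arc_cost A2); rewrite le_eqVlt; apply/orP; left; apply/eqP.
  apply: eq_integral => s; rewrite inE/= in_itv/= => /andP[h0 h1].
  by rewrite xr ?ur// ltW.
Qed.

Hypotheses (K0 : 0 <= K) (M0 : 0 <= M).
Hypothesis lipf : forall a, U a -> forall s t x y, s \in `[0, T] -> t \in `[0, T] ->
  `|f s x a - f t y a| <= K * (`|s - t| + `|x - y|).
Hypothesis lipL : forall a, U a -> forall s t x y, s \in `[0, T] -> t \in `[0, T] ->
  `|L s x a - L t y a| <= K * (`|s - t| + `|x - y|).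
Hypothesis L0 : forall s y a, s \in `[0, T] -> U a -> 0 <= L s y a.
Hypothesis boundf : forall s y0 y a, s \in `[0, T] -> C y0 -> `|y - y0| <= 1 -> U a -> `|f s y a| <= M.

(** Whether the solution stays in [C] is left to the caller, who knows it either
    from a ball around the starting point or from the inward direction. *)
Lemma constant_control_arc s0 y0 h a : 0 <= s0 -> 0 <= h -> s0 + h <= T ->
  K * h <= 2^-1 -> M * h <= 1 -> C y0 -> U a -> exists y : R -> 'rV[R]_n,
  [/\ y s0 = y0,
    forall u v, s0 <= u -> u <= v -> v <= s0 + h -> `|y v - y u| <= M * (v - u),
    forall v, s0 <= v -> v <= s0 + h ->
      `|y v - y0 - (v - s0) *: f s0 y0 a| <= K * (1 + M) * (v - s0) ^+ 2 &
    (forall s, s0 <= s -> s <= s0 + h -> C (y s)) ->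
      arc s0 (s0 + h) (fun=> a) y (h * (L s0 y0 a + K * (1 + M) * h))].
Proof.
move=> s00 h0 hT Kh Mh Cy0 Ua.
have IT s : s0 <= s <= s0 + h -> s \in `[0, T].
  by move=> /andP[h1 h2]; rewrite in_itv/= (le_trans s00 h1) (le_trans h2 hT).
have lipF s s' y y' : s0 <= s <= s0 + h -> s0 <= s' <= s0 + h ->
    `|f s y a - f s' y' a| <= K * (`|s - s'| + `|y - y'|).
  by move=> sI s'I; apply: lipf => //; exact: IT.
have bF s y : s0 <= s <= s0 + h -> `|y - y0| <= 1 -> `|f s y a| <= M.
  by move=> sI yy0; apply: (boundf (y0 := y0)) => //; exact: IT.
have [y [ys0 ylip y2]] := @picard_lindelof_local R n (fun s y => f s y a) s0 h K M y0 h0 K0 Mh Kh lipF bF.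
exists y; split => //.
  by move=> v h1 h2; have := y2 s0 v (lexx _) h1 h2; rewrite ys0.
move=> yC.
have s0h : s0 <= s0 + h by rewrite lerDl.
have K1M : 0 <= K * (1 + M) by rewrite mulr_ge0// addr_ge0.
pose cl := clamp s0 (s0 + h).
have clI s : s0 <= cl s <= s0 + h by exact: clamp_itv.
have ylip' s s' : `|y (cl s) - y (cl s')| <= M * `|s - s'|.
  apply: (@le_trans _ _ (M * `|cl s - cl s'|)); last by rewrite ler_wpM2l// clamp_lip.
  have /andP[a1 a2] := clI s; have /andP[b1 b2] := clI s'.
  have [le|/ltW le] := leP (cl s) (cl s').
    by rewrite distrC (distrC (cl s)) (ger0_norm (_ : 0 <= cl s' - cl s)) ?subr_ge0// ylip.
  by rewrite (ger0_norm (_ : 0 <= cl s - cl s')) ?subr_ge0// ylip.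
have slopeL (V : normedModType R) (G : R -> 'rV[R]_n -> V) :
    (forall s s' y y', s \in `[0, T] -> s' \in `[0, T] -> `|G s y - G s' y'| <= K * (`|s - s'| + `|y - y'|)) ->
    continuous (fun s => G (cl s) (y (cl s))).
  move=> lG; apply: (@lipschitz_continuous _ _ _ _ (K * (1 + M))) => s s'.
  apply: le_trans (lG _ _ _ _ (IT _ (clI s)) (IT _ (clI s'))) _.
  rewrite -mulrA ler_wpM2l// mulrDl mul1r; apply: lerD => //; exact: clamp_lip.
have clamp_inside s : s0 < s -> s < s0 + h -> cl s = s by move=> h1 h2; rewrite /cl clamp_id// ltW.
split => //.
- exists [::] => s h1 h2 _; apply: expansion_derivable => e e0.
  pose k1 := 2 * (K * (1 + M)) + 1.
  have k10 : 0 < k1 by rewrite ltr_wpDl// mulr_ge0.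
  exists (Num.min (e / k1) (Num.min (s - s0) (s0 + h - s))).
    by rewrite !lt_min divr_gt0//= !subr_gt0 h1.
  move=> v; rewrite !lt_min => /and3P[v1 v2 v3].
  have vI : s0 <= v <= s0 + h.
    by move: v2 v3; rewrite !ltr_norml => /andP[? ?] /andP[? ?]; lra.
  have sI : s0 <= s <= s0 + h by rewrite !ltW.
  have /andP[v0 vh] := vI.
  (* The expansion is known forward in time only; backward in time it is used
     from [v] and the slope at [v] is exchanged for the slope at [s]. *)
  have est : `|y v - y s - (v - s) *: f s (y s) a| <= k1 * `|v - s| ^+ 2.
    have [sv|/ltW vs] := leP s v.
      apply: le_trans (y2 s v (ltW h1) sv vh) _.
      by rewrite real_normK ?num_real// ler_wpM2r ?sqr_ge0// /k1; lra.
    have -> : y v - y s - (v - s) *: f s (y s) a =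
       (s - v) *: (f s (y s) a - f v (y v) a) - (y s - y v - (s - v) *: f v (y v) a).
      by apply/rowP => i; rewrite !mxE; ring.
    apply: le_trans (ler_normB _ _) _.
    have e1 := y2 v s v0 vs (ltW h2).
    have e2 : `|f s (y s) a - f v (y v) a| <= K * (1 + M) * (s - v).
      apply: le_trans (lipF _ _ _ _ sI vI) _; rewrite -mulrA ler_wpM2l// mulrDl mul1r.
      by rewrite (ger0_norm (_ : 0 <= s - v)) ?subr_ge0// lerD2l ylip// ltW.
    rewrite normrZ (ger0_norm (_ : 0 <= s - v)) ?subr_ge0// (distrC v) (ger0_norm (_ : 0 <= s - v)) ?subr_ge0//.
    have e3 : (s - v) * `|f s (y s) a - f v (y v) a| <= (s - v) * (K * (1 + M) * (s - v)).
      by rewrite ler_wpM2l// subr_ge0.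
    have e4 : 0 <= (s - v) ^+ 2 by rewrite sqr_ge0.
    rewrite /k1; move: e1 e3 e4; rewrite !expr2; lra.
  apply: le_trans est _; rewrite expr2 mulrA ler_wpM2r//.
  by rewrite mulrC -ler_pdivlMr// ltW.
- move=> i; apply: (@eq_measurable_fun _ _ _ _ _ (fun s => f (cl s) (y (cl s)) a ord0 i)).
    by move=> s; rewrite inE/= in_itv/= => /andP[h1 h2]; rewrite clamp_inside.
  apply: measurable_funTS; apply: continuous_measurable_fun => s.
  apply: (@cvg_comp _ _ _ (fun s => f (cl s) (y (cl s)) a) (fun N => N ord0 i) _ _ _ (slopeL _ (fun s y => f s y a) (lipf Ua) s)).
  exact: coord_continuous.
- apply: (@eq_measurable_fun _ _ _ _ _ (fun s => L (cl s) (y (cl s)) a)).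
    by move=> s; rewrite inE/= in_itv/= => /andP[h1 h2]; rewrite clamp_inside.
  apply: measurable_funTS; apply: continuous_measurable_fun.
  exact: (slopeL R (fun s y => L s y a) (lipL Ua)).
- have mL : measurable_fun `]s0, (s0 + h)[ (fun s => (L s (y s) a)%:E).
    apply/measurable_EFinP.
    apply: (@eq_measurable_fun _ _ _ _ _ (fun s => L (cl s) (y (cl s)) a)).
      by move=> s; rewrite inE/= in_itv/= => /andP[h1 h2]; rewrite clamp_inside.
    apply: measurable_funTS; apply: continuous_measurable_fun.
    exact: (slopeL R (fun s y => L s y a) (lipL Ua)).
  set k := L s0 y0 a + K * (1 + M) * h.
  have -> : h * k = fine (\int[mu]_(s in `]s0, (s0 + h)[) (cst k%:E) s).
    rewrite integral_cst//= lebesgue_measure_itv/= lte_fin.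
    case: ifPn => [_|]; first by rewrite -EFinD -EFinM addrAC subrr add0r mulrC.
    by rewrite -leNgt gerDl => h0'; rewrite (le_anti (introT andP (conj h0' h0))) mule0 mul0r.
  rewrite fineK; last first.
    by rewrite integral_cst//= lebesgue_measure_itv/=; case: ifP => // _; rewrite mule0.
  apply: ge0_le_integral => //.
  + move=> s /=; rewrite in_itv/= => /andP[h1 h2]; rewrite lee_fin L0//.
    by apply: IT; rewrite !ltW.
  + move=> s /=; rewrite in_itv/= => /andP[h1 h2]; rewrite lee_fin.
    have sI : s0 <= s <= s0 + h by rewrite !ltW.
    have I0 : s0 <= s0 <= s0 + h by rewrite lexx.
    have := lipL Ua (y s) y0 (IT _ sI) (IT _ I0); rewrite ler_norml => /andP[_ H].
    have yd : `|y s - y0| <= M * (s - s0) by rewrite -ys0 ylip// ltW.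
    have : K * (`|s - s0| + `|y s - y0|) <= K * (1 + M) * h.
      have yh : M * (s - s0) <= M * h by rewrite ler_wpM2l//; lra.
      have ss0 : `|s - s0| = s - s0 by rewrite ger0_norm// subr_ge0 ltW.
      by rewrite -mulrA ler_wpM2l// ss0; lra.
    rewrite /k; lra.
Qed.

(** Chattering: running through the controls of a convex combination for times
    proportional to their weights realises, up to an error of second order in
    the duration, the combined velocity and the combined cost. *)
Lemma chattering_from s y h l : 0 <= s -> 0 <= h -> s + h <= T ->
  K * h <= 2^-1 -> M * h <= 1 -> (forall z, `|z - y| <= M * h -> C z) ->
  U !=set0 -> forall w, weights U w l -> forall s1 y1,
  s <= s1 -> s1 + h * w <= s + h -> `|y1 - y| <= M * (s1 - s) ->
  exists y2 c, [/\ reach s1 y1 (s1 + h * w) y2 c,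
    `|y2 - y1 - h *: \sum_(d <- l) d.1 *: f s y d.2| <= 2 * (K * (1 + M)) * h * (h * w) &
    c <= h * (\sum_(d <- l) d.1 * L s y d.2) + 2 * (K * (1 + M)) * h * (h * w)].
Proof.
move=> s00 h0 hT Kh Mh yC [a0 Ua0].
have K1M : 0 <= K * (1 + M) by rewrite mulr_ge0// addr_ge0.
elim: l => [|[lam a] l IHl] w [pl sw] s1 y1 ss1 s1h yy1.
  rewrite -sw !big_nil mulr0 addr0; exists y1, 0.
  have Cy1 : C y1.
    apply: yC; apply: le_trans yy1 _; rewrite ler_wpM2l//.
    by move: s1h; rewrite -sw big_nil mulr0; lra.
  split; [exact: (reach_refl _ M0 Ua0)|by rewrite scaler0 !subrr normr0 !mulr0|by rewrite !mulr0 addr0].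
have [/= lam0 Ua] := pl (lam, a) (mem_head _ _).
have pl' : {in l, forall d, 0 <= d.1 /\ U d.2} by move=> d dl; apply: pl; rewrite inE dl orbT.
rewrite !big_cons/= in sw *; set w' := \sum_(d <- l) d.1 in sw *.
have w'0 : 0 <= w' by rewrite /w' big_seq sumr_ge0// => d /pl'[].
have hl0 : 0 <= h * lam by rewrite mulr_ge0.
have hw0 : 0 <= h * w' by rewrite mulr_ge0.
have hw : h * w = h * lam + h * w' by rewrite -sw mulrDr.
have hlh : h * lam <= h by lra.
have s1I : s1 \in `[0, T] by rewrite in_itv/=; apply/andP; split; lra.
have sI : s \in `[0, T] by rewrite in_itv/=; apply/andP; split; lra.
have near_y z s' : s1 <= s' -> s' <= s1 + h * lam -> `|z - y1| <= M * (s' - s1) -> C z.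
  move=> h1 h2 h3; apply: yC; have -> : z - y = (z - y1) + (y1 - y) by rewrite addrA subrK.
  apply: le_trans (ler_normD _ _) _; apply: le_trans (lerD h3 yy1) _.
  by rewrite -mulrDr ler_wpM2l//; lra.
have Cy1 : C y1 by apply: (near_y y1 s1); rewrite ?lerDl// !subrr normr0 mulr0.
have [z [z0 zlip z2 zarc]] : exists z : R -> 'rV[R]_n, [/\ z s1 = y1,
    forall u v, s1 <= u -> u <= v -> v <= s1 + h * lam -> `|z v - z u| <= M * (v - u),
    forall v, s1 <= v -> v <= s1 + h * lam ->
      `|z v - y1 - (v - s1) *: f s1 y1 a| <= K * (1 + M) * (v - s1) ^+ 2 &
    (forall s, s1 <= s -> s <= s1 + h * lam -> C (z s)) ->
      arc s1 (s1 + h * lam) (fun=> a) z (h * lam * (L s1 y1 a + K * (1 + M) * (h * lam)))].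
  apply: constant_control_arc => //.
  - lra.
  - lra.
  - by apply: le_trans Kh; rewrite ler_wpM2l.
  - by apply: le_trans Mh; rewrite ler_wpM2l.
pose y1' := z (s1 + h * lam).
have {}zarc : arc s1 (s1 + h * lam) (fun=> a) z (h * lam * (L s1 y1 a + K * (1 + M) * (h * lam))).
  by apply: zarc => s' h1 h2; apply: (near_y _ s') => //; rewrite -z0 zlip.
have y1'd : `|y1' - y1| <= M * (h * lam).
  by have := zlip s1 (s1 + h * lam) (lexx _); rewrite lerDl z0 addrAC subrr add0r; apply.
have [] := IHl w' (conj pl' erefl) (s1 + h * lam) y1'.
- lra.
- lra.
- have -> : y1' - y = (y1' - y1) + (y1 - y) by rewrite addrA subrK.
  by apply: le_trans (ler_normD _ _) _; apply: le_trans (lerD y1'd yy1) _; rewrite -mulrDr ler_wpM2l//; lra.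
move=> y2 [c [rc d2 c2]].
have sd : `|s1 - s| + `|y1 - y| <= (1 + M) * h.
  rewrite mulrDl mul1r; apply: lerD; first by rewrite ger0_norm ?subr_ge0//; lra.
  by apply: le_trans yy1 _; rewrite ler_wpM2l//; lra.
exists y2, (h * lam * (L s1 y1 a + K * (1 + M) * (h * lam)) + c); split.
- rewrite hw addrA; apply: (@reach_trans _ _ (s1 + h * lam) y1').
  + by rewrite lerDl.
  + by rewrite lerDl.
  + by move=> s' y' a' h1 h2 Ua'; apply: L0 => //; rewrite in_itv/=; apply/andP; split; lra.
  + by exists (fun=> a), z.
  + exact: rc.
- have -> : y2 - y1 - h *: (lam *: f s y a + \sum_(d <- l) d.1 *: f s y d.2) =
    (y2 - y1' - h *: (\sum_(d <- l) d.1 *: f s y d.2)) +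
    ((y1' - y1 - (h * lam) *: f s1 y1 a) + (h * lam) *: (f s1 y1 a - f s y a)).
    by rewrite scalerDr scalerA; apply/rowP => i; rewrite !mxE; ring.
  apply: le_trans (ler_normD _ _) _; rewrite hw mulrDr addrC; apply: lerD => //.
  apply: le_trans (ler_normD _ _) _; rewrite normrZ ger0_norm//.
  have e1 : `|y1' - y1 - (h * lam) *: f s1 y1 a| <= K * (1 + M) * h * (h * lam).
    have E : s1 + h * lam - s1 = h * lam by rewrite addrAC subrr add0r.
    have := z2 (s1 + h * lam); rewrite lerDl E => /(_ hl0 (lexx _)) H.
    by apply: le_trans H _; rewrite expr2 mulrA ler_wpM2r// ler_wpM2l.
  have e2 : h * lam * `|f s1 y1 a - f s y a| <= h * lam * (K * (1 + M) * h).
    by rewrite ler_wpM2l//; apply: le_trans (lipf Ua _ _ s1I sI) _; rewrite -mulrA ler_wpM2l.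
  lra.
- have e1 : L s1 y1 a - L s y a <= K * (1 + M) * h.
    apply: le_trans (ler_norm _) _; apply: le_trans (lipL Ua _ _ s1I sI) _.
    by rewrite -mulrA ler_wpM2l.
  have e2 : h * lam * (L s1 y1 a + K * (1 + M) * (h * lam)) <=
            h * lam * (L s y a + 2 * (K * (1 + M)) * h).
    rewrite ler_wpM2l//; have : K * (1 + M) * (h * lam) <= K * (1 + M) * h by rewrite ler_wpM2l.
    lra.
  rewrite hw; move: c2 e2; rewrite mulrDr; lra.
Qed.

Lemma chattering s y h l : 0 <= s -> 0 <= h -> s + h <= T ->
  K * h <= 2^-1 -> M * h <= 1 -> (forall z, `|z - y| <= M * h -> C z) ->
  U !=set0 -> weights U 1 l ->
  exists y' c, [/\ reach s y (s + h) y' c,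
    `|y' - y - h *: \sum_(d <- l) d.1 *: f s y d.2| <= 2 * (K * (1 + M)) * h * h &
    c <= h * (\sum_(d <- l) d.1 * L s y d.2) + 2 * (K * (1 + M)) * h * h].
Proof.
move=> s00 h0 hT Kh Mh yC U0 wl.
have h1 : s + h * 1 <= s + h by rewrite mulr1.
have y0 : `|y - y| <= M * (s - s).
  by rewrite (subrr y) (subrr s) normr0 mulr0.
have := chattering_from s00 h0 hT Kh Mh yC U0 wl (lexx _) h1 y0.
by rewrite !mulr1.
Qed.

End arcs.

(** * Elementary comparisons between the values *)

Section value_comparisons.
Context {R : realType} {n m : nat}.
Local Notation mu := (@lebesgue_measure R).
Variables (T K t : R) (U : set 'rV[R]_m).
Variables (f : R -> 'rV[R]_n -> 'rV[R]_m -> 'rV[R]_n).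
Variables (L : R -> 'rV[R]_n -> 'rV[R]_m -> R) (g : 'rV[R]_n -> R).
Variables (Omega : set 'rV[R]_n) (x0 : 'rV[R]_n).
Local Notation C := (closure Omega).
Hypotheses (U0 : U !=set0) (K0 : 0 <= K) (t0 : 0 <= t) (tT : t <= T).
Hypothesis lipf : forall a, U a -> forall s t x y, s \in `[0, T] -> t \in `[0, T] ->
  `|f s x a - f t y a| <= K * (`|s - t| + `|x - y|).
Hypothesis lipL : forall a, U a -> forall s t x y, s \in `[0, T] -> t \in `[0, T] ->
  `|L s x a - L t y a| <= K * (`|s - t| + `|x - y|).
Hypothesis L0 : forall s y a, s \in `[0, T] -> U a -> 0 <= L s y a.
Hypothesis cB : forall y s, s \in `[0, T] -> compact (neg_fields U f y s).

Let itT s : s \in `[t, T] -> s \in `[0, T].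
Proof. by rewrite !in_itv/= => /andP[ts ->]; rewrite (le_trans t0 ts). Qed.

Let Hge0 s y b : s \in `[t, T] -> (0 <= hamiltonian_conj U f L s y b)%E.
Proof. by move=> sI; apply: hamiltonian_conj_ge0 => a Ua; apply: L0 => //; exact: itT. Qed.

(** The velocity of a controlled trajectory is admissible and the conjugate is at
    most its cost.  The cost along a control need not be measurable in time. *)
Lemma variational_le_value :
  (value_variational T U f L g Omega x0 t <= value_function T U f L g Omega x0 t)%E.
Proof.
apply: le_ereal_inf_tmp => _ [u [x [[mu_ Uu] cx aex ->]]].
apply: (@le_trans _ _ (\int[mu]_(s in `[t, T]) hamiltonian_conj U f L s (x s) (- x^`()%classic s)
         + (g (x T))%:E)%E).
  by apply: ereal_inf_lbound; exists x.
apply: leeD => //; apply: ae_ge0_le_integral_nonmeas.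
- by move=> s sI; exact: Hge0.
- by move=> s sI; rewrite lee_fin L0//; [exact: itT|apply: Uu; exact: itT].
apply: (@filterS _ _ (ae_filter_ringOfSetsType mu) _ _ _ aex) => s /= H sI.
by rewrite H//; apply: hamiltonian_conj_le_cost; apply: Uu; exact: itT.
Qed.

Lemma variational_le_relaxed :
  (value_variational T U f L g Omega x0 t <= value_relaxed T U f L g Omega x0 t)%E.
Proof.
apply: le_ereal_inf_tmp => _ [x [b [cx mb aex aeb ->]]].
apply: (@le_trans _ _ (\int[mu]_(s in `[t, T]) hamiltonian_conj U f L s (x s) (- x^`()%classic s)
         + (g (x T))%:E)%E).
  by apply: ereal_inf_lbound; exists x.
apply: leeD => //; apply: ae_ge0_le_integral_nonmeas.
- by move=> s sI; exact: Hge0.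
- by move=> s sI; exact: Hge0.
apply: (@filterS _ _ (ae_filter_ringOfSetsType mu) _ _ _ aex) => s /= H sI.
by rewrite H// opprK.
Qed.

(** The velocity is a limit of mean velocities, which are close to mixtures of
    the admissible ones; the hull is closed. *)
Lemma velocity_in_convex_hull x s : ac_curve t T x ->
  (\int[mu]_(r in `[t, T]) hamiltonian_conj U f L r (x r) (- x^`()%classic r) < +oo)%E ->
  t <= s -> s < T -> derivable x s 1 ->
  convex_hull (neg_fields U f (x s) s) (- x^`()%classic s).
Proof.
move=> acx fin ts sT dx; apply: hull_sub_convex_hull.
have sI : s \in `[0, T] by rewrite in_itv/= (le_trans t0 ts) ltW.
have cl : closure (hull (neg_fields U f (x s) s)) `<=` hull (neg_fields U f (x s) s).
  by move=> b; exact: (compact_hull_closed (@cB (x s) s sI)).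
apply: cl => A /nbhs_ballP[e /= e0 eA].
have e3 : 0 < e / 3 by rewrite divr_gt0.
have [d1 d10 H1] := derivable_expansion dx e3.
have [d2 d20 H2] := averaged_velocity U0 K0 t0 lipf lipL L0 acx fin e3.
pose d := Num.min (Num.min d1 d2) (T - s) / 2.
have d0 : 0 < d by rewrite divr_gt0// !lt_min d10 d20 subr_gt0.
have dlt : d < Num.min (Num.min d1 d2) (T - s).
  by rewrite ltr_pdivrMr// ltr_pMr ?ltr1n// !lt_min d10 d20 subr_gt0.
move: dlt; rewrite !lt_min => /andP[/andP[dd1 dd2] dT].
have sd : s < s + d by rewrite ltrDl.
have E : s + d - s = d by rewrite addrAC subrr add0r.
have sdT : s + d <= T by lra.
have := H2 s (s + d) ts sd sdT; rewrite E => /(_ dd2) [l [wl lv _]].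
have := H1 (s + d); rewrite E (ger0_norm (ltW d0)) => /(_ dd1) h1.
exists (- \sum_(w <- l) w.1 *: f s (x s) w.2); split.
  exists [seq (w.1, - f s (x s) w.2) | w <- l].
    case: wl => p sw; split; last by rewrite big_map.
    by move=> w /mapP[w' /p[w0 Uw] ->]; split => //=; exists w'.2.
  rewrite big_map -sumrN; apply: eq_bigr => w _ /=; exact: scalerN.
apply: eA; rewrite -ball_normE /= opprK addrC.
have -> : \sum_(w <- l) w.1 *: f s (x s) w.2 - x^`()%classic s =
  (\sum_(w <- l) w.1 *: f s (x s) w.2 - d^-1 *: (x (s + d) - x s)) +
  d^-1 *: (x (s + d) - x s - d *: x^`()%classic s).
  rewrite [X in _ = _ + X]scalerBr scalerA mulVf ?gt_eqF// scale1r.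
  by rewrite addrA subrK.
apply: le_lt_trans (ler_normD _ _) _.
have : `|d^-1 *: (x (s + d) - x s - d *: x^`()%classic s)| <= e / 3.
  by rewrite normrZ ger0_norm ?invr_ge0 ?(ltW d0)// mulrC ler_pdivrMr.
lra.
Qed.

(** The negative velocity of a curve of finite cost is itself an admissible
    relaxed control. *)
Lemma relaxed_le_variational :
  (value_relaxed T U f L g Omega x0 t <= value_variational T U f L g Omega x0 t)%E.
Proof.
apply: le_ereal_inf_tmp => _ [x [cx ->]].
set I := (\int[mu]_(s in `[t, T]) _)%E.
have [Ioo|Ifin] := eqVneq I +oo%E; first by rewrite Ioo addye// leey.
have Ilt : (I < +oo)%E by rewrite ltey.
have [acx xt xC] := cx; have [_ dx ix] := acx.
apply: ereal_inf_lbound; exists x, (fun s => - x^`()%classic s); split => //.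
- move=> i; case/integrableP : (ix i) => /measurable_EFinP mi _.
  rewrite (_ : (fun s => _) = fun s => - (x^`()%classic s ord0 i)).
    exact: measurableT_comp.
  by apply/funext => s; rewrite mxE.
- by apply: aeW => s _; rewrite opprK.
have nT : {ae mu, forall s : R, s != T}.
  exists [set T]; split; [exact: measurable_set1|exact: lebesgue_measure_set1|].
  by move=> s /= /negP; rewrite negbK => /eqP.
apply: (@filterS2 _ _ (ae_filter_ringOfSetsType mu) _ _ _ _ dx nT) => s /= H sT sI.
have /andP[ts sT'] : t <= s <= T by move: sI; rewrite in_itv.
by apply: velocity_in_convex_hull => //; [rewrite lt_neqAle sT|exact: H].
Qed.

Variable M : R.
Hypothesis M0 : 0 <= M.
Hypothesis boundf : forall s y a, s \in `[0, T] -> C y -> U a -> `|f s y a| <= M.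

(** An arc satisfies the requirements of an admissible trajectory up to finitely
    many times, which are negligible. *)
Lemma reach_value y c : reach M U f L C t x0 T y c ->
  (value_function T U f L g Omega x0 t <= (c + g y)%:E)%E.
Proof.
move=> [u [x [A xt xT]]].
have [E HE] := arc_ode A; pose E' := [:: t, T & E].
have inE' s : s \in `[t, T] -> s \notin E' -> [/\ t < s, s < T & s \notin E].
  rewrite in_itv/= !inE !negb_or => /andP[ts sT] /and3P[nt nT nE]; split => //.
    by rewrite lt_neqAle eq_sym nt.
  by rewrite lt_neqAle nT.
have dE s : s \in `[t, T] -> s \notin E' -> derivable x s 1 /\ x^`()%classic s = f s (x s) (u s).
  by move=> sI /(inE' s sI)[ts sT nE]; exact: HE.
have aeE : {ae mu, forall s : R, s \notin E'}.
  exists [set` E']; split; [exact: seq_set_measurable|exact: seq_set_measure0|].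
  by move=> s /= /negP; rewrite negbK.
have md i : measurable_fun `[t, T] (fun s => x^`()%classic s ord0 i).
  apply: (@measurable_off_seq _ _ E') => //.
  apply: (@eq_measurable_fun _ _ _ _ _ (fun s => f s (x s) (u s) ord0 i)).
    by move=> s; rewrite inE => -[sI /negP nE]; have [_ ->] := dE s sI nE.
  apply: measurable_funS (arc_rhs_measurable A i) => // s [sI /negP nE].
  by have [ts sT _] := inE' s sI nE; rewrite /= in_itv/= ts.
have idx i : mu.-integrable `[t, T] (fun s => (x^`()%classic s ord0 i)%:E).
  have mdE : measurable_fun `[t, T] (fun s => (x^`()%classic s ord0 i)%:E).
    exact/measurable_EFinP.
  have [_] := @negligible_integrable _ _ _ mu `[t, T] [set` E'] _
    (seq_set_measurable E') (measurable_itv _) mdE (seq_set_measure0 E').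
  apply; apply: (@measurable_bounded_integrable _ _ _ mu) => //.
  - by apply: measurableD => //; exact: seq_set_measurable.
  - apply: (@le_lt_trans _ _ (mu `[t, T])).
      by rewrite le_measure ?inE//; apply: measurableD => //; exact: seq_set_measurable.
    by rewrite lebesgue_measure_itv/=; case: ifP => _; rewrite -?EFinB ltry.
  - by apply: measurable_funS (md i) => // s [].
  exists M; split; first exact: num_real.
  move=> k Mk s [sI /negP nE] /=; apply: le_trans (ltW Mk).
  have [_ ->] := dE s sI nE; apply: le_trans (norm_coord _ _) _.
  have /andP[ts sT] : t <= s <= T by move: sI; rewrite /= in_itv.
  by apply: boundf; [exact: itT|exact: (arc_in A)|exact: (arc_control A)].
have acx : ac_curve t T x.
  split => //.
    move=> e e0; exists (e / (M + 1)); first by rewrite divr_gt0// ltr_wpDl.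
    move=> k p q pq _ sd.
    have M1 : 0 < M + 1 by rewrite ltr_wpDl.
    apply: (@le_lt_trans _ _ ((M + 1) * \sum_(i < k) (q i - p i))); last first.
      by rewrite mulrC -ltr_pdivlMr.
    rewrite mulr_sumr; apply: ler_sum => i _; have [h1 h2 h3] := pq i.
    apply: le_trans (arc_lip A h1 h2 h3) _.
    by rewrite ler_wpM2r ?subr_ge0// lerDl.
  apply: (@filterS _ _ (ae_filter_ringOfSetsType mu) _ _ _ aeE) => s /= nE sI.
  by have [] := dE s sI nE.
apply: (@le_trans _ _ (\int[mu]_(s in `[t, T]) (L s (x s) (u s))%:E + (g (x T))%:E)%E).
  apply: ereal_inf_lbound; exists u, x; split => //.
  - split; last by move=> s _; exact: (arc_control A).
    by move=> j; apply: measurable_funTS; exact: (arc_control_measurable A).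
  - split => // s; rewrite in_itv/= => /andP[ts sT]; exact: (arc_in A).
  apply: (@filterS _ _ (ae_filter_ringOfSetsType mu) _ _ _ aeE) => s /= nE sI.
  by have [] := dE s sI nE.
rewrite xT EFinD; apply: leeD => //.
rewrite integral_itv_bndoo; first exact: (arc_cost A).
by apply/measurable_EFinP; exact: (arc_cost_measurable A).
Qed.

End value_comparisons.

(** * Pushing a curve off the boundary *)

(** Finitely many smallness requirements [k * d <= b] at once. *)
Lemma small_enough (R : realType) (l : seq (R * R)) : all (fun p => 0 < p.2) l ->
  exists2 d, 0 < d & all (fun p => p.1 * d <= p.2) l.
Proof.
suff main : all (fun p => 0 < p.2) l ->
    exists2 d, 0 < d & all (fun p => `|p.1| * d <= p.2) l.
  move=> /main[d d0 Hd]; exists d => //; apply: sub_all Hd => p /=.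
  by apply: le_trans; rewrite ler_wpM2r ?ler_norm// ltW.
elim: l => [_|[k b] l IHl] /=; first by exists 1.
move=> /andP[b0 /IHl[d d0 Hd]]; have k0 : 0 < `|k| + 1 by rewrite ltr_wpDl.
exists (Num.min d (b / (`|k| + 1))); first by rewrite lt_min d0 divr_gt0.
apply/andP; split.
  apply: (@le_trans _ _ (`|k| * (b / (`|k| + 1)))).
    by rewrite ler_wpM2l// ge_min lexx orbT.
  by rewrite mulrCA ler_piMr ?(ltW b0)// ler_pdivrMr// mul1r lerDl.
apply: sub_all Hd => p /=; apply: le_trans.
by rewrite ler_wpM2l// ge_min lexx.
Qed.

Section support_function.
Context {R : realType} {n : nat}.
Variable C : set 'rV[R]_n.
Hypotheses (C0 : C !=set0) (cC : compact C).
Hypothesis convC : forall y z l, C y -> C z -> 0 <= l <= 1 -> C (l *: y + (1 - l) *: z).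

Definition support (v : 'rV[R]_n) : R := sup [set dot v w | w in C].

Lemma support_ge v w : C w -> dot v w <= support v.
Proof.
move=> Cw; apply: ub_le_sup; last by exists w.
have [b [breal Hb]] := compact_bounded cC.
exists (n%:R * (`|v| * (b + 1))) => _ [z Cz <-].
apply: le_trans (ler_norm _) _; apply: le_trans (norm_dot_le _ _) _.
by rewrite !ler_wpM2l//; apply: (Hb (b + 1)) => //; rewrite ltrDl.
Qed.

Lemma support_le v b : (forall w, C w -> dot v w <= b) -> support v <= b.
Proof.
move=> H; apply: ge_sup; first by have [w Cw] := C0; exists (dot v w), w.
by move=> _ [w Cw <-]; exact: H.
Qed.

(** A closed convex set is the intersection of its supporting half-spaces. *)
Lemma mem_of_support z : (forall v, dot v v = 1 -> dot v z <= support v) -> C z.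
Proof.
move=> H; apply: contrapT => nCz.
have cl : closed C by apply: compact_closed => //; exact: norm_hausdorff.
have [v v1 [b bz Hb]] := closed_convex_separation cl C0 convC nCz.
by have := le_lt_trans (le_trans (H v v1) (support_le Hb)) bz; rewrite ltxx.
Qed.

End support_function.

(** Over one step of length [h], pushing at rate [lam * Th] along an inward
    velocity gains more than what the errors [DC] and the loss of room [DM]
    cost, once [lam] is large. *)
Lemma room_propagation (R : realType) (dz dr fin h Th lam B DM DC c sl sl' : R) :
  0 <= h -> 0 <= Th -> 0 <= lam -> 0 <= B -> 0 <= DM -> lam * h <= 1 ->
  dz + c * Th <= B * Th * sl -> dr <= h * Th * DC -> fin + 2 * c <= B * sl ->
  DC + 2 * (B * DM) <= c * lam -> sl - DM * h <= sl' ->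
  dz + (h * (lam * Th) * fin + dr) + c * (Th * (1 + lam * h)) <=
    B * (Th * (1 + lam * h)) * sl'.
Proof.
move=> h0 Th0 lam0 B0 DM0 lh hz hr hfin hlam hsl.
have hTh0 : 0 <= h * Th by rewrite mulr_ge0.
have gain : h * Th * (lam * (fin + 2 * c)) <= h * Th * (lam * (B * sl)).
  by rewrite ler_wpM2l// ler_wpM2l.
have cost : h * Th * (DC + 2 * (B * DM)) <= h * Th * (c * lam) by rewrite ler_wpM2l.
have loss : B * Th * (DM * h) * (lam * h) <= B * Th * (DM * h) * 1.
  by rewrite ler_wpM2l// mulr_ge0// mulr_ge0.
have rhs : B * (Th * (1 + lam * h)) * (sl - DM * h) <= B * (Th * (1 + lam * h)) * sl'.
  by rewrite ler_wpM2l// mulr_ge0// mulr_ge0// addr_ge0// mulr_ge0.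
lra.
Qed.

Section pushed_trajectory.
Context {R : realType} {n m : nat}.
Variables (T K M t : R) (U : set 'rV[R]_m).
Variables (f : R -> 'rV[R]_n -> 'rV[R]_m -> 'rV[R]_n).
Variables (L : R -> 'rV[R]_n -> 'rV[R]_m -> R).
Variable C : set 'rV[R]_n.
Hypotheses (U0 : U !=set0) (K0 : 0 <= K) (M0 : 0 <= M) (t0 : 0 <= t).
Hypothesis lipf : forall a, U a -> forall s t x y, s \in `[0, T] -> t \in `[0, T] ->
  `|f s x a - f t y a| <= K * (`|s - t| + `|x - y|).
Hypothesis lipL : forall a, U a -> forall s t x y, s \in `[0, T] -> t \in `[0, T] ->
  `|L s x a - L t y a| <= K * (`|s - t| + `|x - y|).
Hypothesis L0 : forall s y a, s \in `[0, T] -> U a -> 0 <= L s y a.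
Hypothesis boundf : forall s y0 y a, s \in `[0, T] -> C y0 -> `|y - y0| <= 1 -> U a -> `|f s y a| <= M.
Hypotheses (cC : compact C).
Hypothesis convC : forall y z l, C y -> C z -> 0 <= l <= 1 -> C (l *: y + (1 - l) *: z).

Variables (nu r Lam : R).
Hypotheses (nu0 : 0 < nu) (r0 : 0 < r) (Lam0 : 0 <= Lam).
Hypothesis inward : forall s p, s \in `[0, T] -> C p -> exists a, [/\ U a, L s p a <= Lam &
  forall v, dot v v = 1 -> (forall w, C w -> dot v (w - p) <= r) ->
    dot (f s p a) v <= - (nu / 2)].

Variables (x : R -> 'rV[R]_n) (I : R -> R).
Hypothesis xC : forall s, t <= s -> s <= T -> C (x s).
Hypothesis I0 : 0 <= I t.
Hypothesis averages : forall e, 0 < e -> exists2 d, 0 < d &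
  forall u v, t <= u -> u < v -> v <= T -> v - u < d -> exists l, [/\ weights U 1 l,
    `|\sum_(w <- l) w.1 *: f u (x u) w.2 - (v - u)^-1 *: (x v - x u)| <= e &
    (v - u) * (\sum_(w <- l) w.1 * L u (x u) w.2) <= I v - I u + (v - u) * e].

Local Notation D := (n%:R : R).
Local Notation hC := (support C).
(* [B] is the rate at which room is traded for inward displacement, with the
   radius [r] of the inward condition in the denominator; [C2] bounds the
   displacement in terms of the lag; [C3] collects the errors of one step; the
   lag grows at the exponential rate [lam], which dominates them all. *)
Let B : R := 2 * (D * M + nu) / r.
Let C2 : R := M + 1.
Let C3 : R := K * (1 + C2) + 2.
Let lam : R := C3 + (D * C3 + 2 * (B * (D * M))) / (nu / 4).

Let D0 : 0 <= D. Proof. by []. Qed.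
Let DM0 : 0 <= D * M. Proof. exact: mulr_ge0. Qed.
Let nu4 : 0 < nu / 4. Proof. by rewrite divr_gt0. Qed.
Let B0 : 0 <= B.
Proof. by rewrite divr_ge0 ?(ltW r0)// mulr_ge0// addr_ge0// ltW. Qed.
Let Br : B * r = 2 * (D * M + nu). Proof. by rewrite /B divfK ?gt_eqF. Qed.
Let C20 : 0 <= C2. Proof. by rewrite addr_ge0. Qed.
Let C30 : 0 <= C3. Proof. by rewrite addr_ge0// mulr_ge0// addr_ge0. Qed.
Let lamC3 : C3 <= lam.
Proof.
rewrite /lam lerDl; apply: divr_ge0; last exact: ltW nu4.
by apply: addr_ge0; apply: mulr_ge0 => //; exact: mulr_ge0.
Qed.
Let lam0 : 0 <= lam. Proof. exact: le_trans lamC3. Qed.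
Let lamnu : D * C3 + 2 * (B * (D * M)) <= nu / 4 * lam.
Proof.
have -> : nu / 4 * lam = nu / 4 * C3 + (D * C3 + 2 * (B * (D * M))).
  by rewrite /lam; field; rewrite gt_eqF.
rewrite lerDr; by apply: mulr_ge0 => //; exact: ltW nu4.
Qed.

Section fixed_lag.
Variables (delta : R).
Hypothesis delta0 : 0 < delta.

(** The state of the construction at time [s] lags behind the reference curve by
    [Th].  The accumulated displacement is directed inward by an amount
    proportional to the lag, along every direction [v] in which there is little
    room left; the deficit allowed is proportional to the room, which is what
    makes the invariant propagate from one step to the next. *)
Definition pushed (x0 : 'rV[R]_n) (s Th : R) (y : 'rV[R]_n) : Prop :=
  exists c, [/\ reach M U f L C t x0 s y c, `|y - x (s - Th)| <= C2 * Th,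
    forall v, dot v v = 1 ->
      dot v (y - x (s - Th)) + nu / 4 * Th <= B * Th * (hC v - dot v y) &
    c <= I (s - Th) + (1 + Lam) * Th].

(** The reference point lies in [C], so the room at [y] is at least the inward
    displacement from it; hence the trajectory has room proportional to the lag
    in every direction. *)
Lemma pushed_room x0 s Th y v : t <= s - Th -> s <= T -> 0 <= Th -> B * Th <= 1 ->
  pushed x0 s Th y -> dot v v = 1 -> nu / 8 * Th <= hC v - dot v y.
Proof.
move=> ts sT Th0 BTh [c [_ _ H _]] v1.
have xs : C (x (s - Th)) by apply: xC => //; lra.
have h1 := support_ge cC v xs; have h2 := H v v1.
rewrite dotBr in h2.
set sl := hC v - dot v y in h2 *.
have slge : - sl <= dot v y - dot v (x (s - Th)) by rewrite /sl; lra.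
have BTh0 : 0 <= B * Th by rewrite mulr_ge0.
have h3 : nu / 4 * Th <= B * Th * sl + sl by lra.
have nTh : 0 <= nu / 4 * Th by rewrite mulr_ge0// ltW.
have [sl0|sl0] := leP 0 sl.
  have : B * Th * sl <= 1 * sl by rewrite ler_wpM2r.
  lra.
have : B * Th * sl <= 0 by rewrite mulr_ge0_le0// ltW.
lra.
Qed.

(** During a step of length [h] the reference curve advances by
    [(1 - lam * Th) * h] only, and the time thus saved is spent on an inward
    control.  Chattering realises the mixture of the averaged velocity and the
    inward one. *)
Lemma pushed_step x0 d : (forall u v, t <= u -> u < v -> v <= T -> v - u < d ->
    exists l, [/\ weights U 1 l,
    `|\sum_(w <- l) w.1 *: f u (x u) w.2 - (v - u)^-1 *: (x v - x u)| <= delta &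
    (v - u) * (\sum_(w <- l) w.1 * L u (x u) w.2) <= I v - I u + (v - u) * delta]) ->
  forall h s Th y, 0 < h -> t <= s - Th -> s + h <= T -> delta <= Th ->
  lam * Th <= 2^-1 -> B * Th <= 1 -> lam * h <= 1 -> h < d ->
  K * h <= 2^-1 -> M * h <= 1 -> D * M * h <= nu / 8 * delta ->
  2 * (K * (1 + M)) * h <= delta ->
  pushed x0 s Th y -> exists y', pushed x0 (s + h) (Th * (1 + lam * h)) y'.
Proof.
move=> avg h s Th y h0 ts shT dTh lTh BTh lh hd Kh Mh DMh Kdel P.
have Th0 : 0 < Th by exact: lt_le_trans dTh.
have sT : s <= T by lra.
have s0 : 0 <= s by move: t0; lra.
have room v : dot v v = 1 -> nu / 8 * Th <= hC v - dot v y.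
  by apply: pushed_room P => //; lra.
have C0 : C !=set0 by exists (x t); apply: xC => //; lra.
have ball_in z : `|z - y| <= M * h -> C z.
  move=> zy; apply: (mem_of_support C0 cC convC) => v v1.
  have := room v v1; have h1 := dot_unit_le (z - y) v1; rewrite dotBr in h1.
  have h2 : D * `|z - y| <= D * M * h by rewrite -mulrA ler_wpM2l.
  have h3 : nu / 8 * delta <= nu / 8 * Th by rewrite ler_wpM2l// divr_ge0// ltW.
  lra.
have Cy : C y by apply: ball_in; rewrite subrr normr0 mulr_ge0// ltW.
case: P => c [rc zC2 zin cI].
set sg := s - Th in ts zC2 zin cI.
have sI : s \in `[0, T] by rewrite in_itv/= s0.
have sgs : sg <= s by rewrite /sg; lra.
have sgI : sg \in `[0, T] by rewrite in_itv/=; apply/andP; split; move: t0; lra.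
pose th := lam * Th; have th0 : 0 <= th by rewrite mulr_ge0// ltW.
have th1 : 0 < 1 - th by rewrite /th; lra.
pose sg' := sg + (1 - th) * h.
have h1 : 0 < (1 - th) * h by rewrite mulr_gt0.
have sgE : sg' - sg = (1 - th) * h by rewrite /sg' addrAC subrr add0r.
have thh0 : 0 <= th * h by rewrite mulr_ge0// ltW.
have hth : (1 - th) * h <= h by rewrite mulrBl mul1r gerBl.
have sg'E : s + h - Th * (1 + lam * h) = sg' by rewrite /sg' /sg /th; ring.
have sglt : sg < sg' by lra.
have sgT : sg' <= T by rewrite /sg' /sg; lra.
have sgd : sg' - sg < d by rewrite sgE; lra.
have [l [wl lf lL]] := avg sg sg' ts sglt sgT sgd.
have [a [Ua aL ain]] := inward sI Cy.
pose l' := rescale (1 - th) l ++ rescale th [:: (1, a)].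
have wl' : weights U 1 l'.
  rewrite [X in weights _ X](_ : 1 = (1 - th) * 1 + th * 1); last by ring.
  by apply: weights_cat; apply: weights_rescale => //; [exact: ltW|exact: weights1].
have [y' [c2 [rc2 d2 cc2]]] := chattering K0 M0 lipf lipL L0 boundf s0 (ltW h0) shT Kh Mh ball_in U0 wl'.
move: d2 cc2; rewrite /l' !big_cat !(sum_rescale (f s y)).
rewrite !(sumr_rescale (L s y)) !big_seq1 /= scale1r mul1r.
set W := \sum_(w <- l) w.1 *: f s y w.2.
set WL := \sum_(w <- l) w.1 * L s y w.2.
set W0 := \sum_(w <- l) w.1 *: f sg (x sg) w.2 in lf.
set WL0 := \sum_(w <- l) w.1 * L sg (x sg) w.2 in lL.
set avgv := (sg' - sg)^-1 *: (x sg' - x sg) in lf.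
move=> d2 cc2.
pose z := y - x sg.
have distK : K * (`|s - sg| + `|z|) <= K * (1 + C2) * Th.
  rewrite -mulrA ler_wpM2l// mulrDl mul1r; apply: lerD => //.
  by rewrite /sg opprB addrC subrK ger0_norm// ltW.
have WW0 : `|W - W0| <= K * (1 + C2) * Th.
  have -> : W - W0 = \sum_(w <- l) w.1 *: (f s y w.2 - f sg (x sg) w.2).
    by rewrite /W /W0 -sumrB; apply: eq_bigr => w _; rewrite scalerBr.
  rewrite -[X in _ <= X]mul1r.
  apply: (@weighted_norm_le _ _ _ _ _ _ (fun a => f s y a - f sg (x sg) a) _ wl) => b Ub.
  exact: le_trans (lipf Ub _ _ sI sgI) _.
have WLL : WL <= WL0 + K * (1 + C2) * Th.
  rewrite -[X in _ <= _ + X]mul1r; apply: (weighted_le wl) => b Ub.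
  rewrite addrC -lerBlDr; apply: le_trans (ler_norm _) _.
  exact: le_trans (lipL Ub _ _ sI sgI) _.
pose rho := y' - x sg' - z - (h * th) *: f s y a.
have rhoB : `|rho| <= h * (Th * C3).
  have xE : x sg' - x sg = (h * (1 - th)) *: avgv.
    by rewrite /avgv scalerA sgE (mulrC h) mulfV ?scale1r// gt_eqF.
  have -> : rho = (y' - y - h *: ((1 - th) *: W + th *: f s y a)) +
      (h * (1 - th)) *: ((W - W0) + (W0 - avgv)).
    rewrite addrA subrK scalerBr -xE /rho /z scalerDr !scalerA.
    by apply/rowP => i; rewrite !mxE; ring.
  apply: le_trans (ler_normD _ _) _.
  have e1 : 2 * (K * (1 + M)) * h * h <= h * Th.
    by rewrite [X in _ <= X]mulrC ler_wpM2r ?(ltW h0)//; exact: le_trans Kdel dTh.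
  have e2 : `|(h * (1 - th)) *: ((W - W0) + (W0 - avgv))| <= h * (K * (1 + C2) * Th + Th).
    rewrite normrZ ger0_norm; last by rewrite mulr_ge0// ltW.
    apply: ler_pM => //; first by rewrite mulr_ge0// ltW.
      by rewrite mulrC.
    by apply: le_trans (ler_normD _ _) _; apply: lerD => //; exact: le_trans dTh.
  have -> : h * (Th * C3) = h * Th + h * (K * (1 + C2) * Th + Th) by rewrite /C3; ring.
  by apply: lerD => //; exact: le_trans e1.
have zE : y' - x sg' = z + ((h * th) *: f s y a + rho).
  by rewrite /rho; apply/rowP => i; rewrite !mxE; ring.
have fM : `|f s y a| <= M by apply: (@boundf s y y a) => //; rewrite subrr normr0.
have hth0 : 0 <= h * th by rewrite mulr_ge0// ltW.
have hTh0 : 0 <= h * Th by rewrite mulr_ge0// ltW.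
exists y', (c + c2); rewrite sg'E; split.
- apply: (reach_trans _ _ _ rc rc2); [exact: le_trans ts sgs|by rewrite lerDl ltW|].
  move=> s' y1 a' h3 h4; apply: L0; rewrite in_itv/=.
  by rewrite (le_trans t0 h3) (le_trans h4 shT).
- rewrite zE; apply: le_trans (ler_normD _ _) _.
  have e1 : `|(h * th) *: f s y a + rho| <= h * th * M + h * (Th * C3).
    apply: le_trans (ler_normD _ _) _; apply: lerD => //.
    by rewrite normrZ ger0_norm// ler_wpM2l.
  have e2 : h * Th * C3 <= h * Th * lam by rewrite ler_wpM2l.
  have -> : C2 * (Th * (1 + lam * h)) = C2 * Th + (h * th * M + h * Th * lam).
    by rewrite /th /C2; ring.
  apply: lerD => //; apply: le_trans e1 _; rewrite lerD2l mulrA; exact: e2.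
- move=> v v1.
  have hv := zin v v1; rewrite -/z in hv.
  set sl := hC v - dot v y in hv.
  have sl0 : 0 <= sl.
    apply: le_trans (room v v1); rewrite mulr_ge0 ?(ltW Th0)//.
    by rewrite divr_ge0// ltW.
  have [u' [x' [A xs xsh]]] := rc2.
  have y'y : `|y' - y| <= M * h.
    by have := arc_lip A (lexx s); rewrite -xs -xsh => /(_ (s + h)); rewrite lerDl (ltW h0) addrAC subrr add0r; apply.
  have sl' : sl - D * M * h <= hC v - dot v y'.
    have h3 := dot_unit_le (y' - y) v1; rewrite dotBr in h3.
    have : D * `|y' - y| <= D * M * h by rewrite -mulrA ler_wpM2l.
    rewrite /sl; lra.
  have fin : dot v (f s y a) + nu / 2 <= B * sl.
    have [near|far] := leP sl r.
      have := ain v v1; rewrite dotC => H.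
      have : dot v (f s y a) <= - (nu / 2).
        apply: H => w Cw; rewrite dotBr; apply: le_trans near.
        by rewrite /sl lerD2r; exact: support_ge.
      have : 0 <= B * sl by rewrite mulr_ge0.
      lra.
    have h3 : dot v (f s y a) <= D * M.
      by apply: le_trans (dot_unit_le _ v1) _; rewrite ler_wpM2l.
    have : B * r <= B * sl by rewrite ler_wpM2l// ltW.
    rewrite Br; move: nu0 DM0; lra.
  have rv : dot v rho <= h * Th * (D * C3).
    apply: le_trans (dot_unit_le _ v1) _.
    have -> : h * Th * (D * C3) = D * (h * (Th * C3)) by ring.
    by rewrite ler_wpM2l.
  rewrite zE (dotDr v z) (dotDr v _ rho) dotZr.
  apply: (room_propagation (fin := dot v (f s y a)) (DC := D * C3) (sl := sl)
    (DM := D * M) (ltW h0) (ltW Th0) lam0 B0 DM0 lh hv rv _ lamnu sl').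
  by rewrite (_ : 2 * (nu / 4) = nu / 2)//; field.
- have e1 : h * ((1 - th) * WL) <= I sg' - I sg + h * Th + h * (K * (1 + C2) * Th).
    have e2 : h * (1 - th) * WL <= h * (1 - th) * (WL0 + K * (1 + C2) * Th).
      by rewrite ler_wpM2l// mulr_ge0// ltW.
    have e3 : h * (1 - th) * (K * (1 + C2) * Th) <= h * (K * (1 + C2) * Th).
      have q0 : 0 <= K * (1 + C2) * Th by rewrite !mulr_ge0 ?addr_ge0// ltW.
      have hle : h * (1 - th) <= h by rewrite mulrC.
      by rewrite ler_wpM2r.
    have e4 : (1 - th) * h * delta <= h * Th.
      by apply: ler_pM => //; exact: ltW.
    rewrite sgE in lL; lra.
  have e5 : h * (th * L s y a) <= h * th * Lam by rewrite mulrA ler_wpM2l.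
  have e6 : 2 * (K * (1 + M)) * h * h <= h * Th.
    by rewrite [X in _ <= X]mulrC ler_wpM2r ?(ltW h0)//; exact: le_trans Kdel dTh.
  have e7 : h * Th * C3 <= h * Th * lam by rewrite ler_wpM2l.
  have -> : (1 + Lam) * (Th * (1 + lam * h)) = (1 + Lam) * Th + (h * Th * lam + h * th * Lam).
    by rewrite /th; ring.
  move: cc2 e7; rewrite mulrDr /C3.
  have -> : h * Th * (K * (1 + C2) + 2) = h * (K * (1 + C2) * Th) + h * Th + h * Th by ring.
  lra.
Qed.

(** The first push starts from the initial point, possibly on the boundary,
    with a single control that is inward there. *)
Lemma pushed_start x0 : C x0 -> x t = x0 -> t + delta <= T ->
  K * delta <= 2^-1 -> M * delta <= 1 -> D * (K * (1 + M)) * delta <= nu / 4 ->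
  D * M * delta <= r / 2 -> K * (1 + M) * delta <= 1 ->
  exists y, pushed x0 (t + delta) delta y.
Proof.
move=> Cx0 xt tdT Kd Md DKd DMd KMd.
have tI : t \in `[0, T] by rewrite in_itv/= t0 (le_trans _ tdT)// lerDl ltW.
have C0 : C !=set0 by exists x0.
have [a [Ua aL ain]] := inward tI Cx0.
have [y [yt ylip y2 yarc]] := constant_control_arc K0 M0 lipf lipL L0 boundf
  t0 (ltW delta0) tdT Kd Md Cx0 Ua.
have drift s v : t <= s -> s <= t + delta -> dot v v = 1 ->
    dot v (y s - x0) <= (s - t) * (dot v (f t x0 a) + nu / 4).
  move=> ts sd v1; have st0 : 0 <= s - t by rewrite subr_ge0.
  have -> : y s - x0 = (y s - x0 - (s - t) *: f t x0 a) + (s - t) *: f t x0 a by rewrite subrK.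
  rewrite dotDr dotZr mulrDr addrC lerD2l.
  apply: le_trans (dot_unit_le _ v1) _.
  apply: (@le_trans _ _ (D * (K * (1 + M) * (s - t) ^+ 2))); first by rewrite ler_wpM2l// y2.
  have -> : D * (K * (1 + M) * (s - t) ^+ 2) = (s - t) * (D * (K * (1 + M)) * (s - t)) by ring.
  rewrite ler_wpM2l//; apply: le_trans DKd; rewrite ler_wpM2l//; last by rewrite lerBlDl.
  by rewrite !mulr_ge0// addr_ge0.
have inertia s v : t <= s -> s <= t + delta -> dot v v = 1 ->
    dot v (y s - x0) <= D * M * (s - t).
  move=> ts sd v1; apply: le_trans (dot_unit_le _ v1) _.
  by rewrite -mulrA ler_wpM2l// -yt ylip.
have dichotomy v : dot v v = 1 -> dot v (f t x0 a) <= - (nu / 2) \/ r <= hC v - dot v x0.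
  move=> v1; have [rle|rlt] := leP r (hC v - dot v x0); [by right|left].
  rewrite dotC; apply: ain => // w Cw; rewrite dotBr; apply: le_trans (ltW rlt).
  by rewrite lerD2r; exact: support_ge.
have DMle s : t <= s -> s <= t + delta -> D * M * (s - t) <= D * M * delta.
  by move=> ts sd; rewrite ler_wpM2l// lerBlDl.
have yC s : t <= s -> s <= t + delta -> C (y s).
  move=> ts sd; apply: (mem_of_support C0 cC convC) => v v1.
  have h1 := support_ge cC v Cx0.
  have [fin|far] := dichotomy v v1.
    have := drift s v ts sd v1; rewrite dotBr.
    have : (s - t) * (dot v (f t x0 a) + nu / 4) <= 0.
      by rewrite mulr_ge0_le0 ?subr_ge0//; move: nu0; lra.
    lra.
  have := inertia s v ts sd v1; rewrite dotBr; have := DMle s ts sd; move: r0; lra.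
have tt : t <= t + delta by rewrite lerDl ltW.
exists (y (t + delta)), (delta * (L t x0 a + K * (1 + M) * delta)).
have Es : t + delta - t = delta by rewrite addrAC subrr add0r.
have Et : t + delta - delta = t by rewrite addrK.
rewrite Et xt; split.
- by exists (fun=> a), y; split => //; exact: yarc.
- rewrite -yt; apply: le_trans (ylip _ _ _ tt _) _ => //; rewrite Es ler_wpM2r ?(ltW delta0)//.
  by rewrite lerDl.
- move=> v v1; have h1 := support_ge cC v Cx0.
  have BD0 : 0 <= B * delta by rewrite mulr_ge0// ltW.
  have [fin|far] := dichotomy v v1.
    have h2 := drift (t + delta) v tt (lexx _) v1; rewrite Es in h2.
    have h3 : delta * (dot v (f t x0 a) + nu / 4) <= delta * (- (nu / 4)).
      by rewrite ler_wpM2l ?(ltW delta0)//; lra.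
    have h4 : 0 <= nu / 4 * delta by rewrite mulr_ge0// ltW.
    apply: (@le_trans _ _ 0); first lra.
    rewrite mulr_ge0//; rewrite dotBr in h2; lra.
  have h2 := inertia (t + delta) v tt (lexx _) v1; rewrite Es in h2.
  have h3 : r / 2 <= hC v - dot v (y (t + delta)) by rewrite dotBr in h2; lra.
  have h4 : B * delta * (r / 2) <= B * delta * (hC v - dot v (y (t + delta))).
    by rewrite ler_wpM2l.
  have h5 : B * delta * (r / 2) = (D * M + nu) * delta.
    by rewrite (_ : _ * _ = delta * (B * r) / 2); [rewrite Br; field|field].
  have h6 : 0 <= nu * delta by rewrite mulr_ge0// ltW.
  lra.
- rewrite mulrC; apply: (@le_trans _ _ ((1 + Lam) * delta)).
    by rewrite ler_wpM2r ?(ltW delta0)//; lra.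
  by rewrite lerDr.
Qed.

(** The lag grows geometrically, hence stays below [delta * E] with [E]
    independent of the number of steps. *)
Lemma pushed_iterate x0 d h N E y0 : (forall u v, t <= u -> u < v -> v <= T -> v - u < d ->
    exists l, [/\ weights U 1 l,
    `|\sum_(w <- l) w.1 *: f u (x u) w.2 - (v - u)^-1 *: (x v - x u)| <= delta &
    (v - u) * (\sum_(w <- l) w.1 * L u (x u) w.2) <= I v - I u + (v - u) * delta]) ->
  0 < h -> t + delta + N%:R * h <= T ->
  lam * h <= 1 -> h < d -> K * h <= 2^-1 -> M * h <= 1 ->
  D * M * h <= nu / 8 * delta -> 2 * (K * (1 + M)) * h <= delta ->
  (1 + lam * h) ^+ N <= E -> lam * (delta * E) <= 2^-1 -> B * (delta * E) <= 1 ->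
  pushed x0 (t + delta) delta y0 ->
  exists2 y, pushed x0 (t + delta + N%:R * h) (delta * (1 + lam * h) ^+ N) y &
    t <= t + delta + N%:R * h - delta * (1 + lam * h) ^+ N.
Proof.
move=> avg h0 + lh hd Kh Mh DMh Kdel + lE BE P.
have lh1 : 1 <= 1 + lam * h by rewrite lerDl mulr_ge0// ltW.
have d0 := ltW delta0.
elim: N => [|N IHN] NT NE.
  by rewrite mul0r addr0 expr0 mulr1; exists y0 => //; rewrite addrK.
set q := 1 + lam * h in lh1 NE IHN *.
have q0 : 0 <= q by exact: le_trans lh1.
have NE' : q ^+ N <= E by apply: le_trans NE; rewrite exprS ler_peMl// exprn_ge0.
have q1 : 1 <= q ^+ N by rewrite exprn_ege1.
have ThE : delta * q ^+ N <= delta * E by rewrite ler_wpM2l.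
have SNh : N.+1%:R * h = N%:R * h + h by rewrite -natr1 mulrDl mul1r.
have NT' : t + delta + N%:R * h <= T by apply: le_trans NT; rewrite SNh addrA lerDl ltW.
have [y Py ts] := IHN NT' NE'.
have lTh : lam * (delta * q ^+ N) <= 2^-1 by apply: le_trans lE; rewrite ler_wpM2l.
have shT : t + delta + N%:R * h + h <= T by rewrite -addrA -SNh.
have dTh : delta <= delta * q ^+ N by rewrite ler_peMr.
have BTh : B * (delta * q ^+ N) <= 1 by apply: le_trans BE; rewrite ler_wpM2l.
have [y' Py'] := pushed_step avg h0 ts shT dTh lTh BTh lh hd Kh Mh DMh Kdel Py.
exists y'; first by rewrite SNh addrA exprSr mulrA.
have h2 : lam * (delta * q ^+ N) * h <= 2^-1 * h by rewrite ler_wpM2r// ltW.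
rewrite SNh exprSr {2}/q; move: h2 ts h0.
have -> : delta * (q ^+ N * (1 + lam * h)) = delta * q ^+ N + lam * (delta * q ^+ N) * h by ring.
move: (delta * q ^+ N) => z; lra.
Qed.

End fixed_lag.

(** The initial lag [delta] is chosen first, then the step: the discretisation
    errors have to be small against [delta]. *)
Lemma approximating_trajectory x0 (J eps : R) : t < T -> C x0 -> x t = x0 -> 0 < eps ->
  (forall e, 0 < e -> exists2 d, 0 < d & forall u v, t <= u -> u <= v -> v <= T ->
    v - u < d -> `|x v - x u| < e) ->
  (forall s, t <= s -> s <= T -> I s <= J) ->
  exists y c, [/\ reach M U f L C t x0 T y c, `|y - x T| <= eps & c <= J + eps].
Proof.
move=> tT Cx0 xt eps0 ux IJ.
have T0 : 0 <= T by exact: le_trans t0 (ltW tT).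
pose E := expR (lam * T).
have E0 : 0 < E by exact: expR_gt0.
have eps2 : 0 < eps / 2 by rewrite divr_gt0.
have Tt : 0 < T - t by rewrite subr_gt0.
have half0 : 0 < 2^-1 :> R by rewrite invr_gt0.
have [dx dx0 Hx] := ux _ eps2.
have pos1 : all (fun p : R * R => 0 < p.2) [:: (K, 2^-1); (M, 1); (D * (K * (1 + M)), nu / 4);
  (D * M, r / 2); (K * (1 + M), 1); (lam * E, 2^-1); (B * E, 1); (2, T - t); (2 * E, dx);
  (C2 * E, eps / 2); ((1 + Lam) * E, eps)].
  by rewrite /= half0 ltr01 nu4 Tt dx0 eps2 eps0 divr_gt0.
have [delta delta0 /=] := small_enough pos1.
move=> /and5P[Kd Md DKd DMd /and5P[KMd lEd BEd Td /and4P[Ed C2d Ld _]]].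
have [d d0 avg] := averages delta0.
have nud : 0 < nu / 8 * delta by rewrite mulr_gt0// divr_gt0.
have pos2 : all (fun p : R * R => 0 < p.2) [:: (lam, 1); (2, d); (K, 2^-1); (M, 1);
  (D * M, nu / 8 * delta); (2 * (K * (1 + M)), delta)].
  by rewrite /= half0 ltr01 d0 nud delta0.
have [h1 h10 /=] := small_enough pos2.
move=> /and5P[lh hd Kh Mh /and3P[DMh Kdel _]].
have A0 : 0 < T - t - delta by lra.
pose N := Num.bound ((T - t - delta) / h1).
have hN : (T - t - delta) / h1 < N%:R by apply: archi_boundP; rewrite divr_ge0// ltW.
have N0 : 0 < N%:R :> R by apply: le_lt_trans hN; rewrite divr_ge0// ltW.
pose h := (T - t - delta) / N%:R.
have h0 : 0 < h by rewrite divr_gt0.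
have hh1 : h <= h1.
  by rewrite /h ler_pdivrMr// mulrC -ler_pdivrMr// ltW.
have Nh : N%:R * h = T - t - delta by rewrite /h mulrC divfK// gt_eqF.
have TE : t + delta + N%:R * h = T by rewrite Nh; ring.
have mono k b : 0 <= k -> k * h1 <= b -> k * h <= b.
  by move=> k0; apply: le_trans; rewrite ler_wpM2l.
have K1M : 0 <= K * (1 + M) by rewrite mulr_ge0// addr_ge0.
have powE : (1 + lam * h) ^+ N <= E.
  apply: (@le_trans _ _ (expR (lam * h) ^+ N)).
    by rewrite lerXn2r ?nnegrE ?expR_ge0 ?expR_ge1Dx// addr_ge0// mulr_ge0// ltW.
  rewrite -expRM_natl /E ler_expR mulrCA Nh ler_wpM2l//; move: t0; lra.
have tdT : t + delta <= T by lra.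
have [y0 P0] := pushed_start delta0 Cx0 xt tdT Kd Md DKd DMd KMd.
have TEle : t + delta + N%:R * h <= T by rewrite TE.
have hd' : h < d by have := mono 2 d (ler0n _ _) hd; lra.
have lE2 : lam * (delta * E) <= 2^-1 by rewrite mulrCA mulrC.
have BE2 : B * (delta * E) <= 1 by rewrite mulrCA mulrC.
have [y Py ts] := pushed_iterate delta0 avg h0 TEle (mono _ _ lam0 lh) hd'
  (mono _ _ K0 Kh) (mono _ _ M0 Mh) (mono _ _ DM0 DMh)
  (mono _ _ (mulr_ge0 (ler0n _ 2) K1M) Kdel) powE lE2 BE2 P0.
rewrite TE in Py ts.
set Th := delta * (1 + lam * h) ^+ N in Py ts.
have ThE : Th <= delta * E by rewrite ler_wpM2l// ltW.
have Th0 : 0 < Th.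
  by rewrite mulr_gt0// exprn_gt0// ltr_pwDl// mulr_ge0// ltW.
have dE0 : 0 <= delta * E by rewrite mulr_ge0 ?ltW.
have [c [rc yx _ cI]] := Py.
exists y, c; split => //.
  have -> : y - x T = (y - x (T - Th)) - (x T - x (T - Th)).
    by apply/rowP => i; rewrite !mxE; ring.
  apply: le_trans (ler_normB _ _) _.
  have e1 : `|x T - x (T - Th)| < eps / 2.
    apply: Hx => //; first by rewrite gerBl ltW.
    by rewrite (_ : T - (T - Th) = Th); [move: Ed ThE dx0; lra|ring].
  have e2 : C2 * Th <= eps / 2.
    by apply: le_trans C2d; rewrite mulrAC -mulrA ler_wpM2l.
  lra.
apply: le_trans cI _; apply: lerD.
  by apply: IJ => //; rewrite gerBl ltW.
by apply: le_trans Ld; rewrite mulrAC -mulrA ler_wpM2l// addr_ge0.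
Qed.

End pushed_trajectory.

(** * The representation formulas *)

Lemma lipschitz_bounds (R : realType) (n m : nat) (V : normedModType R) (T : R)
    (U : set 'rV[R]_m) (F : R -> 'rV[R]_n -> 'rV[R]_m -> V) : lipschitz_tx T U F ->
  exists2 K, 0 <= K & forall K', K <= K' -> forall a, U a -> forall s t x y,
    s \in `[0, T] -> t \in `[0, T] -> `|F s x a - F t y a| <= K' * (`|s - t| + `|x - y|).
Proof.
move=> [K HK]; exists `|K| => // K' KK' a Ua s t x y sT tT.
apply: le_trans (HK a Ua s t x y sT tT) _; apply: ler_wpM2r; first exact: addr_ge0.
exact: le_trans (ler_norm K) KK'.
Qed.

(** Velocities are bounded near a bounded set, uniformly over the controls:
    they are at one point, by compactness, and the Lipschitz estimate spreads it. *)
Lemma velocity_bound (R : realType) (n m : nat) (T K : R) (U : set 'rV[R]_m)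
    (f : R -> 'rV[R]_n -> 'rV[R]_m -> 'rV[R]_n) (C : set 'rV[R]_n) :
  0 <= T -> 0 <= K ->
  (forall a, U a -> forall s t x y, s \in `[0, T] -> t \in `[0, T] ->
    `|f s x a - f t y a| <= K * (`|s - t| + `|x - y|)) ->
  compact (neg_fields U f 0 0) -> compact C ->
  exists2 M, 0 <= M & forall s y0 y a, s \in `[0, T] -> C y0 -> `|y - y0| <= 1 -> U a ->
    `|f s y a| <= M.
Proof.
move=> T0 K0 lipf /compact_bounded[b [_ Hb]] /compact_bounded[rho [_ Hrho]].
have Zb a : U a -> `|f 0 0 a| <= `|b| + 1.
  move=> Ua; rewrite -normrN; apply: (Hb (`|b| + 1)); last by exists a.
  by rewrite (le_lt_trans (ler_norm _))// ltrDl.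
have Zr y0 : C y0 -> `|y0| <= `|rho| + 1.
  by move=> Cy0; apply: (Hrho (`|rho| + 1)) => //; rewrite (le_lt_trans (ler_norm _))// ltrDl.
exists (`|b| + 1 + K * (T + (`|rho| + 1 + 1))).
  by rewrite addr_ge0// mulr_ge0// addr_ge0.
move=> s y0 y a sI Cy0 yy0 Ua.
have I0 : 0 \in `[0, T] by rewrite in_itv/= lexx.
have -> : f s y a = f 0 0 a + (f s y a - f 0 0 a) by rewrite addrC subrK.
apply: le_trans (ler_normD _ _) _; apply: lerD; first exact: Zb.
apply: le_trans (lipf a Ua s 0 y 0 sI I0) _; rewrite ler_wpM2l// !subr0.
have /andP[s0 sT] : 0 <= s <= T by move: sI; rewrite in_itv.
apply: lerD; first by rewrite ger0_norm.
have -> : y = y0 + (y - y0) by rewrite addrC subrK.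
by apply: le_trans (ler_normD _ _) _; apply: lerD => //; exact: Zr.
Qed.

Section value_le_variational.
Context {R : realType} {n m : nat}.
Local Notation mu := (@lebesgue_measure R).
Variables (T K Kg M nu t : R) (U : set 'rV[R]_m).
Variables (f : R -> 'rV[R]_n -> 'rV[R]_m -> 'rV[R]_n).
Variables (L : R -> 'rV[R]_n -> 'rV[R]_m -> R) (g : 'rV[R]_n -> R).
Variables (Omega : set 'rV[R]_n) (normal : 'rV[R]_n -> 'rV[R]_n) (x0 : 'rV[R]_n).
Local Notation C := (closure Omega).
Hypotheses (U0 : U !=set0) (K0 : 0 <= K) (Kg0 : 0 <= Kg) (M0 : 0 <= M) (nu0 : 0 < nu).
Hypotheses (t0 : 0 <= t) (tT : t <= T).
Hypothesis lipf : forall a, U a -> forall s t x y, s \in `[0, T] -> t \in `[0, T] ->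
  `|f s x a - f t y a| <= K * (`|s - t| + `|x - y|).
Hypothesis lipL : forall a, U a -> forall s t x y, s \in `[0, T] -> t \in `[0, T] ->
  `|L s x a - L t y a| <= K * (`|s - t| + `|x - y|).
Hypothesis L0 : forall s y a, s \in `[0, T] -> U a -> 0 <= L s y a.
Hypothesis lipg : forall x y, `|g x - g y| <= Kg * `|x - y|.
Hypothesis boundf : forall s y0 y a, s \in `[0, T] -> C y0 -> `|y - y0| <= 1 -> U a ->
  `|f s y a| <= M.
Hypotheses (cC : compact C) (convC : convex_set C).
Hypothesis normalP : forall x, boundary Omega x -> is_outward_unit_normal Omega x (normal x).
Hypothesis inward : forall x t, boundary Omega x -> t \in `[0, T] ->
  exists2 a, U a & dot (f t x a) (normal x) <= - nu.

(** Follow a curve of finite cost by trajectories ending near its end point, at a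
    cost exceeding the conjugate cost arbitrarily little.  At the final time
    there is no time left for the initial push, but both values are [g] at the
    starting point. *)
Lemma value_le_variational : C x0 ->
  (value_function T U f L g Omega x0 t <= value_variational T U f L g Omega x0 t)%E.
Proof.
move=> Cx0; apply: le_ereal_inf_tmp => _ [x [cx ->]].
have [acx xt xC] := cx.
set J := (\int[mu]_(s in `[t, T]) _)%E.
have [->|Joo] := eqVneq J +oo%E; first by rewrite addye// leey.
have itT s : s \in `[t, T] -> s \in `[0, T].
  by rewrite !in_itv/= => /andP[ts ->]; rewrite (le_trans t0 ts).
have J0 : (0 <= J)%E.
  apply: integral_ge0 => s sI; apply: hamiltonian_conj_ge0 => a Ua.
  by apply: L0 => //; exact: itT.
have Jlt : (J < +oo)%E by rewrite ltey.
have JE : J = (fine J)%:E by rewrite fineK// ge0_fin_numE.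
have boundf' s y a : s \in `[0, T] -> C y -> U a -> `|f s y a| <= M.
  by move=> sI Cy Ua; apply: (boundf (y0 := y)) => //; rewrite subrr normr0.
have from_reach y c : reach M U f L C t x0 T y c ->
    (value_function T U f L g Omega x0 t <= (c + g y)%:E)%E.
  by move=> rc; exact: (reach_value _ _ M0 boundf' rc).
have [tET|tltT] : t = T \/ t < T by apply/predU1P; rewrite -le_eqVlt.
  have [a Ua] := U0; apply: le_trans (from_reach x0 0 _) _.
    by rewrite -[X in reach _ _ _ _ _ _ _ X]tET; exact: (reach_refl _ _ _ M0 Ua).
  by rewrite add0r -tET xt -[leLHS]add0e leeD.
have [r r0 [Lam Hin]] := inward_uniform U0 K0 nu0 lipf lipL cC normalP inward.
have Hin' s p : s \in `[0, T] -> C p -> exists a, [/\ U a, L s p a <= Num.max Lam 0 &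
  forall v, dot v v = 1 -> (forall w, C w -> dot v (w - p) <= r) ->
    dot (f s p a) v <= - (nu / 2)].
  move=> sI Cp; have [a [Ua aL Ha]] := Hin s p sI Cp; exists a; split => //.
  by rewrite le_max aL.
have Lam0 : 0 <= Num.max Lam 0 by rewrite le_max lexx orbT.
apply/lee_addgt0Pr => e e0.
have k0 : 0 < Kg + 1 by rewrite ltr_wpDl.
have e2 : 0 < e / 2 by rewrite divr_gt0.
pose eps := Num.min (e / 2) (e / 2 / (Kg + 1)).
have eps0 : 0 < eps by rewrite lt_min e2 divr_gt0.
have xC' s : t <= s -> s <= T -> C (x s) by move=> ts sT; apply: xC; rewrite in_itv/= ts.
have IJ s : t <= s -> s <= T -> running_cost t U f L x s <= fine J.
  by move=> ts sT; rewrite -lee_fin -JE; exact: (running_cost_le t0 L0 Jlt ts sT).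
have [y [c [rc yx cJ]]] := approximating_trajectory U0 K0 M0 t0 lipf lipL L0 boundf
  cC (convex_set_elim convC) nu0 r0 Lam0 Hin' xC' (running_cost_ge0 f t0 L0 x tT)
  (averaged_velocity U0 K0 t0 lipf lipL L0 acx Jlt) tltT Cx0 xt eps0
  (ac_curve_unif_continuous acx) IJ.
apply: le_trans (from_reach _ _ rc) _; rewrite JE -!EFinD lee_fin.
have h1 : g y <= g (x T) + e / 2.
  have := lipg y (x T); rewrite ler_norml => /andP[_].
  have : Kg * `|y - x T| <= e / 2.
    apply: (@le_trans _ _ ((Kg + 1) * eps)).
      by apply: ler_pM => //; rewrite lerDl.
    by rewrite mulrC -ler_pdivlMr// /eps ge_min lexx orbT.
  lra.
have h2 : eps <= e / 2 by rewrite /eps ge_min lexx.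
lra.
Qed.

End value_le_variational.

Theorem theorem2 (R : realType) (n m : nat) (T : R) (U : set 'rV[R]_m)
    (f : R -> 'rV[R]_n -> 'rV[R]_m -> 'rV[R]_n)
    (L : R -> 'rV[R]_n -> 'rV[R]_m -> R)
    (g : 'rV[R]_n -> R)
    (Omega : set 'rV[R]_n) (normal : 'rV[R]_n -> 'rV[R]_n) :
  0 < T ->
  U !=set0 -> compact U ->
  lipschitz_tx T U f ->
  lipschitz_tx T U L ->
  (forall t x a, t \in `[0, T] -> U a -> 0 <= L t x a) ->
  lipschitz g ->
  (exists M : R, forall x, `|g x| <= M) ->
  (forall x t, t \in `[0, T] -> compact (neg_fields U f x t)) ->
  open Omega -> bounded_set Omega ->
  convex_set (closure Omega) -> compact (closure Omega) ->
  (forall x, boundary Omega x -> is_outward_unit_normal Omega x (normal x)) ->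
  (exists2 nu : R, 0 < nu &
    forall x t, boundary Omega x -> t \in `[0, T] ->
      exists2 a, U a & dot (f t x a) (normal x) <= - nu) ->
  forall x t, closure Omega x -> t \in `[0, T] ->
    value_function T U f L g Omega x t
      = value_variational T U f L g Omega x t /\
    value_variational T U f L g Omega x t
      = value_relaxed T U f L g Omega x t.
Proof.
move=> T0 U0 _ /lipschitz_bounds[Kf Kf0 Hf] /lipschitz_bounds[KL KL0 HL] L0 lipg _ cB _ _
  convC cC normalP [nu nu0 inward] x t Cx tI.
have /andP[t0 tT] : 0 <= t <= T by move: tI; rewrite in_itv.
pose K := Kf + KL.
have K0 : 0 <= K by rewrite addr_ge0.
have KfK : Kf <= K by rewrite lerDl.
have KLK : KL <= K by rewrite lerDr.
have lipf := Hf K KfK; have lipL := HL K KLK.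
have L0' s y a : s \in `[0, T] -> U a -> 0 <= L s y a by exact: L0.
have I0 : 0 \in `[0, T] by rewrite in_itv/= lexx ltW.
have [M M0 boundf] := velocity_bound (ltW T0) K0 lipf (cB 0 0 I0) cC.
have [Kg Kg0 Hg] : exists2 Kg, 0 <= Kg & forall y z, `|g y - g z| <= Kg * `|y - z|.
  move: lipg => [b [_ Hb]]; exists (`|b| + 1) => [|y z]; first by rewrite addr_ge0.
  apply: (Hb (`|b| + 1) _ (y, z)) => //.
  by rewrite (le_lt_trans (ler_norm _))// ltrDl.
split; apply/eqP; rewrite eq_le; apply/andP; split.
- exact: (value_le_variational U0 K0 Kg0 M0 nu0 t0 tT lipf lipL L0' Hg boundf cC convC normalP inward).
- exact: variational_le_value.
- exact: variational_le_relaxed.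
- exact: (relaxed_le_variational _ _ _ U0 K0 t0 lipf lipL L0' cB).
Qed.
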